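(* For any $\mathrm{SU}(3)$-invariant Hermitian structure $(g,J)$ on $\mathbb F_2=\mathrm{SU}(3)/T^2$ (i.e. $J$ integrable) there are, up to gauge, at most two invariant irreducible HYM connections with gauge group $\mathrm{SO}(3)$. Using the action of the Weyl group to arrange that $J=J^i$, with metric determined by $A_1,A_2,A_3>0$, these are the following: (1) the connection $$A=r_1\otimes\tfrac{T_1}{2}\pm\sqrt{1-A_1^2\left(\tfrac1{2A_2^2}-\tfrac1{2A_3^2}\right)}\,(\eta_1\otimes T_2-\theta_1\otimes T_3)$$ on $P_{r_1}$, which exists in case $\mu(L_{r_1})<0$, i.e. $A_1^2(A_3^2-A_2^2)<2A_2^2A_3^2$; (2) the connection $$A=r_2\otimes\tfrac{T_1}{2}\pm\sqrt{1+A_2^2\left(\tfrac1{2A_3^2}-\tfrac1{2A_1^2}\right)}\,(\eta_2\otimes T_2-\theta_2\otimes T_3)$$ on $P_{r_2}$, which exists in case $\mu(L_{r_2})<0$, i.e. $A_2^2(A_3^2-A_1^2)<2A_3^2A_1^2$. Moreover, when equality, rather than strict inequality, holds in either case, the connection $A$ becomes reducible.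
   Context: Flag manifold: $T^2\subset\mathrm{SU}(3)$ is the diagonal maximal torus. Write the Maurer–Cartan form of $\mathrm{SU}(3)$ as $$g^{-1}dg=\begin{pmatrix} i\beta_1&\theta_3+i\eta_3&-\theta_2+i\eta_2\\ -\theta_3+i\eta_3&i\beta_2&\theta_1+i\eta_1\\ \theta_2+i\eta_2&-\theta_1+i\eta_1&i\beta_3\end{pmatrix},\qquad \beta_1+\beta_2+\beta_3=0,$$ with real left-invariant 1-forms $\beta_i,\eta_i,\theta_i$. Invariant almost Hermitian structures: for $A_j>0$ and $\epsilon_j\in\{\pm1\}$ set $\alpha_j=A_j(\eta_j+i\epsilon_j\theta_j)$; the structure determined by this data has $(1,0)$-forms (pulled back to $\mathrm{SU}(3)$) spanned by $\alpha_1,\alpha_2,\alpha_3$ and $\omega=g(J\cdot,\cdot)=\frac i2\sum_j\alpha_j\wedge\bar\alpha_j$. $J$ is integrable iff $\epsilon_1\epsilon_2+\epsilon_1\epsilon_3+\epsilon_2\epsilon_3+1=0$; up to the action of the Weyl group of $\mathrm{SU}(3)$ on $\mathbb F_2$ the only integrable one is $J^i$, given by $(\epsilon_1,\epsilon_2,\epsilon_3)=(1,1,-1)$. Weights and bundles: an integral weight is $\beta=k\beta_1+l\beta_2$, $k,l\in\mathbb Z$, with $e^{i\beta}:T^2\to\mathrm U(1)$, $\mathrm{diag}(e^{is_1},e^{is_2},e^{-i(s_1+s_2)})\mapsto e^{i(ks_1+ls_2)}$; $r_1=\beta_1+2\beta_2$, $r_2=-2\beta_1-\beta_2$, $r_3=\beta_1-\beta_2$.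 Let $\lambda_\beta=\mathrm{diag}(e^{i\beta/2},e^{-i\beta/2}):T^2\to\mathrm{SU}(2)/\mathbb Z_2=\mathrm{SO}(3)$, $P_\beta=\mathrm{SU}(3)\times_{(T^2,\lambda_\beta)}\mathrm{SO}(3)$ (all homogeneous $\mathrm{SO}(3)$-bundles are of this form, and $P_\beta\cong P_{-\beta}$), $L_\beta=\mathrm{SU}(3)\times_{(T^2,e^{i\beta})}\mathbb C$. The slope (a positive multiple of $\langle c_1(L_\beta)\cup[\omega^2],[\mathbb F_2]\rangle$) is $\mu(L_\beta)=\frac23\left(-\frac{l}{\epsilon_1A_1^2}+\frac{k}{\epsilon_2A_2^2}-\frac{k-l}{\epsilon_3A_3^2}\right)$. $T_1,T_2,T_3$ is the basis of $\mathfrak{so}(3)\cong\mathfrak{su}(2)$ with $[T_1,T_2]=2T_3$ and cyclic permutations, $T_1=\mathrm{diag}(i,-i)$. Invariant connections on $P_\beta$ are written as $\mathfrak{so}(3)$-valued left-invariant 1-forms on $\mathrm{SU}(3)$. A connection is HYM if $F_A^{0,2}=0$ and $F_A\wedge\omega^2=0$. It is irreducible if it does not reduce to a principal subbundle with structure group a proper closed subgroup. *)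

(* Defs.v *)
From HB Require Import structures.
From mathcomp Require Import all_boot all_order all_fingroup all_algebra.
From mathcomp Require Import ring.
From mathcomp Require Import sesquilinear spectral complex.
From mathcomp Require Import all_classical all_reals all_analysis.
Import Order.TTheory GRing.Theory Num.Theory.
Import numFieldNormedType.Exports.
Set Implicit Arguments.
Unset Strict Implicit.
Unset Printing Implicit Defensive.
Local Open Scope classical_set_scope.
Local Open Scope ring_scope.
Local Open Scope complex_scope.

(* Indices 1, 2, 3 of the mathematics are the elements 0, 1, 2 of 'I_3, on
   which + is addition modulo 3. *)
Definition tri (K : nzRingType) (x1 x2 x3 : K) : 'I_3 -> K :=
  fun j => [:: x1; x2; x3]`_j.

Definition mx3 (K : nzRingType) (rows : seq (seq K)) : 'M[K]_3 :=
  \matrix_(i, j) (nth [::] rows i)`_j.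

Definition lieb (K : nzRingType) (X Y : 'M[K]_3) : 'M[K]_3 := X *m Y - Y *m X.

Definition SU3 (R : realType) : set 'M[R[i]]_3 :=
  [set g | g \is unitarymx /\ \det g = 1].

Definition T2 (R : realType) : set 'M[R[i]]_3 :=
  [set t | @SU3 R t /\ is_diag_mx t].

Definition su3 (R : realType) : set 'M[R[i]]_3 :=
  [set X | (X^t*)%sesqui = - X /\ \tr X = 0].

Definition SO3 (R : realType) : set 'M[R]_3 :=
  [set a | a *m a^T = 1%:M /\ \det a = 1].

(* Left-invariant forms on SU(3) are identified with (multilinear) functions
   on su(3); the value on X is the value on the left-invariant field g X.
   On su(3) the entry (j+1, j+2) is theta_j + i eta_j for every j modulo 3,
   see [maurer_cartan] below. *)
Definition beta (R : realType) (j : 'I_3) (X : 'M[R[i]]_3) : R :=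
  complex.Im (X j j).
Definition eta (R : realType) (j : 'I_3) (X : 'M[R[i]]_3) : R :=
  complex.Im (X (j + 1) (j + 2)).
Definition theta (R : realType) (j : 'I_3) (X : 'M[R[i]]_3) : R :=
  complex.Re (X (j + 1) (j + 2)).

Lemma maurer_cartan (R : realType) (X : 'M[R[i]]_3) : su3 X ->
  X = mx3 [::
    [:: 0 +i* beta 0 X; theta 2 X +i* eta 2 X; - theta 1 X +i* eta 1 X];
    [:: - theta 2 X +i* eta 2 X; 0 +i* beta 1 X; theta 0 X +i* eta 0 X];
    [:: theta 1 X +i* eta 1 X; - theta 0 X +i* eta 0 X; 0 +i* beta 2 X]].
Proof.
case=> /matrixP XH _.
have H i j : X j i = - conjc (X i j).
  by apply/eqP; rewrite -eqr_oppLR; apply/eqP; have := XH j i; rewrite !mxE.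
have D i : X i i = 0 +i* beta i X.
  have := H i i; rewrite /beta; case: (X i i) => a b /= [/eqP].
  by rewrite -subr_eq0 opprK -mulr2n mulrn_eq0 /= => /eqP ->.
have E i j : X i j = complex.Re (X i j) +i* complex.Im (X i j).
  by case: (X i j).
have F i j : X j i = - complex.Re (X i j) +i* complex.Im (X i j).
  by rewrite H; case: (X i j) => a b; congr (_ +i* _); rewrite /= opprK.
have s12 : (1 + 2 = 0 :> 'I_3) by apply: val_inj.
have s11 : (1 + 1 = 2 :> 'I_3) by apply: val_inj.
have s21 : (2 + 1 = 0 :> 'I_3) by apply: val_inj.
have s22 : (2 + 2 = 1 :> 'I_3) by apply: val_inj.
rewrite /eta /theta !(s11, s12, s21, s22, add0r).
have o0 h : @Ordinal 3 0 h = 0 by apply: val_inj.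
have o1 h : @Ordinal 3 1 h = 1 by apply: val_inj.
have o2 h : @Ordinal 3 2 h = 2 by apply: val_inj.
by apply/matrixP => i j; rewrite mxE;
  case: i => -[|[|[|//]]] hi; case: j => -[|[|[|//]]] hj /=;
  rewrite ?(o0, o1, o2) -?(D, E, F).
Qed.

(* d a (X, Y) = - a [X, Y] for a left-invariant 1-form a. *)
Definition dform (R : realType) (V : zmodType) (a : 'M[R[i]]_3 -> V)
  (X Y : 'M[R[i]]_3) : V := - a (lieb X Y).

(* A pair Z stands for the element Z.1 + i Z.2 of the abstract
   complexification of su(3); [ext1] and [ext2] are the complex-multilinear
   extensions of 1-forms and 2-forms on su(3). *)
Definition su3C (R : realType) : set ('M[R[i]]_3 * 'M[R[i]]_3) :=
  [set Z | su3 Z.1 /\ su3 Z.2].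
Definition ext1 (R : realType) (V : lmodType R[i]) (a : 'M[R[i]]_3 -> V)
  (Z : 'M[R[i]]_3 * 'M[R[i]]_3) : V := a Z.1 + 'i *: a Z.2.
Definition ext2 (R : realType) (V : lmodType R[i])
  (F : 'M[R[i]]_3 -> 'M[R[i]]_3 -> V) (Z W : 'M[R[i]]_3 * 'M[R[i]]_3) : V :=
  F Z.1 W.1 - F Z.2 W.2 + 'i *: (F Z.1 W.2 + F Z.2 W.1).

Record ahs (R : realType) := AHS { sizes : 'I_3 -> R; signs : 'I_3 -> R }.

Definition is_ahs (R : realType) (S : ahs R) : Prop :=
  forall j, 0 < sizes S j /\ (signs S j = 1 \/ signs S j = -1).

Definition alpha (R : realType) (S : ahs R) (j : 'I_3) (X : 'M[R[i]]_3)
  : R[i]^o := (sizes S j)%:C * (eta j X +i* (signs S j * theta j X)).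

Definition omega (R : realType) (S : ahs R) (X Y : 'M[R[i]]_3) : R[i] :=
  'i / 2 * \sum_j (alpha S j X * conjc (alpha S j Y) -
                   alpha S j Y * conjc (alpha S j X)).

(* Complex tangent vectors of SU(3) whose projection to F_2 is of type (0,1). *)
Definition type01 (R : realType) (S : ahs R)
  : set ('M[R[i]]_3 * 'M[R[i]]_3) :=
  [set Z | su3C Z /\ forall j, ext1 (alpha S j) Z = 0].

(* The exterior derivatives of (1,0)-forms have no (0,2)-part. *)
Definition integrable_ahs (R : realType) (S : ahs R) : Prop :=
  forall Z W, type01 S Z -> type01 S W ->
  forall j, ext2 (dform (alpha S j)) Z W = 0.

Definition Ji (R : realType) (A1 A2 A3 : R) : ahs R :=
  AHS (tri A1 A2 A3) (tri 1 1 (-1)).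

(* S' is the pull-back of S by the Weyl group element gT |-> gnT, where n
   normalises T^2; g |-> g n pulls a left-invariant form a on SU(3) back to
   X |-> a (n^-1 X n). *)
Definition Adinv (R : realType) (n X : 'M[R[i]]_3) : 'M[R[i]]_3 :=
  invmx n *m X *m n.
Definition weyl_pullback (R : realType) (n : 'M[R[i]]_3) (S S' : ahs R)
  : Prop :=
  [/\ SU3 n, forall t, T2 t -> T2 (Adinv n t),
      forall Z, su3C Z -> (type01 S (Adinv n Z.1, Adinv n Z.2) <-> type01 S' Z)
    & forall X Y, su3 X -> su3 Y ->
        omega S (Adinv n X) (Adinv n Y) = omega S' X Y].

(* so(3) = su(2) acts on itself by ad; T1, T2, T3 below are the matrices of
   ad T_1, ad T_2, ad T_3 in the basis T_1, T_2, T_3, and SU(2)/Z_2 is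
   identified with SO(3) by Ad in the same basis. *)
Definition soT1 (R : realType) : 'M[R]_3 :=
  mx3 [:: [:: 0; 0; 0]; [:: 0; 0; -2]; [:: 0; 2; 0]].
Definition soT2 (R : realType) : 'M[R]_3 :=
  mx3 [:: [:: 0; 0; 2]; [:: 0; 0; 0]; [:: -2; 0; 0]].
Definition soT3 (R : realType) : 'M[R]_3 :=
  mx3 [:: [:: 0; -2; 0]; [:: 2; 0; 0]; [:: 0; 0; 0]].

Lemma lieb_soT (R : realType) :
  [/\ lieb (soT1 R) (soT2 R) = 2 *: soT3 R,
      lieb (soT2 R) (soT3 R) = 2 *: soT1 R
    & lieb (soT3 R) (soT1 R) = 2 *: soT2 R].
Proof.
by split; apply/matrixP => i j; rewrite !mxE !big_ord_recl !big_ord0 !mxE;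
  case: i => -[|[|[|//]]] hi; case: j => -[|[|[|//]]] hj /=; ring.
Qed.

Definition weight (R : realType) (k l : int) (X : 'M[R[i]]_3) : R :=
  k%:~R * beta 0 X + l%:~R * beta 1 X.

Definition character (R : realType) (k l : int) (t : 'M[R[i]]_3) : R[i] :=
  t 0 0 ^ k * t 1 1 ^ l.

(* Ad of diag(e^{is/2}, e^{-is/2}) is the rotation by the angle s about T_1. *)
Definition lam (R : realType) (k l : int) (t : 'M[R[i]]_3) : 'M[R]_3 :=
  let z := character k l t in
  mx3 [:: [:: 1; 0; 0];
          [:: 0; complex.Re z; - complex.Im z];
          [:: 0; complex.Im z; complex.Re z]].

Definition slope (R : realType) (S : ahs R) (k l : int) : R :=
  2 / 3 * (- (l%:~R / (signs S 0 * sizes S 0 ^+ 2))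
           + k%:~R / (signs S 1 * sizes S 1 ^+ 2)
           - (k - l)%:~R / (signs S 2 * sizes S 2 ^+ 2)).

(* An invariant connection on P_beta, beta = k beta_1 + l beta_2, given by its
   pull-back to SU(3); only the values of [cform] on su(3) matter. *)
Record conn (R : realType) :=
  Conn { wk : int; wl : int; cform : 'M[R[i]]_3 -> 'M[R]_3 }.

Definition is_conn (R : realType) (B : conn R) : Prop :=
  [/\ forall (a : R) X Y, su3 X -> su3 Y ->
        cform B (a%:C *: X + Y) = a *: cform B X + cform B Y,
      forall X, su3 X -> (cform B X)^T = - cform B X,
      forall X, su3 X -> is_diag_mx X ->
        cform B X = (weight (wk B) (wl B) X / 2) *: soT1 R
    & forall t X, T2 t -> su3 X ->
        cform B (t *m X *m invmx t) =
        lam (wk B) (wl B) t *m cform B X *m invmx (lam (wk B) (wl B) t)].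

Definition curv (R : realType) (B : conn R) (X Y : 'M[R[i]]_3) : 'M[R]_3 :=
  dform (cform B) X Y + lieb (cform B X) (cform B Y).

Definition curvC (R : realType) (B : conn R) (X Y : 'M[R[i]]_3)
  : 'M[R[i]]_3 := map_mx (real_complex R) (curv B X Y).

(* The 6-form F /\ omega /\ omega. *)
Definition curv_omega2 (R : realType) (S : ahs R) (B : conn R)
  (X : 'I_6 -> 'M[R[i]]_3) : 'M[R[i]]_3 :=
  8^-1 *: \sum_(s : 'S_6)
    ((-1) ^+ s * omega S (X (s 2)) (X (s 3)) * omega S (X (s 4)) (X (s 5))) *:
      curvC B (X (s 0)) (X (s 1)).

Definition HYM (R : realType) (S : ahs R) (B : conn R) : Prop :=
  (forall Z W, type01 S Z -> type01 S W -> ext2 (curvC B) Z W = 0) /\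
  (forall X, (forall m, su3 (X m)) -> curv_omega2 S B X = 0).

(* Topology and smoothness on SU(3), as a subspace of R^18. *)
Definition realmx (R : realType) (g : 'M[R[i]]_3) : 'M[R]_3 * 'M[R]_3 :=
  (map_mx (@complex.Re R) g, map_mx (@complex.Im R) g).

Definition nbhsSU3 (R : realType) (g : 'M[R[i]]_3) : set_system 'M[R[i]]_3 :=
  [set U | exists2 V, nbhs (realmx g) V &
             forall h, SU3 h -> V (realmx h) -> U h].

Definition openSU3 (R : realType) (U : set 'M[R[i]]_3) : Prop :=
  U `<=` @SU3 R /\ forall g, U g -> nbhsSU3 g U.

(* V is the derivative of f at g in the direction of the tangent vector g X. *)
Definition left_derive (R : realType) (f : 'M[R[i]]_3 -> 'M[R]_3)
  (g X : 'M[R[i]]_3) (V : 'M[R]_3) : Prop :=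
  forall c : R -> 'M[R[i]]_3, (forall t, SU3 (c t)) -> c 0 = g ->
  is_derive (0 : R) 1 (fun t => realmx (c t)) (realmx (g *m X)) ->
  is_derive (0 : R) 1 (fun t => f (c t)) V.

Fixpoint Cn_on (R : realType) (n : nat) (U : set 'M[R[i]]_3)
  (f : 'M[R[i]]_3 -> 'M[R]_3) : Prop :=
  (forall g, U g -> f @ nbhsSU3 g --> f g) /\
  if n is m.+1 then
    forall X, su3 X -> exists2 f',
      (forall g, U g -> left_derive f g X (f' g)) & Cn_on m U f'
  else True.

Definition smooth_on (R : realType) (U : set 'M[R[i]]_3)
  (f : 'M[R[i]]_3 -> 'M[R]_3) : Prop := forall n, Cn_on n U f.

Definition closed_subgroup (R : realType) (H : set 'M[R]_3) : Prop :=
  [/\ H `<=` @SO3 R, H 1%:M,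
      forall a b, H a -> H b -> H (a *m b), forall a, H a -> H (invmx a)
    & closed H].

(* The Lie algebra of H: the generators of one-parameter subgroups in H. *)
Definition lie_alg (R : realType) (H : set 'M[R]_3) : set 'M[R]_3 :=
  [set Y | exists c : R -> 'M[R]_3,
     [/\ c 0 = 1%:M, forall t : R, is_derive t 1 c (c t *m Y)
       & forall t, H (c t)]].

(* A principal H-subbundle of P_beta is given by its preimage
   {(g, a) | Q g a} under SU(3) x SO(3) -> P_beta, (g, a) |-> [g, a], where
   [g t, a] = [g, lam(t) a].  The connection reduces to it if its pull-back by
   local sections a = s(g) is h-valued. *)
Definition reduces_to (R : realType) (B : conn R) (H : set 'M[R]_3) : Prop :=
  exists Q : 'M[R[i]]_3 -> set 'M[R]_3,
  [/\ forall g, SU3 g -> exists2 a, SO3 a & Q g = [set a *m h | h in H],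
      forall g t a, SU3 g -> T2 t -> Q g a ->
        Q (g *m t) (invmx (lam (wk B) (wl B) t) *m a)
    & forall g0, SU3 g0 -> exists U s,
      [/\ openSU3 U, U g0, smooth_on U s, forall g, U g -> Q g (s g)
        & forall g X, U g -> su3 X -> exists2 V, left_derive s g X V &
            lie_alg H (invmx (s g) *m cform B X *m s g + invmx (s g) *m V)]].

Definition reducible (R : realType) (B : conn R) : Prop :=
  exists H : set 'M[R]_3,
    [/\ closed_subgroup H, H <> @SO3 R & reduces_to B H].

Definition irreducible_HYM (R : realType) (S : ahs R) (B : conn R) : Prop :=
  [/\ is_conn B, HYM S B & ~ reducible B].

(* The bundle isomorphism [g, a] |-> [g, u(g) a] from P_beta' to P_beta pulls
   B back to B' = u^-1 B u + u^-1 du. *)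
Definition gauge_equiv (R : realType) (B B' : conn R) : Prop :=
  exists u : 'M[R[i]]_3 -> 'M[R]_3,
  [/\ forall g, SU3 g -> SO3 (u g), smooth_on (@SU3 R) u,
      forall g t, SU3 g -> T2 t ->
        u (g *m t) =
        invmx (lam (wk B) (wl B) t) *m u g *m lam (wk B') (wl B') t
    & forall g X, SU3 g -> su3 X -> exists2 V, left_derive u g X V &
        cform B' X = invmx (u g) *m cform B X *m u g + invmx (u g) *m V].

(* The bit b is the choice of sign in front of the square root. *)
Definition conn_r1 (R : realType) (A1 A2 A3 : R) (b : bool) : conn R :=
  Conn 1 2 (fun X => weight 1 2 X *: (2^-1 *: soT1 R) +
    ((-1) ^+ b *
     Num.sqrt (1 - A1 ^+ 2 * (1 / (2 * A2 ^+ 2) - 1 / (2 * A3 ^+ 2)))) *: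
    (eta 0 X *: soT2 R - theta 0 X *: soT3 R)).

Definition conn_r2 (R : realType) (A1 A2 A3 : R) (b : bool) : conn R :=
  Conn (-2) (-1) (fun X => weight (-2) (-1) X *: (2^-1 *: soT1 R) +
    ((-1) ^+ b *
     Num.sqrt (1 + A2 ^+ 2 * (1 / (2 * A3 ^+ 2) - 1 / (2 * A1 ^+ 2)))) *:
    (eta 1 X *: soT2 R - theta 1 X *: soT3 R)).

(* Main.v *)
From mathcomp Require Import all_boot all_order all_fingroup all_algebra.
From mathcomp Require Import ring lra zify.
From mathcomp Require Import complex.
From mathcomp Require Import all_classical all_reals all_analysis.
Require Import Defs.
Import Order.TTheory GRing.Theory Num.Theory.
Import numFieldNormedType.Exports.
Set Implicit Arguments.
Unset Strict Implicit.
Unset Printing Implicit Defensive.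
Local Open Scope classical_set_scope.
Local Open Scope ring_scope.
Local Open Scope complex_scope.

(** Under Ad(T^2) the Lie algebra su(3) is the sum of the diagonal part and of three
real planes V_0, V_1, V_2 with coordinates z_j = theta_j + i eta_j; the torus
rotates V_j by the character of the root r_j (indices are taken modulo 3 and
start at 0).  In the same way so(3) is, for the action through lam, the sum of
the line of T_1 and of the plane of T_2 and T_3, which is rotated by the
character of the weight beta of the bundle.

_Invariant connections._  The form of an invariant connection on P_beta is
(beta / 2) T_1 plus an equivariant linear map from V_0 + V_1 + V_2 to so(3).  By
Schur's lemma, which here is a comparison of cosines ([equivariant_plane]), this
map is zero unless beta is r_j or -r_j for some j, and then it lives on V_j
alone and is a similarity onto the plane of T_2 and T_3 ([conn_structure]).  If
it is zero, the connection takes its values in the line of T_1 and reduces to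
SO(2) ([torus_conn_reducible]).  If not, a constant gauge transformation brings
the connection to the form
r_j T_1 / 2 + c (eta_j T_2 - theta_j T_3) with c > 0 ([conn_normalize]).

_The Hermitian Yang-Mills equations._  The curvature of this model
([curv_root_conn]) has the T_1-component
2 (1 - c^2) eta_j /\ theta_j - eta_(j+1) /\ theta_(j+1)
- eta_(j+2) /\ theta_(j+2), which is of type (1,1) for every choice of signs,
while its T_3- and T_2-components are c times the real and imaginary parts of
z_(j+2) /\ z_(j+1).  Since z_k is of type (0,1) or (1,0) according as eps_k is 1
or -1, there is no (0,2)-part exactly when c = 0 or eps_(j+1) eps_(j+2) = -1.
With omega = sum_k w_k eta_k /\ theta_k, w_k = eps_k A_k^2, the equation
F /\ omega^2 = 0 only sees the T_1-component and says that
c^2 = 1 - w_j (1 / (2 w_(j+1)) + 1 / (2 w_(j+2))); this is [HYM_root_conn].  Two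
of the three signs agree, so at most two indices j are admissible, and each of
them determines c up to a sign that a gauge transformation removes.  For J^i the
admissible indices are 0 and 1; the slope of r_j is a negative multiple of the
right-hand side ([slope_Ji]), so a solution with c <> 0 exists when the slope is
negative, and c = 0 when it vanishes.

_Irreducibility for c <> 0_ ([root_conn_irreducible]).  The Lie algebra of a
proper closed subgroup of SO(3) lies in a line R K ([lie_alg_line]), because two
one-parameter groups of rotations about different axes generate SO(3).  If the
connection A reduces to such a subgroup, there is a local map s to SO(3) near
the identity of SU(3) such that xi = s K s^T satisfies d xi = [xi, A].  As A
vanishes on V_(j+1) and V_(j+2), xi is constant on the surface e^(tX) e^(uY) with
X in V_(j+1) and Y in V_(j+2).  But the direction Ad(e^(-uY)) X of this surface has a
component in [V_(j+1), V_(j+2)] = V_j, hence xi(1) commutes with A(V_j), the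
plane of T_2 and T_3, and is zero: a contradiction.

_Integrability and the Weyl group._  Modulo multiples of z_j and its conjugate,
the differential of the conjugate of z_j is z_(j+1) /\ z_(j+2), up to sign, so J
is integrable exactly when the three signs are not all equal ([integrable_signs],
[signs_integrable]).  Cyclic permutations of the indices, and transpositions,
which also reverse all signs, then lead to J^i ([weyl_to_Ji]). *)

(** * Three-by-three matrices with cyclic indices *)

Lemma ord3P (P : 'I_3 -> Prop) : P 0 -> P 1 -> P 2 -> forall i, P i.
Proof.
move=> P0 P1 P2 [[|[|[|//]]] hi].
- by rewrite (_ : Ordinal hi = 0)//; exact: val_inj.
- by rewrite (_ : Ordinal hi = 1)//; exact: val_inj.
- by rewrite (_ : Ordinal hi = 2)//; exact: val_inj.
Qed.

Lemma addI3 : ((1 + 1 = 2 :> 'I_3) * (1 + 2 = 0 :> 'I_3)) *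
  ((2 + 1 = 0 :> 'I_3) * (2 + 2 = 1 :> 'I_3)).
Proof. by do ![split]; exact: val_inj. Qed.

Lemma sum3 (V : zmodType) (F : 'I_3 -> V) : \sum_i F i = F 0 + F 1 + F 2.
Proof.
rewrite !big_ord_recl big_ord0 addr0 addrA /=.
by congr (F _ + F _ + F _); apply: val_inj.
Qed.

Lemma mulmx3 (K : nzRingType) (m n : nat) (A : 'M[K]_(m, 3)) (B : 'M[K]_(3, n)) i j :
  (A *m B) i j = A i 0 * B 0 j + A i 1 * B 1 j + A i 2 * B 2 j.
Proof. by rewrite mxE sum3. Qed.

Lemma mx3P (K : Type) (A B : 'M[K]_3) :
  [/\ A 0 0 = B 0 0, A 0 1 = B 0 1 & A 0 2 = B 0 2] ->
  [/\ A 1 0 = B 1 0, A 1 1 = B 1 1 & A 1 2 = B 1 2] ->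
  [/\ A 2 0 = B 2 0, A 2 1 = B 2 1 & A 2 2 = B 2 2] -> A = B.
Proof.
by move=> [? ? ?] [? ? ?] [? ? ?]; apply/matrixP => i j; move: i j; do 2 elim/ord3P.
Qed.

Lemma mx3E (K : nzRingType) (a b c d e f g h i : K) :
  let M := mx3 [:: [:: a; b; c]; [:: d; e; f]; [:: g; h; i]] in
  (((M 0 0 = a) * (M 0 1 = b) * (M 0 2 = c)) *
   ((M 1 0 = d) * (M 1 1 = e) * (M 1 2 = f)) *
   ((M 2 0 = g) * (M 2 1 = h) * (M 2 2 = i)))%type.
Proof. by do ![split]; rewrite mxE. Qed.

Lemma eqI3 : (((0 == 1 :> 'I_3) = false) * ((0 == 2 :> 'I_3) = false) *
  ((1 == 0 :> 'I_3) = false) * ((1 == 2 :> 'I_3) = false) *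
  ((2 == 0 :> 'I_3) = false) * ((2 == 1 :> 'I_3) = false))%type.
Proof. by []. Qed.

Lemma det3 (K : comNzRingType) (A : 'M[K]_3) :
  \det A = A 0 0 * (A 1 1 * A 2 2 - A 1 2 * A 2 1)
         - A 0 1 * (A 1 0 * A 2 2 - A 1 2 * A 2 0)
         + A 0 2 * (A 1 0 * A 2 1 - A 1 1 * A 2 0).
Proof.
have det2 (B : 'M[K]_2) : \det B = B 0 0 * B 1 1 - B 0 1 * B 1 0.
  rewrite (expand_det_row _ 0) !big_ord_recl big_ord0 addr0 /cofactor !det_mx11.
  rewrite !mxE /= expr0 expr1 mul1r mulN1r mulrN.
  by congr (_ * B _ _ - B _ _ * B _ _); exact: val_inj.
have e : ((lift 0 (0 : 'I_2) = 1 :> 'I_3) * (lift 0 (1 : 'I_2) = 2 :> 'I_3) *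
     (lift 1 (0 : 'I_2) = 0 :> 'I_3) * (lift 1 (1 : 'I_2) = 2 :> 'I_3) *
     (lift 2 (0 : 'I_2) = 0 :> 'I_3) * (lift 2 (1 : 'I_2) = 1 :> 'I_3))%type.
  by do ![split]; exact: val_inj.
rewrite (expand_det_row _ 0) sum3 /cofactor !det2 !mxE !e.
by rewrite /= expr0 expr1 sqrrN expr1n !mul1r !mulN1r; ring.
Qed.

(** Counting the indices from a variable base point j lets one computation cover
the three root planes at once. *)
Lemma addI3c (j : 'I_3) : ((j + 1 + 1 = j + 2 :> 'I_3) * (j + 1 + 2 = j :> 'I_3)) *
  ((j + 2 + 1 = j :> 'I_3) * (j + 2 + 2 = j + 1 :> 'I_3)).
Proof. by elim/ord3P: j; do ![split]; exact: val_inj. Qed.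

Lemma sum3c (V : zmodType) (F : 'I_3 -> V) (j : 'I_3) :
  \sum_i F i = F j + F (j + 1) + F (j + 2).
Proof.
rewrite sum3; elim/ord3P: j; rewrite ?add0r ?addI3 //.
- by rewrite [RHS]addrC addrA.
- by rewrite -[RHS]addrA [RHS]addrC.
Qed.

Lemma eqI3c (j : 'I_3) :
  ((((j == j + 1) = false) * ((j == j + 2) = false)) *
   (((j + 1 == j) = false) * ((j + 1 == j + 2) = false))) *
   (((j + 2 == j) = false) * ((j + 2 == j + 1) = false)).
Proof. by elim/ord3P: j. Qed.

Lemma ord3cP (j i : 'I_3) : [\/ i = j, i = j + 1 | i = j + 2].
Proof.
elim/ord3P: j; elim/ord3P: i; rewrite ?add0r ?addI3;
  first [by constructor 1|by constructor 2|by constructor 3].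
Qed.

Lemma mx3cP (K : Type) (j : 'I_3) (A B : 'M[K]_3) :
  [/\ A j j = B j j, A j (j + 1) = B j (j + 1) & A j (j + 2) = B j (j + 2)] ->
  [/\ A (j + 1) j = B (j + 1) j, A (j + 1) (j + 1) = B (j + 1) (j + 1)
    & A (j + 1) (j + 2) = B (j + 1) (j + 2)] ->
  [/\ A (j + 2) j = B (j + 2) j, A (j + 2) (j + 1) = B (j + 2) (j + 1)
    & A (j + 2) (j + 2) = B (j + 2) (j + 2)] -> A = B.
Proof.
move=> [? ? ?] [? ? ?] [? ? ?]; apply/matrixP.
by move=> a b; case: (ord3cP j a) => ->; case: (ord3cP j b) => ->.
Qed.

Lemma mulmx3c (K : nzRingType) (m n : nat) (j : 'I_3) (A : 'M[K]_(m, 3))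
    (B : 'M[K]_(3, n)) i k :
  (A *m B) i k = A i j * B j k + A i (j + 1) * B (j + 1) k + A i (j + 2) * B (j + 2) k.
Proof. by rewrite mxE (sum3c _ j). Qed.

Lemma det3c (K : comNzRingType) (j : 'I_3) (A : 'M[K]_3) :
  \det A = A j j * (A (j + 1) (j + 1) * A (j + 2) (j + 2)
                  - A (j + 1) (j + 2) * A (j + 2) (j + 1))
         - A j (j + 1) * (A (j + 1) j * A (j + 2) (j + 2)
                          - A (j + 1) (j + 2) * A (j + 2) j)
         + A j (j + 2) * (A (j + 1) j * A (j + 2) (j + 1)
                          - A (j + 1) (j + 1) * A (j + 2) j).
Proof. by rewrite det3; elim/ord3P: j; rewrite ?add0r ?addI3; ring. Qed.

(** * Calculus of matrix-valued functions *)

Lemma is_derive_mxP (R : realType) (m n : nat) (M : R -> 'M[R]_(m, n)) (t : R) dM :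
  is_derive t 1 M dM <-> forall i j, is_derive t 1 (fun x => M x i j) (dM i j).
Proof.
split=> [[Mt <-] i j|H].
  split; first by move/derivable_mxP: Mt.
  by rewrite derive_mx// mxE.
have Mt : derivable M t 1 by apply/derivable_mxP => i j; have [] := H i j.
split=> //; rewrite derive_mx//; apply/matrixP => i j; rewrite mxE.
by have [] := H i j.
Qed.

Lemma is_derive_mulmx (R : realType) (m n p : nat) (f : R -> 'M[R]_(m, n))
    (g : R -> 'M[R]_(n, p)) (t : R) df dg :
  is_derive t 1 f df -> is_derive t 1 g dg ->
  is_derive t 1 (fun x => f x *m g x) (df *m g t + f t *m dg).
Proof.
move=> /is_derive_mxP Hf /is_derive_mxP Hg; apply/is_derive_mxP => i j.
pose h k := ((fun x => f x i k) * (fun x => g x k j))%R.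
have -> : (fun x => (f x *m g x) i j) = \sum_k h k.
  by apply/funext => x; rewrite mxE fct_sumE.
pose dh k := f t i k *: dg k j + g t k j *: df i k.
have -> : (df *m g t + f t *m dg) i j = \sum_k dh k.
  rewrite !mxE -big_split; apply: eq_bigr => k _ /=.
  by rewrite /dh addrC; congr (_ + _); rewrite mulrC.
by apply: is_derive_sum => k; apply: is_deriveM.
Qed.

Lemma is_derive_trmx (R : realType) (m n : nat) (f : R -> 'M[R]_(m, n)) (t : R) df :
  is_derive t 1 f df -> is_derive t 1 (fun x => (f x)^T) df^T.
Proof.
move=> /is_derive_mxP Hf; apply/is_derive_mxP => i j; rewrite mxE.
by under eq_fun do rewrite mxE.
Qed.

Lemma is_derive_cstmx (R : realType) (m n : nat) (a : 'M[R]_(m, n)) (t : R) :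
  is_derive t 1 (fun=> a) 0.
Proof. exact: is_derive_cst. Qed.

Lemma mx_is_derive_0_is_cst (R : realType) (m n : nat)
    (f : R -> 'M[R]_(m, n)) x y :
  (forall t : R, is_derive t 1 f 0) -> f x = f y.
Proof.
move=> H; apply/matrixP => i j.
apply: (@is_derive_0_is_cst _ (fun x => f x i j)) => t.
by have /is_derive_mxP /(_ i j) := H t; rewrite mxE.
Qed.

Lemma is_derive_pair (R : realType) (V W : normedModType R) (f : R -> V)
    (g : R -> W) (t : R) df dg :
  is_derive t 1 f df -> is_derive t 1 g dg ->
  is_derive t 1 (fun x => (f x, g x)) (df, dg).
Proof.
move=> [f1 <-] [g1 <-].
have H : (fun h : R => h^-1 *: ((fun x => (f x, g x)) (h *: 1 + t) -
    (f t, g t))) @ 0^' --> ('D_1 f t, 'D_1 g t).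
  exact: (cvg_pair f1 g1).
split; first by apply/cvg_ex; eexists; exact: H.
exact: (cvg_lim _ H).
Qed.

Lemma is_derive_realmx (R : realType) (c : R -> 'M[R[i]]_3) (t : R) (D : 'M[R[i]]_3) :
  (forall i j, is_derive t 1 (fun x => complex.Re (c x i j))
     (complex.Re (D i j))) ->
  (forall i j, is_derive t 1 (fun x => complex.Im (c x i j))
     (complex.Im (D i j))) ->
  is_derive t 1 (fun x => realmx (c x)) (realmx D).
Proof.
move=> HR HI; apply: is_derive_pair; apply/is_derive_mxP => i j; rewrite mxE.
  by under eq_fun do rewrite mxE; exact: HR.
by under eq_fun do rewrite mxE; exact: HI.
Qed.

Lemma cvg_mx_entries (R : realType) (T : topologicalType) (m n : nat)
    (c : T -> 'M[R]_(m, n)) (x : T) :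
  (forall i j, {for x, continuous (fun y => c y i j)}) -> {for x, continuous c}.
Proof.
move=> H /= A [P PM sPA].
have K : \forall y \near x, forall ij : 'I_m * 'I_n, P ij.1 ij.2 (c y ij.1 ij.2).
  apply: (@filter_forall T _ (fun ij y => P ij.1 ij.2 (c y ij.1 ij.2))).
  by case=> i j; exact: (H i j _ (PM i j)).
by apply: filterS K => y Py; apply: sPA => i j; exact: (Py (i, j)).
Qed.

Lemma continuous_realmx (R : realType) (T : topologicalType)
    (c : T -> 'M[R[i]]_3) (x : T) :
  (forall i j, {for x, continuous (fun y => complex.Re (c y i j))}) ->
  (forall i j, {for x, continuous (fun y => complex.Im (c y i j))}) ->
  {for x, continuous (fun y => realmx (c y))}.
Proof.
move=> HR HI.
have HR' : {for x, continuous (fun y => map_mx (@complex.Re R) (c y))}.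
  apply: cvg_mx_entries => i j.
  rewrite [X in {for x, continuous X}](_ : _ = fun y => complex.Re (c y i j)).
    exact: HR.
  by apply/funext => y; rewrite mxE.
have HI' : {for x, continuous (fun y => map_mx (@complex.Im R) (c y))}.
  apply: cvg_mx_entries => i j.
  rewrite [X in {for x, continuous X}](_ : _ = fun y => complex.Im (c y i j)).
    exact: HI.
  by apply/funext => y; rewrite mxE.
exact: (cvg_pair HR' HI').
Qed.

(** * Rotations and subgroups of SO(3) *)

Lemma SO3P (R : realType) (a : 'M[R]_3) :
  SO3 a -> [/\ a *m a^T = 1%:M, a^T *m a = 1%:M & invmx a = a^T].
Proof.
move=> [aaT _]; have aTa := mulmx1C aaT; split=> //.
have [aU _] := mulmx1_unit aaT.
by rewrite -[RHS](mulKmx aU) aaT mulmx1.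
Qed.

Lemma SO3_mul (R : realType) (a b : 'M[R]_3) : SO3 a -> SO3 b -> SO3 (a *m b).
Proof.
move=> [aa da] [bb db]; split; last by rewrite det_mulmx da db mulr1.
by rewrite trmx_mul mulmxA -(mulmxA a) bb mulmx1.
Qed.

Lemma SO3_tr (R : realType) (a : 'M[R]_3) : SO3 a -> SO3 a^T.
Proof.
by move=> Sa; have [_ aTa _] := SO3P Sa; split; rewrite ?trmxK// det_tr; case: Sa.
Qed.

Lemma SO3_1 (R : realType) : SO3 (1%:M : 'M[R]_3).
Proof. by split; rewrite ?det1// trmx1 mulmx1. Qed.

Lemma sqr2_eq0 (R : realDomainType) (x y : R) :
  x ^+ 2 + y ^+ 2 = 0 -> x = 0 /\ y = 0.
Proof.
by move/eqP; rewrite paddr_eq0 ?sqr_ge0// !sqrf_eq0 => /andP[/eqP ? /eqP].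
Qed.

Lemma circle_angle (R : realType) (a b : R) : a ^+ 2 + b ^+ 2 = 1 ->
  exists t, cos t = a /\ sin t = b.
Proof.
move=> ab; have a1 : -1 <= a <= 1 by apply/andP; split; nra.
have sb : Num.sqrt (1 - a ^+ 2) = `|b| by rewrite -ab addrC addKr sqrtr_sqr.
have [b0|b0] := leP 0 b.
  exists (acos a); rewrite acosK ?in_itv//= sin_acos// sb.
  by split=> //; apply: ger0_norm.
exists (- acos a); rewrite cosN sinN acosK ?in_itv//= sin_acos// sb.
by split=> //; rewrite ltr0_norm ?opprK.
Qed.

Lemma rotate_to (R : realType) (p q p' q' : R) :
  p ^+ 2 + q ^+ 2 = p' ^+ 2 + q' ^+ 2 ->
  exists t, cos t * p - sin t * q = p' /\ sin t * p + cos t * q = q'.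
Proof.
move=> pq; have [n0|n0] := eqVneq (p ^+ 2 + q ^+ 2) 0.
  have [p0 q0] : p = 0 /\ q = 0 by split; nra.
  have [p0' q0'] : p' = 0 /\ q' = 0 by split; nra.
  by exists 0; rewrite p0 q0 p0' q0' !mulr0 subr0 addr0.
(* The rotation is the quotient (p' + i q') / (p + i q). *)
have [|t [ct st]] := @circle_angle _ ((p * p' + q * q') / (p ^+ 2 + q ^+ 2))
   ((p * q' - q * p') / (p ^+ 2 + q ^+ 2)).
  rewrite !expr_div_n -mulrDl.
  have -> : (p * p' + q * q') ^+ 2 + (p * q' - q * p') ^+ 2 =
            (p ^+ 2 + q ^+ 2) * (p' ^+ 2 + q' ^+ 2) by ring.
  by rewrite -pq -expr2 divff// expf_neq0.
by exists t; rewrite ct st; split; field.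
Qed.

Definition rot1 (R : realType) (t : R) : 'M[R]_3 :=
  mx3 [:: [:: 1; 0; 0]; [:: 0; cos t; - sin t]; [:: 0; sin t; cos t]].

Lemma SO3_rot1 (R : realType) (t : R) : SO3 (rot1 t).
Proof.
have cs : cos t ^+ 2 = 1 - sin t ^+ 2 by have := cos2Dsin2 t; lra.
split; last by rewrite det3 !mx3E; ring: cs.
by apply: mx3P; rewrite !mulmx3 !mxE /= ; split; ring: cs.
Qed.

Lemma is_derive_rot1 (R : realType) (k t : R) :
  is_derive t 1 (fun x => rot1 (k * x)) (rot1 (k * t) *m (k / 2 *: soT1 R)).
Proof.
have dk : is_derive t 1 ( *%R k) k.
  by have := is_deriveZ k (is_derive_id t (1 : R)); rewrite /GRing.scale /= mulr1.
have ds : is_derive t 1 (fun x => sin (k * x)) (k * cos (k * t)).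
  by rewrite mulrC; exact: (is_derive1_comp (is_derive_sin _) dk).
have dc : is_derive t 1 (fun x => cos (k * x)) (- (k * sin (k * t))).
  by rewrite -mulNr mulrC mulrN -mulNr; exact: (is_derive1_comp (is_derive_cos _) dk).
have dn : is_derive t 1 (fun x => - sin (k * x)) (- (k * cos (k * t))).
  exact: is_deriveN.
apply/is_derive_mxP; elim/ord3P; elim/ord3P; rewrite mulmx3;
  under eq_fun do rewrite mx3E; rewrite !mxE /=.
all: apply: is_derive_eq; last by field.
Qed.

(** The group axioms in the form in which they pass to conjugates of H. *)
Definition rot_subgroup (R : realType) (H : set 'M[R]_3) : Prop :=
  [/\ H `<=` @SO3 R, forall a b, H a -> H b -> H (a *m b)
    & forall a, H a -> H a^T].

Lemma closed_subgroup_rot (R : realType) (H : set 'M[R]_3) :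
  closed_subgroup H -> rot_subgroup H.
Proof.
move=> [HS _ HM HV _]; split=> // a Ha.
by have [_ _ <-] := SO3P (HS _ Ha); exact: HV.
Qed.

Lemma lie_alg_skew (R : realType) (H : set 'M[R]_3) Y :
  H `<=` @SO3 R -> lie_alg H Y -> Y^T = - Y.
Proof.
move=> HS [c [c0 dc Hc]].
have D := is_derive_mulmx (dc 0) (is_derive_trmx (dc 0)).
have : (fun x => c x *m (c x)^T) = fun=> 1%:M.
  by apply/funext => x; have [] := SO3P (HS _ (Hc x)).
move=> E; rewrite E in D; have [_] := D; rewrite derive_cst c0.
rewrite !mul1mx trmx1 mulmx1 => /esym/eqP.
by rewrite addrC addr_eq0 => /eqP.
Qed.

Lemma skew3 (R : realType) (Y : 'M[R]_3) : Y^T = - Y ->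
  Y = mx3 [:: [:: 0; - Y 1 0; Y 0 2]; [:: Y 1 0; 0; - Y 2 1]; [:: - Y 0 2; Y 2 1; 0]].
Proof.
move=> /matrixP YT.
have E i j : Y j i = - Y i j by have := YT i j; rewrite !mxE.
have Z i : Y i i = 0 by have := E i i; lra.
by apply: mx3P; rewrite !mx3E !Z; split=> //; exact: E.
Qed.

(** Uniqueness for c' = c Y: the product of c with the inverse of the rotation by
2 r x has derivative 0, so c is this rotation. *)
Lemma lie_alg_rot1 (R : realType) (H : set 'M[R]_3) (r : R) :
  H `<=` @SO3 R -> r != 0 -> lie_alg H (r *: soT1 R) -> forall t, H (rot1 t).
Proof.
move=> HS r0 [c [c0 dc Hc]] t.
have cE x : c x = rot1 (2 * r * x).
  pose d x := c x *m (rot1 (2 * r * x))^T.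
  have d0 : d x = d 0.
    apply: mx_is_derive_0_is_cst => y.
    have := is_derive_mulmx (dc y) (is_derive_trmx (is_derive_rot1 (2 * r) y)).
    rewrite trmx_mul (_ : 2 * r / 2 = r); last by field.
    rewrite !mulmxA -mulmxDl -mulmxDr.
    suff -> : r *: soT1 R + (r *: soT1 R)^T = 0 by rewrite mulmx0 mul0mx.
    by rewrite linearZ -scalerDr; apply: mx3P; rewrite !mxE /=; split; ring.
  have /SO3P[_ rTr _] := SO3_rot1 (2 * r * x).
  rewrite -[c x]mulmx1 -rTr mulmxA -/(d x) d0 /d c0 mul1mx mulr0.
  rewrite (_ : rot1 0 = 1%:M) ?trmx1 ?mul1mx//.
  by apply: mx3P; rewrite !mxE /= ?cos0 ?sin0 ?oppr0.
have := Hc (t / (2 * r)); rewrite cE mulrCA divff ?mulr1//.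
by rewrite mulf_neq0 // pnatr_eq0.
Qed.

Lemma SO3_row (R : realType) (a : 'M[R]_3) i : SO3 a ->
  a i 0 ^+ 2 + a i 1 ^+ 2 + a i 2 ^+ 2 = 1.
Proof.
move=> [/matrixP/(_ i i)]; rewrite mulmx3 !mxE eqxx /= !expr2.
by [].
Qed.

Lemma SO3_col (R : realType) (a : 'M[R]_3) i : SO3 a ->
  a 0 i ^+ 2 + a 1 i ^+ 2 + a 2 i ^+ 2 = 1.
Proof. by move/SO3_tr/SO3_row => /(_ i); rewrite !mxE. Qed.

(** As the rows and columns have norm 1, only a block [[x, y], [z, w]] remains, and
(x - w)^2 + (y + z)^2 is the sum of its squared entries minus twice its
determinant, hence 0. *)
Lemma SO3_fix1 (R : realType) (a : 'M[R]_3) : SO3 a -> a 0 0 = 1 ->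
  exists t, a = rot1 t.
Proof.
move=> Sa a00; have := SO3_row 0 Sa; have := SO3_col 0 Sa; rewrite a00 => c0 r0.
have [[a01 a02] [a10 a20]] : (a 0 1 = 0 /\ a 0 2 = 0) /\ (a 1 0 = 0 /\ a 2 0 = 0).
  by split; split; nra.
have c1 := SO3_col 1 Sa; have c2 := SO3_col 2 Sa.
have [_] := Sa; rewrite det3 a00 a01 a02 a10 a20 => D.
have [|t [ct st]] := @circle_angle _ (a 1 1) (a 2 1).
  by rewrite -c1 a01 expr0n add0r.
rewrite a01 a02 in c1 c2.
have : (a 1 1 - a 2 2) ^+ 2 + (a 1 2 + a 2 1) ^+ 2 = 0.
  move: D c1 c2; clear; move: (a 1 1) (a 1 2) (a 2 1) (a 2 2) => x y z w.
  rewrite expr0n !(mul0r, mul1r, subr0, addr0, add0r) => D c1 c2.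
  have -> : (x - w) ^+ 2 + (y + z) ^+ 2 =
    (x ^+ 2 + z ^+ 2) + (y ^+ 2 + w ^+ 2) - 2 * (x * w - y * z) by ring.
  by rewrite D c1 c2; ring.
move=> /sqr2_eq0[/subr0_eq e1 /eqP]; rewrite addr_eq0 => /eqP e2.
by exists t; apply: mx3P; rewrite !mx3E ?ct ?st; split.
Qed.

(** Euler angles: an element h of H with the (0,0)-entry of a can be rotated about
the first axis until its first column is that of a, and then h^T a fixes the
first axis. *)
Lemma rot_subgroup_full (R : realType) (H : set 'M[R]_3) :
  rot_subgroup H -> (forall t, H (rot1 t)) ->
  (forall x : R, -1 <= x <= 1 -> exists2 h, H h & h 0 0 = x) -> @SO3 R `<=` H.
Proof.
move=> [HS HM HT] Hrot Hx a Sa.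
have a1 : -1 <= a 0 0 <= 1.
  have := SO3_row 0 Sa; have := sqr_ge0 (a 0 1); have := sqr_ge0 (a 0 2).
  by move=> ? ? ?; apply/andP; split; nra.
have [h Hh h0] := Hx _ a1.
have [|t [t1 t2]] := @rotate_to _ (h 1 0) (h 2 0) (a 1 0) (a 2 0).
  have := SO3_col 0 Sa; rewrite -(SO3_col 0 (HS _ Hh)) h0.
  by rewrite -!addrA => /addrI.
pose g := rot1 t *m h.
have Hg : H g by exact: HM.
have gS := HS _ Hg; have [gg' _ _] := SO3P gS.
have gc : forall i, g i 0 = a i 0.
  by elim/ord3P; rewrite mulmx3 !mx3E ?h0; [ring|rewrite -t1; ring|rewrite -t2; ring].
have Sg := SO3_mul (SO3_tr gS) Sa.
have [|s sE] := SO3_fix1 Sg.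
  rewrite -(SO3_col 0 gS) mulmx3 -!gc !expr2; congr (_ + _ + _); congr (_ * _); exact: mxE.
by rewrite -[a]mul1mx -gg' -mulmxA sE; exact: HM.
Qed.

(** With S containing [z, 1], z >= 0, it contains [2 z^2 - 1, 1]; each step at least
doubles the distance 1 - z until it reaches 1, and one more step from [0, 1]
reaches -1. *)
Lemma doubling_fills (R : realType) (S : set R) (x : R) :
  x < 1 -> (forall y : R, x <= y <= 1 -> S y) ->
  (forall y : R, S y -> S (2 * y ^+ 2 - 1)) -> forall y : R, -1 <= y <= 1 -> S y.
Proof.
move=> x1 Sx S2.
have step (z : R) : 0 <= z -> (forall y : R, z <= y <= 1 -> S y) ->
    forall y : R, 2 * z ^+ 2 - 1 <= y <= 1 -> S y.
  move=> z0 Sz y /andP[zy y1].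
  have s0 : 0 <= (y + 1) / 2 by nra.
  have E : y = 2 * Num.sqrt ((y + 1) / 2) ^+ 2 - 1 by rewrite sqr_sqrtr//; field.
  rewrite E; apply/S2/Sz/andP; split.
    have zy2 : z ^+ 2 <= (y + 1) / 2 by lra.
    by rewrite -(ger0_norm z0) -sqrtr_sqr ler_sqrt.
  have y2 : (y + 1) / 2 <= 1 by lra.
  by rewrite -[leRHS](@sqrtr1 R) ler_sqrt.
have half : exists2 z : R, z <= 0 & forall y : R, z <= y <= 1 -> S y.
  have [n nx] : exists n, 1 <= 2 ^+ n * (1 - x).
    exists (Num.bound (1 - x)^-1).
    have /ltW := upper_nthrootP (leqnn (Num.bound (1 - x)^-1)).
    by rewrite -[(1 - x)^-1]div1r ler_pdivrMr// subr_gt0.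
  elim: n x x1 nx Sx => [|n IH] x x1.
    by rewrite expr0 mul1r => nx Sx; exists x => //; lra.
  move=> nx Sx; have [x0|x0] := leP x 0; first by exists x.
  apply: (IH (2 * x ^+ 2 - 1)); [nra| |exact: step (ltW x0) Sx].
  apply: le_trans nx _; rewrite exprSr -mulrA ler_pM2l ?exprn_gt0//; nra.
have [z z0 Sz] := half.
move=> y y1; apply: (step 0 (lexx 0)); last by rewrite expr0n mulr0 add0r.
by move=> w /andP[w0 w1]; apply: Sz; rewrite w1 andbT; lra.
Qed.

(** If every c(t) fixed the first axis, L would be a multiple of T_1.  So c(t)_00
takes a value less than 1, hence by continuity all values between it and 1, and
these spread to [-1, 1]: for h in H the half-turn h rot1(pi) h^T about the image
of the first axis has the (0,0)-entry 2 h_00^2 - 1. *)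
Lemma lie_alg_full_std (R : realType) (H : set 'M[R]_3) (L : 'M[R]_3) :
  rot_subgroup H -> (forall t, H (rot1 t)) -> lie_alg H L ->
  (forall r, L <> r *: soT1 R) -> @SO3 R `<=` H.
Proof.
move=> HG Hrot HL LT; have [HS HM HT] := HG.
have LS := lie_alg_skew HS HL; have [c [c0 dc Hc]] := HL.
have d0 : is_derive (0 : R) 1 c L by have := dc 0; rewrite c0 mul1mx.
have [t1 ct1] : exists t1, c t1 0 0 != 1.
  apply: contrapT => /forallNP cn; have {}cn t : c t 0 0 = 1.
    by apply/eqP/negPn/negP/cn.
  have row0 i : c i 0 1 = 0 /\ c i 0 2 = 0.
    apply: sqr2_eq0; have := SO3_row 0 (HS _ (Hc i)).
    by rewrite cn expr1n -addrA -[RHS]addr0 => /addrI.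
  have L0 j : (forall t, c t 0 j = 0) -> L 0 j = 0.
    move=> cj; have /is_derive_mxP /(_ 0 j) := d0.
    have -> : (fun x => c x 0 j) = cst 0 by apply/funext.
    by case=> _; rewrite derive_cst.
  have LE := skew3 LS; apply: (LT (L 2 1 / 2)); rewrite {1}LE.
  have L01 : L 1 0 = 0.
    have := L0 1 (fun t => (row0 t).1); rewrite LE !mx3E => /eqP.
    by rewrite oppr_eq0 => /eqP.
  have L02 : L 0 2 = 0 by exact: L0 2 (fun t => (row0 t).2).
  by apply: mx3P; rewrite !mxE /= ?L01 ?L02 ?oppr0 ?mulr0; split=> //; field.
have cont : continuous (fun t => c t 0 0).
  move=> t; apply/differentiable_continuous/derivable1_diffP.
  by have [/derivable_mxP] := dc t.
apply: (rot_subgroup_full HG Hrot).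
pose S := [set x | exists2 h, H h & h 0 0 = x].
have cle1 : c t1 0 0 <= 1.
  have := SO3_row 0 (HS _ (Hc t1)); have := sqr_ge0 (c t1 0 1).
  have := sqr_ge0 (c t1 0 2); move: (c t1 0 0) (c t1 0 1 ^+ 2) (c t1 0 2 ^+ 2).
  by move=> x y z *; nra.
have clt1 : c t1 0 0 < 1 by rewrite lt_neqAle ct1.
apply: (doubling_fills (S := S) clt1).
  move=> y /andP[y1 y2].
  have c00 : c 0 0 0 = 1 by rewrite c0 mxE.
  have [t0|t0] := leP 0 t1.
    have [||t _ <-] := @IVT _ (fun t => c t 0 0) 0 t1 y t0.
    - exact: continuous_subspaceT.
    - by rewrite c00 minElt maxElt !ltNge cle1 /= y1 y2.
    - by exists (c t).
  have [||t _ <-] := @IVT _ (fun t => c t 0 0) t1 0 y (ltW t0).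
  - exact: continuous_subspaceT.
  - by rewrite c00 minElt maxElt clt1 y1 y2.
  - by exists (c t).
move=> y [h Hh <-].
exists (h *m rot1 pi *m h^T); first by apply/HM/HT/Hh/HM.
have := SO3_row 0 (HS _ Hh).
rewrite !(mulmx3, mx3E) !mxE cospi sinpi => E.
move: (h 0 0) (h 0 1) (h 0 2) E => p q s E.
have xyz : p ^+ 2 = 1 - q ^+ 2 - s ^+ 2 by rewrite -E; ring.
ring: xyz.
Qed.

(** K is the cross product with a vector u, and the half-turn about the bisector of
the first axis e and of u or -u carries the axis of K to e. *)
Lemma conj_skew (R : realType) (K : 'M[R]_3) : K^T = - K -> K != 0 ->
  exists2 a, SO3 a & exists2 r, r != 0 & a *m K *m a^T = r *: soT1 R.
Proof.
move=> KS K0; rewrite (skew3 KS) in K0 *.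
move: (K 2 1) (K 0 2) (K 1 0) K0 => u0 u1 u2 K0 {KS K}.
(* u / n is the unit vector along u or -u that has u0 / n >= 0, so that the
   denominator 1 + x below is not 0. *)
pose n := Num.sqrt (u0 ^+ 2 + u1 ^+ 2 + u2 ^+ 2) * (if 0 <= u0 then 1 else -1).
have u20 : 0 <= u0 ^+ 2 + u1 ^+ 2 + u2 ^+ 2 by rewrite !addr_ge0 ?sqr_ge0.
have nn : n ^+ 2 = u0 ^+ 2 + u1 ^+ 2 + u2 ^+ 2.
  rewrite /n exprMn sqr_sqrtr//; case: ifP => _; rewrite ?sqrrN expr1n mulr1//.
have n0 : n != 0.
  apply: contraNneq K0 => n0; move: nn; rewrite n0 expr0n /= => /esym/eqP.
  rewrite paddr_eq0 ?addr_ge0 ?sqr_ge0// sqrf_eq0 => /andP[/eqP/sqr2_eq0[-> ->] /eqP ->].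
  by apply/eqP; apply: mx3P; rewrite !mxE /= ?oppr0.
have k0 : 0 <= u0 / n.
  rewrite /n; case: ifPn => [u00|]; first by rewrite divr_ge0// mulr1 sqrtr_ge0.
  rewrite -ltNge => u00; rewrite mulrN1 invrN mulrN -mulNr divr_ge0 ?sqrtr_ge0//.
  by rewrite oppr_ge0 ltW.
have [K1 [E0 [E1 E2]]] : (u0 / n) ^+ 2 = 1 - (u1 / n) ^+ 2 - (u2 / n) ^+ 2 /\
    u0 = n * (u0 / n) /\ u1 = n * (u1 / n) /\ u2 = n * (u2 / n).
  split; last by do ![split]; field.
  by rewrite !expr_div_n nn; field; rewrite -nn expf_neq0.
move: (u0 / n) (u1 / n) (u2 / n) k0 K1 E0 E1 E2 => x y z x0 xyz -> -> ->.
pose d := (1 + x)^-1.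
(* This is 2 v v^T - 1 for the unit vector v along (1 + x, y, z). *)
pose a : 'M[R]_3 := mx3 [:: [:: x; y; z]; [:: y; d * y ^+ 2 - 1; d * y * z];
  [:: z; d * y * z; d * z ^+ 2 - 1]].
exists a.
  split; last by rewrite det3 !mx3E /d; field: xyz; lra.
  apply: mx3P; rewrite !mulmx3 !mxE /=; split; rewrite /d; field: xyz; lra.
exists (n / 2); first by rewrite mulf_neq0// invr_eq0 pnatr_eq0.
by apply: mx3P; rewrite !(mulmx3, mx3E) !mxE /=; split; rewrite /d; field: xyz; lra.
Qed.

Lemma lie_alg_full (R : realType) (H : set 'M[R]_3) (K L : 'M[R]_3) :
  rot_subgroup H -> K != 0 -> lie_alg H K -> lie_alg H L ->
  (forall r, L <> r *: K) -> @SO3 R `<=` H.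
Proof.
move=> HG K0 HK HL LK; have [HS HM HT] := HG.
have [a Sa [r r0 aKa]] := conj_skew (lie_alg_skew HS HK) K0.
have [aaT aTa _] := SO3P Sa.
pose H' : set 'M[R]_3 := [set h | H (a^T *m h *m a)].
have bK b : a^T *m (a *m b *m a^T) *m a = b.
  by rewrite !mulmxA aTa mul1mx -mulmxA aTa mulmx1.
have Kb b : a *m (a^T *m b *m a) *m a^T = b.
  by rewrite !mulmxA aaT mul1mx -mulmxA aaT mulmx1.
have HG' : rot_subgroup H'.
  split.
  - move=> h /HS Sh; rewrite -[h]Kb.
    exact: (SO3_mul (SO3_mul Sa Sh) (SO3_tr Sa)).
  - move=> g h Hg Hh; have := HM _ _ Hg Hh.
    by rewrite !mulmxA -(mulmxA _ a) aaT mulmx1 /H' /= mulmxA.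
  - move=> g /HT; rewrite /H' /=.
    by rewrite !trmx_mul trmxK mulmxA.
have lie' Y : lie_alg H Y -> lie_alg H' (a *m Y *m a^T).
  move=> [c [c0 dc Hc]]; exists (fun t => a *m c t *m a^T); split.
  - by rewrite c0 mulmx1.
  - move=> t.
    have D := is_derive_mulmx (is_derive_mulmx (is_derive_cstmx a t) (dc t))
                (is_derive_cstmx a^T t).
    apply: is_derive_eq D _.
    by rewrite mul0mx add0r mulmx0 addr0 !mulmxA -(mulmxA _ a^T) aTa mulmx1.
  - by move=> t; rewrite /H' /= bK.
have [HS' _ _] := HG'.
have HT1 : lie_alg H' (r *: soT1 R) by rewrite -aKa; exact: lie'.
have full := lie_alg_full_std HG' (lie_alg_rot1 HS' r0 HT1) (lie' _ HL).
move=> b Sb; rewrite -[b]bK; apply: full.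
  move=> s E; apply: (LK (s / r)); rewrite -[L]bK -[in RHS](bK K) E aKa.
  by rewrite scalemxAl scalemxAr scalerA divfK.
exact: (SO3_mul (SO3_mul Sa Sb) (SO3_tr Sa)).
Qed.

(** This is all that irreducibility needs to know about the subgroups of SO(3). *)
Lemma lie_alg_line (R : realType) (H : set 'M[R]_3) :
  closed_subgroup H -> H <> @SO3 R ->
  exists K, [/\ K != 0, K^T = - K & forall Y, lie_alg H Y -> exists f, Y = f *: K].
Proof.
move=> cH HSO; have HG := closed_subgroup_rot cH; have [HS _ _] := HG.
have [[K [HK K0]]|noK] := pselect (exists K, lie_alg H K /\ K != 0).
  exists K; split=> //; first exact: lie_alg_skew HK.
  move=> Y HY; apply: contrapT => /forallNP YK; apply: HSO.
  by apply/seteqP; split=> //; exact: lie_alg_full HG K0 HK HY YK.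
(* When the Lie algebra is 0 it lies in every line. *)
exists (soT1 R); split.
- by apply/eqP => /matrixP /(_ 2 1); rewrite !mxE /= => /eqP; rewrite pnatr_eq0.
- by apply: mx3P; rewrite !mxE /= ?opprK ?oppr0.
- move=> Y HY; exists 0; rewrite scale0r; apply/eqP; apply: contrapT => /negP Y0.
  by apply: noK; exists Y.
Qed.

(** * Coordinates and root planes of su(3) *)

Lemma su3_skew (R : realType) (X : 'M[R[i]]_3) i j : su3 X ->
  X j i = - conjc (X i j).
Proof.
case=> /matrixP /(_ j i) XH _.
by apply/eqP; rewrite -eqr_oppLR; apply/eqP; move: XH; rewrite !mxE.
Qed.

Lemma su3E (R : realType) (X : 'M[R[i]]_3) (j : 'I_3) : su3 X ->
  (((X j j = 0 +i* beta j X) *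
   (X (j + 1) (j + 1) = 0 +i* beta (j + 1) X) *
   (X (j + 2) (j + 2) = 0 +i* beta (j + 2) X)) *
   ((X (j + 1) (j + 2) = theta j X +i* eta j X) *
    (X (j + 2) (j + 1) = - theta j X +i* eta j X))) *
   (((X (j + 2) j = theta (j + 1) X +i* eta (j + 1) X) *
    (X j (j + 2) = - theta (j + 1) X +i* eta (j + 1) X)) *
   ((X j (j + 1) = theta (j + 2) X +i* eta (j + 2) X) *
    (X (j + 1) j = - theta (j + 2) X +i* eta (j + 2) X))).
Proof.
move=> sX.
have D (i : 'I_3) : X i i = 0 +i* beta i X.
  have := su3_skew i i sX; rewrite /beta; case: (X i i) => a b /= [/eqP].
  by rewrite -subr_eq0 opprK -mulr2n mulrn_eq0 /= => /eqP ->.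
have O (i : 'I_3) : (X (i + 1) (i + 2) = theta i X +i* eta i X) *
           (X (i + 2) (i + 1) = - theta i X +i* eta i X).
  rewrite (su3_skew (i + 1) (i + 2) sX) /theta /eta.
  by case: (X (i + 1) (i + 2)) => a b; split=> //=; congr (_ +i* _); rewrite /= opprK.
have O1 := O (j + 1); have O2 := O (j + 2); rewrite !addI3c in O1 O2.
by do ![split]; rewrite ?D ?O ?O1 ?O2.
Qed.

Lemma beta_sum (R : realType) (X : 'M[R[i]]_3) (j : 'I_3) : su3 X ->
  beta j X + beta (j + 1) X + beta (j + 2) X = 0.
Proof.
move=> sX; have [_] := sX; rewrite /mxtrace (sum3c _ j) !(su3E j sX).
by move/(congr1 (@complex.Im R)).
Qed.

Definition eta_theta (R : realType) (j : 'I_3) (X Y : 'M[R[i]]_3) : R :=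
  eta j X * theta j Y - eta j Y * theta j X.

(** As beta_0 + beta_1 + beta_2 = 0 on su(3), these are r_1, r_2, r_3, for j = 0, 1, 2. *)
Definition root_form (R : realType) (j : 'I_3) (X : 'M[R[i]]_3) : R :=
  beta (j + 1) X - beta (j + 2) X.

(** The structure equations of SU(3), since d a (X, Y) = - a [X, Y]. *)
Lemma lieb_coords (R : realType) (X Y : 'M[R[i]]_3) (j : 'I_3) :
  su3 X -> su3 Y ->
  [/\ beta j (lieb X Y) = 2 * eta_theta (j + 1) X Y - 2 * eta_theta (j + 2) X Y,
      theta j (lieb X Y) = - (root_form j X * eta j Y - root_form j Y * eta j X)
        + (theta (j + 2) X * theta (j + 1) Y - eta (j + 2) X * eta (j + 1) Y)
        - (theta (j + 2) Y * theta (j + 1) X - eta (j + 2) Y * eta (j + 1) X)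
    & eta j (lieb X Y) = root_form j X * theta j Y - root_form j Y * theta j X
        - (theta (j + 2) X * eta (j + 1) Y + eta (j + 2) X * theta (j + 1) Y)
        + (theta (j + 2) Y * eta (j + 1) X + eta (j + 2) Y * theta (j + 1) X)].
Proof.
move=> sX sY; rewrite /lieb /eta_theta /root_form.
split; [rewrite /beta|rewrite {1}/theta|rewrite {1}/eta]; rewrite !mxE !(sum3c _ j);
  rewrite !(su3E j sX) !(su3E j sY) /=; ring.
Qed.

Lemma lieb_su3 (R : realType) (X Y : 'M[R[i]]_3) : su3 X -> su3 Y -> su3 (lieb X Y).
Proof.
move=> sX sY; split; last by rewrite /lieb linearB /= mxtrace_mulC subrr.
have [hX _] := sX; have [hY _] := sY.
rewrite /lieb linearB /= map_mxB !trmx_mul !map_mxM /= hX hY.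
by rewrite !mulNmx !mulmxN !opprK opprB.
Qed.

Lemma theta_lin (R : realType) (j : 'I_3) (a : R) (X Y : 'M[R[i]]_3) :
  theta j (a%:C *: X + Y) = a * theta j X + theta j Y.
Proof. by rewrite /theta !mxE; case: (X _ _) (Y _ _) => ? ? [? ?] /=; ring. Qed.

Lemma eta_lin (R : realType) (j : 'I_3) (a : R) (X Y : 'M[R[i]]_3) :
  eta j (a%:C *: X + Y) = a * eta j X + eta j Y.
Proof. by rewrite /eta !mxE; case: (X _ _) (Y _ _) => ? ? [? ?] /=; ring. Qed.

Lemma beta_lin (R : realType) (j : 'I_3) (a : R) (X Y : 'M[R[i]]_3) :
  beta j (a%:C *: X + Y) = a * beta j X + beta j Y.
Proof. by rewrite /beta !mxE; case: (X _ _) (Y _ _) => ? ? [? ?] /=; ring. Qed.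

(** The element of the root plane V_j with coordinate theta_j + i eta_j = z. *)
Definition root_vec (R : realType) (j : 'I_3) (z : R[i]) : 'M[R[i]]_3 :=
  z *: delta_mx (j + 1) (j + 2) - conjc z *: delta_mx (j + 2) (j + 1).

Lemma su3P (R : realType) (X : 'M[R[i]]_3) :
  (forall i j, X j i = - conjc (X i j)) -> \tr X = 0 -> su3 X.
Proof.
move=> H tX; split=> //; apply/matrixP => i j; rewrite !mxE.
by rewrite (H j i) opprK.
Qed.

Lemma root_vec_entries (R : realType) (j : 'I_3) (z : R[i]) :
  (((root_vec j z j j = 0) * (root_vec j z j (j + 1) = 0)) *
   (root_vec j z j (j + 2) = 0)) *
  ((((root_vec j z (j + 1) j = 0) * (root_vec j z (j + 1) (j + 1) = 0)) *
    (root_vec j z (j + 1) (j + 2) = z)) *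
   (((root_vec j z (j + 2) j = 0) * (root_vec j z (j + 2) (j + 1) = - conjc z)) *
    (root_vec j z (j + 2) (j + 2) = 0))).
Proof.
rewrite /root_vec; move: (conjc z) => w; rewrite !mxE !eqxx !eqI3c /=; do ![split]; ring.
Qed.

Lemma root_vec_su3 (R : realType) (j : 'I_3) (z : R[i]) : su3 (root_vec j z).
Proof.
have E := root_vec_entries j z; apply: su3P.
  by move=> a b; case: (ord3cP j a) => ->; case: (ord3cP j b) => ->;
    rewrite !E ?conjc0 ?oppr0 // rmorphN opprK /=; exact/esym/conjcK.
by rewrite /mxtrace (sum3c _ j) !E !addr0.
Qed.

Lemma beta_root_vec (R : realType) (j k : 'I_3) (z : R[i]) :
  beta k (root_vec j z) = 0.
Proof. by rewrite /beta; case: (ord3cP j k) => ->; rewrite !root_vec_entries. Qed.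

Lemma theta_root_vec (R : realType) (j k : 'I_3) (z : R[i]) :
  theta k (root_vec j z) = (k == j)%:R * complex.Re z.
Proof.
rewrite /theta; case: (ord3cP j k) => ->; rewrite ?addI3c !root_vec_entries.
- by rewrite eqxx mul1r.
- by rewrite eqI3c mul0r.
- by rewrite eqI3c mul0r.
Qed.

Lemma eta_root_vec (R : realType) (j k : 'I_3) (z : R[i]) :
  eta k (root_vec j z) = (k == j)%:R * complex.Im z.
Proof.
rewrite /eta; case: (ord3cP j k) => ->; rewrite ?addI3c !root_vec_entries.
- by rewrite eqxx mul1r.
- by rewrite eqI3c mul0r.
- by rewrite eqI3c mul0r.
Qed.

Lemma su3_ext (R : realType) (X Y : 'M[R[i]]_3) : su3 X -> su3 Y ->
  (forall j, [/\ beta j X = beta j Y, theta j X = theta j Y & eta j X = eta j Y]) ->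
  X = Y.
Proof.
move=> sX sY H; rewrite (maurer_cartan sX) (maurer_cartan sY).
by have [-> -> ->] := H 0; have [-> -> ->] := H 1; have [-> -> ->] := H 2.
Qed.

Lemma su3_lin (R : realType) (a : R) (X Y : 'M[R[i]]_3) :
  su3 X -> su3 Y -> su3 (a%:C *: X + Y).
Proof.
move=> sX sY; apply: su3P => [i j|].
  rewrite !mxE (su3_skew i j sX) (su3_skew i j sY).
  by case: (X i j) (Y i j) => ? ? [? ?] /=; simpc; congr (_ +i* _); ring.
by rewrite mxtraceD mxtraceZ; case: sX sY => _ -> [_ ->]; rewrite mulr0 addr0.
Qed.

Lemma su3_0 (R : realType) : su3 (0 : 'M[R[i]]_3).
Proof. by split; rewrite ?mxtrace0// ?trmx0 ?map_mx0 ?oppr0. Qed.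

(** * The model connections and their curvature *)

(** The coefficients of r_j on beta_0 and beta_1. *)
Definition root_k (j : 'I_3) : int := [:: 1; -2; 1]`_j.
Definition root_l (j : 'I_3) : int := [:: 2; -1; -1]`_j.

(** Up to gauge, every irreducible invariant connection is one of these, see
[conn_normalize]. *)
Definition root_conn (R : realType) (j : 'I_3) (c : R) : conn R :=
  Conn (root_k j) (root_l j) (fun X =>
    weight (root_k j) (root_l j) X *: (2^-1 *: soT1 R) +
    c *: (eta j X *: soT2 R - theta j X *: soT3 R)).

Lemma weight_root_form (R : realType) (j : 'I_3) (X : 'M[R[i]]_3) : su3 X ->
  weight (root_k j) (root_l j) X = root_form j X.
Proof.
move=> sX; have := beta_sum 0 sX; rewrite !add0r /weight /root_form => b.
by elim/ord3P: j; rewrite /root_k /root_l /= ?add0r ?addI3; lra.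
Qed.

Definition so3 (R : realType) (x y z : R) : 'M[R]_3 :=
  x *: soT1 R + y *: soT2 R + z *: soT3 R.

Lemma so3E (R : realType) (x y z : R) : so3 x y z =
  mx3 [:: [:: 0; - 2 * z; 2 * y]; [:: 2 * z; 0; - 2 * x]; [:: - 2 * y; 2 * x; 0]].
Proof. by apply: mx3P; rewrite !mxE /=; split; ring. Qed.

Lemma so3_inj (R : realType) (x y z x' y' z' : R) :
  so3 x y z = so3 x' y' z' -> [/\ x = x', y = y' & z = z'].
Proof.
rewrite !so3E => /matrixP E.
have := E 2 1; have := E 0 2; have := E 1 0; rewrite !mx3E => ? ? ?.
by split; lra.
Qed.

Lemma so3_0 (R : realType) : so3 0 0 0 = 0 :> 'M[R]_3.
Proof. by rewrite /so3 !scale0r !addr0. Qed.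

Lemma so3_lin (R : realType) (a b x y z x' y' z' : R) :
  a *: so3 x y z + b *: so3 x' y' z' =
  so3 (a * x + b * x') (a * y + b * y') (a * z + b * z').
Proof. by rewrite !so3E; apply: mx3P; rewrite !mxE /=; split; ring. Qed.

Lemma root_conn_so3 (R : realType) (j : 'I_3) (c : R) (X : 'M[R[i]]_3) : su3 X ->
  cform (root_conn j c) X = so3 (root_form j X / 2) (c * eta j X) (- (c * theta j X)).
Proof.
move=> sX; rewrite /= weight_root_form// /so3 !scalerA scalerBr !scalerA scaleNr.
by rewrite addrA.
Qed.

(** The rotation is given by c and s instead of an angle in order to apply both to
[rot1] and to [lam]. *)
Lemma rotation_so3 (R : realType) (c s x y z : R) : c ^+ 2 + s ^+ 2 = 1 ->
  let r := mx3 [:: [:: 1; 0; 0]; [:: 0; c; - s]; [:: 0; s; c]] in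
  r *m so3 x y z *m r^T = so3 x (c * y - s * z) (s * y + c * z).
Proof.
move=> cs1 r; have cs : c ^+ 2 = 1 - s ^+ 2 by rewrite -cs1; ring.
rewrite !so3E; apply: mx3P; rewrite !mulmx3 ![r^T _ _]mxE /r !mx3E.
all: by split; ring: cs.
Qed.

Lemma lieb_so3 (R : realType) (x y z x' y' z' : R) :
  lieb (so3 x y z) (so3 x' y' z') =
  so3 (2 * (y * z' - z * y')) (2 * (z * x' - x * z')) (2 * (x * y' - y * x')).
Proof.
have E (A B : 'M[R]_3) i j : lieb A B i j = (A *m B) i j - (B *m A) i j.
  by rewrite /lieb !mxE.
by rewrite !so3E; apply: mx3P; rewrite !E !mulmx3 !mx3E; split; ring.
Qed.

Ltac gen_coords j x :=
  move: (eta (j + 1) x) (eta (j + 2) x) (theta (j + 1) x) (theta (j + 2) x) => ? ? ? ?.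

(** In terms of z_k = theta_k + i eta_k, [curv_T2] and [curv_T3] are the imaginary
and real parts of z_(j+2) /\ z_(j+1). *)
Definition curv_T2 (R : realType) (j : 'I_3) (X Y : 'M[R[i]]_3) : R :=
  theta (j + 2) X * eta (j + 1) Y + eta (j + 2) X * theta (j + 1) Y
  - theta (j + 2) Y * eta (j + 1) X - eta (j + 2) Y * theta (j + 1) X.
Definition curv_T3 (R : realType) (j : 'I_3) (X Y : 'M[R[i]]_3) : R :=
  theta (j + 2) X * theta (j + 1) Y - eta (j + 2) X * eta (j + 1) Y
  - theta (j + 2) Y * theta (j + 1) X + eta (j + 2) Y * eta (j + 1) X.

(** The terms r_j /\ eta_j and r_j /\ theta_j of the structure equations cancel
against the bracket with r_j T_1 / 2, and c^2 comes from [T_2, T_3] = 2 T_1. *)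
Lemma curv_root_conn (R : realType) (j : 'I_3) (c : R) (X Y : 'M[R[i]]_3) :
  su3 X -> su3 Y ->
  curv (root_conn j c) X Y =
  so3 (2 * (1 - c ^+ 2) * eta_theta j X Y - eta_theta (j + 1) X Y - eta_theta (j + 2) X Y)
      (c * curv_T2 j X Y) (c * curv_T3 j X Y).
Proof.
move=> sX sY; have sXY := lieb_su3 sX sY.
have [_ tj ej] := lieb_coords j sX sY.
have [b1 _ _] := lieb_coords (j + 1) sX sY.
have [b2 _ _] := lieb_coords (j + 2) sX sY.
rewrite /curv /dform !root_conn_so3// {1}/root_form tj ej b1 b2 !addI3c /curv_T2 /curv_T3.
rewrite lieb_so3 -[- so3 _ _ _]scaleN1r -[X in _ + X]scale1r so3_lin /eta_theta.
move: (root_form j X) (root_form j Y) (eta j X) (eta j Y) (theta j X) (theta j Y).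
gen_coords j X; gen_coords j Y => *.
by congr so3; field.
Qed.

(** * Wedge products of three 2-forms on six vectors *)

Lemma ord6P (P : 'I_6 -> Prop) :
  P 0 -> P 1 -> P 2 -> P 3 -> P 4 -> P 5 -> forall i, P i.
Proof.
move=> P0 P1 P2 P3 P4 P5 [[|[|[|[|[|[|//]]]]]] h].
- by rewrite (_ : Ordinal h = 0)//; exact: val_inj.
- by rewrite (_ : Ordinal h = 1)//; exact: val_inj.
- by rewrite (_ : Ordinal h = 2)//; exact: val_inj.
- by rewrite (_ : Ordinal h = 3)//; exact: val_inj.
- by rewrite (_ : Ordinal h = 4)//; exact: val_inj.
- by rewrite (_ : Ordinal h = 5)//; exact: val_inj.
Qed.

Section Wedge.
Variables (R : realType) (X : 'I_6 -> 'M[R[i]]_3).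
Implicit Types l : 'I_6 -> 'M[R[i]]_3 -> R.

(** The value on X of the product of the six covectors l. *)
Definition det6 l : R := \det (\matrix_(i, k) l i (X k)).

Lemma det6_perm l (s : 'S_6) : det6 (fun i => l (s i)) = (-1) ^+ s * det6 l.
Proof.
rewrite /det6 -det_perm -det_mulmx -row_permE; congr (\det _).
by apply/matrixP => i k; rewrite !mxE.
Qed.

Lemma det6_eq0 l i k : i != k -> l i = l k -> det6 l = 0.
Proof.
move=> ik lik; apply: (determinant_alternate ik) => m.
by rewrite !mxE lik.
Qed.

(** 8 times the value on X of the wedge product of the 2-forms f, g and h. *)
Definition wedge3 (f g h : 'M[R[i]]_3 -> 'M[R[i]]_3 -> R) : R :=
  \sum_(s : 'S_6) (-1) ^+ s *
    (f (X (s 0)) (X (s 1)) * g (X (s 2)) (X (s 3)) * h (X (s 4)) (X (s 5))).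

Definition wedge2 (a b : 'M[R[i]]_3 -> R) (Y Z : 'M[R[i]]_3) : R := a Y * b Z - a Z * b Y.

Definition cov6 (a b c d e f : 'M[R[i]]_3 -> R) (i : 'I_6) :=
  nth a [:: a; b; c; d; e; f] i.

Lemma det6E a b c d e f : det6 (cov6 a b c d e f) =
  \sum_(s : 'S_6) (-1) ^+ s *
    (a (X (s 0)) * b (X (s 1)) * c (X (s 2)) * d (X (s 3)) * e (X (s 4)) * f (X (s 5))).
Proof.
apply: eq_bigr => s _; congr (_ * _).
rewrite !big_ord_recr big_ord0 /= mul1r !mxE.
by congr (_ * _ * _ * _ * _ * _); rewrite /cov6 /=; congr (_ (X (s _))); exact: val_inj.
Qed.

Lemma det6_swap a b c d e f : [/\ det6 (cov6 b a c d e f) = - det6 (cov6 a b c d e f),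
  det6 (cov6 a b d c e f) = - det6 (cov6 a b c d e f) &
  det6 (cov6 a b c d f e) = - det6 (cov6 a b c d e f)].
Proof.
have H (i k : 'I_6) : i != k -> - det6 (cov6 a b c d e f) =
    det6 (fun m => cov6 a b c d e f (tperm i k m)).
  by move=> ik; rewrite det6_perm odd_tperm ik /= expr1 mulN1r.
split; [rewrite (H 0 1)//|rewrite (H 2 3)//|rewrite (H 4 5)//]; congr det6;
  by apply/funext; elim/ord6P; rewrite permE.
Qed.

(** Expanding the three factors gives eight determinants, which differ only by swaps
of neighbouring covectors. *)
Lemma wedge3_wedge2 a b c d e0 f :
  wedge3 (wedge2 a b) (wedge2 c d) (wedge2 e0 f) = 8 * det6 (cov6 a b c d e0 f).
Proof.
pose D b1 b2 b3 := det6 (cov6 (if b1 then b else a) (if b1 then a else b)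
  (if b2 then d else c) (if b2 then c else d)
  (if b3 then f else e0) (if b3 then e0 else f)).
transitivity (D false false false - D true false false - D false true false
  + D true true false - D false false true + D true false true
  + D false true true - D true true true).
  rewrite /D /wedge3 !det6E -!(sumrB, big_split) /=; apply: eq_bigr => s _.
  move: (X (s 0)) (X (s 1)) (X (s 2)) (X (s 3)) (X (s 4)) (X (s 5)) ((-1) ^+ s).
  move=> x0 x1 x2 x3 x4 x5 e /=; rewrite /wedge2.
  move: (a x0) (a x1) (b x0) (b x1) (c x2) (c x3) (d x2) (d x3) (e0 x4) (e0 x5)
    (f x4) (f x5).
  by move=> *; ring.
have S1 b2 b3 : D true b2 b3 = - D false b2 b3.
  by rewrite /D; have [-> _ _] := det6_swap a b (if b2 then d else c)
    (if b2 then c else d) (if b3 then f else e0) (if b3 then e0 else f).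
have S2 b3 : D false true b3 = - D false false b3.
  by rewrite /D; have [_ -> _] := det6_swap a b c d (if b3 then f else e0)
    (if b3 then e0 else f).
have S3 : D false false true = - D false false false.
  by rewrite /D; have [_ _ ->] := det6_swap a b c d e0 f.
by rewrite !S1 !S2 !S3 /D; ring.
Qed.

(** The left-invariant volume form of SU(3)/T^2 in the coordinates of the root
planes. *)
Definition volume : R := det6 (cov6 (@eta R 0) (@theta R 0) (@eta R 1) (@theta R 1)
  (@eta R 2) (@theta R 2)).

Lemma det6_pair a b c d e f :
  det6 (cov6 c d a b e f) = det6 (cov6 a b c d e f) /\
  det6 (cov6 a b e f c d) = det6 (cov6 a b c d e f).
Proof.
have H (i k m n : 'I_6) : i != k -> m != n -> det6 (cov6 a b c d e f) =
    det6 (fun p => cov6 a b c d e f ((tperm i k * tperm m n)%g p)).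
  by move=> ik mn; rewrite det6_perm odd_permM !odd_tperm ik mn /= expr0 mul1r.
split; [rewrite (H 0 2 1 3)//|rewrite (H 2 4 3 5)//]; congr det6.
  by apply/funext; elim/ord6P; rewrite permM ![(tperm _ _) _]permE /= ?permE.
by apply/funext; elim/ord6P; rewrite permM ![(tperm _ _) _]permE /= ?permE.
Qed.

Lemma eta_thetaE (j : 'I_3) : @eta_theta R j = wedge2 (@eta R j) (@theta R j).
Proof. by []. Qed.

Lemma wedge3_repeat a b c d e f i k : i != k ->
  cov6 a b c d e f i = cov6 a b c d e f k ->
  wedge3 (wedge2 a b) (wedge2 c d) (wedge2 e f) = 0.
Proof. by move=> ik l; rewrite wedge3_wedge2 (det6_eq0 ik l) mulr0. Qed.

(** Each factor squares to 0, and exchanging two pairs of covectors is an even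
permutation. *)
Lemma wedge3_eta_theta (j k l : 'I_3) :
  wedge3 (@eta_theta R j) (@eta_theta R k) (@eta_theta R l) =
  8 * volume *+ [&& j != k, k != l & l != j].
Proof.
have [jk|jk] /= := eqVneq j k; first
  by rewrite !eta_thetaE jk (wedge3_repeat (i := 0) (k := 2)).
have [kl|kl] /= := eqVneq k l; first
  by rewrite !eta_thetaE kl (wedge3_repeat (i := 2) (k := 4)).
have [lj|lj] /= := eqVneq l j; first
  by rewrite !eta_thetaE lj (wedge3_repeat (i := 0) (k := 4)).
rewrite mulr1n !eta_thetaE wedge3_wedge2 /volume; congr (_ * _).
have P a b c d e f := (det6_pair a b c d e f).1.
have Q a b c d e f := (det6_pair a b c d e f).2.
move: jk kl lj; elim/ord3P: j; elim/ord3P: k; elim/ord3P: l => //= _ _ _.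
all: first [by rewrite P|by rewrite Q|by rewrite P Q|by rewrite Q P|by rewrite P Q P].
Qed.

End Wedge.

(** * The six-form of the curvature and omega *)

(** The coefficient of eta_j /\ theta_j in omega. *)
Definition omega_coef (R : realType) (S : ahs R) (j : 'I_3) : R :=
  signs S j * sizes S j ^+ 2.

Definition omega_re (R : realType) (S : ahs R) (X Y : 'M[R[i]]_3) : R :=
  \sum_j omega_coef S j * eta_theta j X Y.

Lemma omegaE (R : realType) (S : ahs R) (X Y : 'M[R[i]]_3) :
  omega S X Y = (omega_re S X Y)%:C.
Proof.
rewrite /omega /omega_re rmorph_sum mulr_sumr /=; apply: eq_bigr => j _.
rewrite /omega_coef /eta_theta /alpha /=.
move: (eta j X) (eta j Y) (theta j X) (theta j Y) (sizes S j) (signs S j) => a b c d A e.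
have -> : 'i / 2 = 0 +i* 2^-1 :> R[i].
  rewrite -[2 : R[i]](rmorph_nat (real_complex R)) -fmorphV /=; simpc.
  by congr (_ +i* _); field.
by simpc; congr (_ +i* _); field.
Qed.

Lemma wedge3_omega_re (R : realType) (S : ahs R) X f :
  wedge3 X f (omega_re S) (omega_re S) =
  \sum_j \sum_k omega_coef S j * omega_coef S k *
    wedge3 X f (@eta_theta R j) (@eta_theta R k).
Proof.
rewrite /wedge3.
under [RHS]eq_bigr do under eq_bigr do rewrite mulr_sumr.
under [RHS]eq_bigr do rewrite exchange_big /=.
rewrite exchange_big /=; apply: eq_bigr => s _.
rewrite /omega_re -mulrA mulr_suml !mulr_sumr; apply: eq_bigr => j _.
rewrite !mulr_sumr; apply: eq_bigr => k _.
move: (f _ _) (eta_theta j _ _) (eta_theta k _ _)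
  (omega_coef S j) (omega_coef S k) ((-1) ^+ s) => *; ring.
Qed.

Lemma wedge3D (R : realType) X (f f' g h : 'M[R[i]]_3 -> 'M[R[i]]_3 -> R) (a b : R) :
  wedge3 X (fun Y Z => a * f Y Z + b * f' Y Z) g h =
  a * wedge3 X f g h + b * wedge3 X f' g h.
Proof.
rewrite /wedge3 !mulr_sumr -big_split /=; apply: eq_bigr => s _.
move: (f _ _) (f' _ _) (g _ _) (h _ _) ((-1) ^+ s) => *; ring.
Qed.

Lemma wedge3_omega_re_eta_theta (R : realType) (S : ahs R) X (l : 'I_3) :
  wedge3 X (@eta_theta R l) (omega_re S) (omega_re S) =
  16 * volume X * (omega_coef S (l + 1) * omega_coef S (l + 2)).
Proof.
rewrite wedge3_omega_re (sum3c _ l) !(sum3c _ l) !wedge3_eta_theta.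
by elim/ord3P: l; rewrite ?add0r ?addI3 ?eqI3 /= ?mulr0n ?mulr1n; ring.
Qed.

(** A term eta_p /\ theta_p /\ eta_q /\ theta_q of omega^2 with p <> q uses the
covectors of all root planes but one, so it shares one with V_j or V_k. *)
Lemma wedge3_omega_re_mixed (R : realType) (S : ahs R) X (j k : 'I_3) a b : j != k ->
  a = @eta R j \/ a = @theta R j -> b = @eta R k \/ b = @theta R k ->
  wedge3 X (wedge2 a b) (omega_re S) (omega_re S) = 0.
Proof.
move=> jk Ha Hb; rewrite wedge3_omega_re big1// => p _; rewrite big1// => q _.
suff -> : wedge3 X (wedge2 a b) (@eta_theta R p) (@eta_theta R q) = 0 by rewrite mulr0.
rewrite !eta_thetaE.
have [pq|pq] := eqVneq p q; first by rewrite pq (@wedge3_repeat _ _ _ _ _ _ _ _ 2 4).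
have : [|| p == j, p == k, q == j | q == k].
  by move: jk pq; clear; elim/ord3P: j; elim/ord3P: k; elim/ord3P: p; elim/ord3P: q.
case/or4P => /eqP E; rewrite E.
- by case: Ha => ->; [apply: (@wedge3_repeat _ _ _ _ _ _ _ _ 0 2)|
    apply: (@wedge3_repeat _ _ _ _ _ _ _ _ 0 3)].
- by case: Hb => ->; [apply: (@wedge3_repeat _ _ _ _ _ _ _ _ 1 2)|
    apply: (@wedge3_repeat _ _ _ _ _ _ _ _ 1 3)].
- by case: Ha => ->; [apply: (@wedge3_repeat _ _ _ _ _ _ _ _ 0 4)|
    apply: (@wedge3_repeat _ _ _ _ _ _ _ _ 0 5)].
- by case: Hb => ->; [apply: (@wedge3_repeat _ _ _ _ _ _ _ _ 1 4)|
    apply: (@wedge3_repeat _ _ _ _ _ _ _ _ 1 5)].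
Qed.

(** The T_2- and T_3-components of the curvature mix the planes V_(j+1) and V_(j+2)
and are killed by omega^2. *)
Lemma curv_omega2_root_conn (R : realType) (S : ahs R) (j : 'I_3) (c : R) X :
  (forall m, su3 (X m)) ->
  curv_omega2 S (root_conn j c) X = map_mx (real_complex R)
   (so3 (2 * volume X * (2 * (1 - c ^+ 2) * (omega_coef S (j + 1) * omega_coef S (j + 2))
      - omega_coef S (j + 2) * omega_coef S j
      - omega_coef S j * omega_coef S (j + 1))) 0 0).
Proof.
move=> sX.
pose f1 Y Z := 2 * (1 - c ^+ 2) * eta_theta j Y Z +
   1 * ((- 1) * eta_theta (j + 1) Y Z + (- 1) * eta_theta (j + 2) Y Z).
pose f2 Y Z := c * wedge2 (@theta R (j + 2)) (@eta R (j + 1)) Y Z +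
  c * wedge2 (@eta R (j + 2)) (@theta R (j + 1)) Y Z.
pose f3 Y Z := c * wedge2 (@theta R (j + 2)) (@theta R (j + 1)) Y Z +
  (- c) * wedge2 (@eta R (j + 2)) (@eta R (j + 1)) Y Z.
pose W f := wedge3 X f (omega_re S) (omega_re S).
transitivity (map_mx (real_complex R) (8^-1 *: so3 (W f1) (W f2) (W f3))).
  rewrite map_mxZ /= fmorphV /= rmorph_nat; congr (_ *: _).
  rewrite /so3 /W /wedge3 !scaler_suml -!big_split /= raddf_sum; apply: eq_bigr => s _.
  rewrite !omegaE /curvC curv_root_conn// -(rmorph_sign (real_complex R)) -!rmorphM.
  rewrite -map_mxZ; congr map_mx; rewrite /so3 !scalerDr !scalerA.
  by congr (_ *: _ + _ *: _ + _ *: _); rewrite /f1 /f2 /f3 /curv_T2 /curv_T3 /wedge2;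
    move: (X (s 0)) (X (s 1)) (omega_re S _ _) (omega_re S _ _) ((-1) ^+ s) => x y p q e;
    gen_coords j x; gen_coords j y; 
    move: (eta_theta j x y) (eta_theta (j + 1) x y) (eta_theta (j + 2) x y) => *; ring.
have nj : j + 2 != j + 1 by elim/ord3P: j {f1 f2 f3}.
congr map_mx.
have -> : W f2 = 0.
  by rewrite /W wedge3D !(wedge3_omega_re_mixed _ _ nj) ?mulr0 ?addr0; auto.
have -> : W f3 = 0.
  by rewrite /W wedge3D !(wedge3_omega_re_mixed _ _ nj) ?mulr0 ?addr0; auto.
rewrite /W !wedge3D !wedge3_omega_re_eta_theta !addI3c /so3 !scale0r !addr0 scalerA.
by congr (_ *: _); field.
Qed.

(** The basis dual to the covectors of [volume]. *)
Definition root_basis (R : realType) (m : 'I_6) : 'M[R[i]]_3 :=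
  nth 0 [:: root_vec 0 'i; root_vec 0 1; root_vec 1 'i; root_vec 1 1;
           root_vec 2 'i; root_vec 2 1] m.

Lemma root_basis_su3 (R : realType) m : su3 (root_basis R m).
Proof. by elim/ord6P: m; exact: root_vec_su3. Qed.

Lemma volume_root_basis (R : realType) : volume (root_basis R) = 1.
Proof.
rewrite /volume /det6 -[RHS](det1 R 6); congr (\det _); apply/matrixP => m n; rewrite !mxE.
have T := @theta_root_vec R; have E := @eta_root_vec R; rewrite /root_basis.
move: (@theta R) (@eta R) (@root_vec R) T E => th et rv T E.
by elim/ord6P: m; elim/ord6P: n; rewrite /cov6 /= ?T ?E ?eqI3 ?eqxx /=; ring.
Qed.

(** * The Hermitian Yang-Mills equations *)

(** The condition on Z.1 + i Z.2 is Z.1 = - J Z.2 modulo the diagonal. *)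
Lemma type01P (R : realType) (S : ahs R) Z : is_ahs S ->
  type01 S Z <-> su3C Z /\ forall k,
    eta k Z.1 = signs S k * theta k Z.2 /\ theta k Z.1 = - signs S k * eta k Z.2.
Proof.
move=> aS; suff H k : ext1 (alpha S k) Z = 0 <->
    eta k Z.1 = signs S k * theta k Z.2 /\ theta k Z.1 = - signs S k * eta k Z.2.
  by split=> -[sZ HZ]; split=> // k; apply/H.
have [A0 e1] := aS k; rewrite /ext1 /alpha.
have ee : signs S k ^+ 2 = 1 by case: e1 => ->; ring.
move: (eta k Z.1) (theta k Z.1) (eta k Z.2) (theta k Z.2) => a b c d.
have -> : 'i *: ((sizes S k)%:C * (c +i* (signs S k * d)) : R[i]^o) =
  'i * ((sizes S k)%:C * (c +i* (signs S k * d))) by [].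
simpc; split.
  move=> /eqP; rewrite eq_complex /= => /andP[/eqP E1 /eqP E2].
  have {}E1 : sizes S k * (a - signs S k * d) = 0 by rewrite -E1; ring.
  have {}E2 : sizes S k * (signs S k * b + c) = 0 by rewrite -E2; ring.
  move/eqP: E1; rewrite mulf_eq0 gt_eqF//= subr_eq0 => /eqP ->; split=> //.
  move/eqP: E2; rewrite mulf_eq0 gt_eqF//= addr_eq0 => /eqP E2.
  by rewrite -[b]mul1r -ee expr2 -mulrA E2; ring.
move=> [-> ->]; apply/eqP; rewrite eq_complex /=; apply/andP; split; apply/eqP.
  by ring.
by ring: ee.
Qed.

(** Z is - J V + i V for the element V of V_k with coordinate z.  Only the values of
the coordinate forms on Z are kept. *)
Lemma type01_root_vec (R : realType) (S : ahs R) (k : 'I_3) (z : R[i]) : is_ahs S ->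
  exists Z, [/\ type01 S Z, forall m, beta m Z.1 = 0 /\ beta m Z.2 = 0,
    forall m, theta m Z.2 = (m == k)%:R * complex.Re z &
    forall m, eta m Z.2 = (m == k)%:R * complex.Im z].
Proof.
move=> aS.
exists (root_vec k ((- signs S k * complex.Im z) +i* (signs S k * complex.Re z)),
  root_vec k z); split.
- apply/(type01P _ aS); split; first by split; exact: root_vec_su3.
  by move=> m; rewrite !theta_root_vec !eta_root_vec; case: eqVneq => [->|_] /=; split; ring.
- by move=> m; split; exact: beta_root_vec.
- by move=> m; exact: theta_root_vec.
- by move=> m; exact: eta_root_vec.
Qed.

(** When the two signs differ, one of z_(j+1) and z_(j+2) is of type (1,0) and the
other of type (0,1), so that their product has no (0,2)-part. *)
Lemma curv_T23_type01 (R : realType) (S : ahs R) (j : 'I_3) Z W : is_ahs S ->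
  type01 S Z -> type01 S W -> signs S (j + 1) * signs S (j + 2) = -1 ->
  [/\ curv_T2 j Z.1 W.1 = curv_T2 j Z.2 W.2, curv_T2 j Z.1 W.2 = - curv_T2 j Z.2 W.1,
      curv_T3 j Z.1 W.1 = curv_T3 j Z.2 W.2 & curv_T3 j Z.1 W.2 = - curv_T3 j Z.2 W.1].
Proof.
move=> aS /(type01P _ aS)[_ HZ] /(type01P _ aS)[_ HW].
rewrite /curv_T2 /curv_T3.
have [-> ->] := HZ (j + 1); have [-> ->] := HZ (j + 2).
have [-> ->] := HW (j + 1); have [-> ->] := HW (j + 2).
have [[_ e1] [_ e2]] := (aS (j + 1), aS (j + 2)).
gen_coords j Z.2. gen_coords j W.2.
case: e1 => ->; case: e2 => -> E; try lra; split; ring.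
Qed.

Lemma eta_theta_type01 (R : realType) (S : ahs R) (k : 'I_3) Z W : is_ahs S ->
  type01 S Z -> type01 S W ->
  eta_theta k Z.1 W.1 = eta_theta k Z.2 W.2 /\
  eta_theta k Z.1 W.2 = - eta_theta k Z.2 W.1.
Proof.
move=> aS /(type01P _ aS)[_ HZ] /(type01P _ aS)[_ HW].
rewrite /eta_theta.
have [-> ->] := HZ k; have [-> ->] := HW k.
have [_ e] := aS k.
move: (eta k Z.2) (theta k Z.2) (eta k W.2) (theta k W.2).
case: e => ->; split; ring.
Qed.

Lemma ext2_curvC_eq0 (R : realType) (B : conn R) Z W :
  ext2 (curvC B) Z W = 0 <->
  curv B Z.1 W.1 = curv B Z.2 W.2 /\ curv B Z.1 W.2 = - curv B Z.2 W.1.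
Proof.
rewrite /ext2 /curvC.
move: (curv B Z.1 W.1) (curv B Z.2 W.2) (curv B Z.1 W.2) (curv B Z.2 W.1) => A A' C C'.
split=> [/matrixP E|[-> ->]].
  by split; apply/matrixP => i j; have := E i j; rewrite !mxE; simpc;
    move/eqP; rewrite eq_complex /= => /andP[/eqP + /eqP]; lra.
apply/matrixP => i j; rewrite !mxE; simpc; apply/eqP; rewrite eq_complex /=.
by apply/andP; split; apply/eqP; ring.
Qed.

(** The first condition is the vanishing of the (0,2)-part of z_(j+2) /\ z_(j+1), the
second one that of the T_1-component of F /\ omega^2. *)
Lemma HYM_root_conn (R : realType) (S : ahs R) (j : 'I_3) (c : R) : is_ahs S ->
  HYM S (root_conn j c) <->
  (c = 0 \/ signs S (j + 1) * signs S (j + 2) = -1) /\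
  2 * (1 - c ^+ 2) * (omega_coef S (j + 1) * omega_coef S (j + 2)) =
    omega_coef S j * (omega_coef S (j + 1) + omega_coef S (j + 2)).
Proof.
move=> aS; split.
  move=> [F02 Fw]; split; last first.
    have := Fw _ (@root_basis_su3 R).
    rewrite (curv_omega2_root_conn _ _ _ (@root_basis_su3 R)).
    move/matrixP/(_ 2 1); rewrite volume_root_basis so3E !mxE /= => /eqP.
    by rewrite -[0 : R[i]]/(0%:C) (inj_eq (@complexI R)) => /eqP; lra.
  have [->|c0] := eqVneq c 0; [by left|right].
  have [[_ e1] [_ e2]] := (aS (j + 1), aS (j + 2)).
  suff : signs S (j + 1) * signs S (j + 2) <> 1.
    by case: e1 => ->; case: e2 => -> //; rewrite ?mulr1 ?mul1r ?mulrNN ?mul1r.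
  move=> e12.
  (* On these two vectors a nonzero multiple of z_(j+2) /\ z_(j+1) remains in the
     T_2-component if the signs agree. *)
  have [Z [TZ _ tZ hZ]] := type01_root_vec (j + 2) 1 aS.
  have [W [TW _ tW hW]] := type01_root_vec (j + 1) 'i aS.
  have [_ HZ] := (type01P Z aS).1 TZ; have [_ HW] := (type01P W aS).1 TW.
  have [[[sZ1 sZ2] _] [[sW1 sW2] _]] := (TZ, TW).
  have [] := (ext2_curvC_eq0 _ _ _).1 (F02 _ _ TZ TW) => + _.
  rewrite !curv_root_conn// => /so3_inj[_ /(mulfI c0) + _]; rewrite /curv_T2.
  have n21 : (j + 2 == j + 1) = false by elim/ord3P: j {c0 F02 Fw e1 e2 e12 tZ hZ tW hW}.
  rewrite !(HZ _).1 !(HZ _).2 !(HW _).1 !(HW _).2 !tZ !hZ !tW !hW.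
  rewrite !eqxx [j + 1 == _]eq_sym n21 /= !(mul0r, mulr0, mulr1) => E.
  have : signs S (j + 1) * signs S (j + 2) = -1 by move: E; lra.
  by lra.
move=> [Hc Hw]; split; last first.
  move=> X sX; rewrite curv_omega2_root_conn// Hw.
  rewrite (_ : 2 * volume X * _ = 0) ?so3_0 ?map_mx0//; ring.
move=> Z W TZ TW; apply/ext2_curvC_eq0.
have [[[sZ1 sZ2] _] [[sW1 sW2] _]] := (TZ, TW).
rewrite !curv_root_conn//.
have Zr k := eta_theta_type01 k aS TZ TW.
have [-> ->] := Zr j; have [-> ->] := Zr (j + 1); have [-> ->] := Zr (j + 2).
case: Hc => [->|e12].
  by rewrite !mul0r !so3E; split=> //; apply: mx3P; rewrite !mxE /=; split; ring.
have [-> -> -> ->] := curv_T23_type01 aS TZ TW e12; split=> //.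
by rewrite !so3E; apply: mx3P; rewrite !mxE /=; split; ring.
Qed.

(** * Integrability *)

Lemma ext2_complex_eq0 (R : realType) (A : R) (a b : 'M[R[i]]_3 -> 'M[R[i]]_3 -> R) Z W :
  0 < A ->
  ext2 (fun X Y => - (A%:C * (a X Y +i* b X Y)) : R[i]^o) Z W = 0 <->
  a Z.1 W.1 - a Z.2 W.2 = b Z.1 W.2 + b Z.2 W.1 /\
  b Z.1 W.1 - b Z.2 W.2 = - (a Z.1 W.2 + a Z.2 W.1).
Proof.
rewrite /ext2 => A0.
move: (a Z.1 W.1) (a Z.2 W.2) (a Z.1 W.2) (a Z.2 W.1) => a11 a22 a12 a21.
move: (b Z.1 W.1) (b Z.2 W.2) (b Z.1 W.2) (b Z.2 W.1) => b11 b22 b12 b21.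
have sE (x : R[i]^o) : 'i *: x = 'i * (x : R[i]) by [].
rewrite sE; simpc; split.
  move/eqP; rewrite eq_complex /= => /andP[/eqP E1 /eqP E2].
  have {}E1 : A * (a11 - a22 - (b12 + b21)) = 0 by rewrite -[RHS]oppr0 -E1; ring.
  have {}E2 : A * (b11 - b22 + (a12 + a21)) = 0 by rewrite -[RHS]oppr0 -E2; ring.
  move/eqP: E1; rewrite mulf_eq0 gt_eqF//= subr_eq0 => /eqP ->.
  by move/eqP: E2; rewrite mulf_eq0 gt_eqF//= addr_eq0 opprD => /eqP ->.
move=> [E1 E2]; apply/eqP; rewrite eq_complex /=; apply/andP; split; apply/eqP.
  by transitivity (- A * (a11 - a22 - (b12 + b21))); [ring|rewrite E1; ring].
by transitivity (- A * (b11 - b22 + (a12 + a21))); [ring|rewrite E2; ring].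
Qed.

Lemma eta_lieb (R : realType) (j : 'I_3) (X Y : 'M[R[i]]_3) : su3 X -> su3 Y ->
  eta j (lieb X Y) =
  root_form j X * theta j Y - root_form j Y * theta j X - curv_T2 j X Y.
Proof.
by move=> sX sY; have [_ _ ->] := lieb_coords j sX sY; rewrite /curv_T2; ring.
Qed.

Lemma theta_lieb (R : realType) (j : 'I_3) (X Y : 'M[R[i]]_3) : su3 X -> su3 Y ->
  theta j (lieb X Y) =
  - (root_form j X * eta j Y - root_form j Y * eta j X) + curv_T3 j X Y.
Proof.
by move=> sX sY; have [_ -> _] := lieb_coords j sX sY; rewrite /curv_T3; ring.
Qed.

Lemma ext2_dalpha_eq0 (R : realType) (S : ahs R) (j : 'I_3) Z W : is_ahs S ->
  su3C Z -> su3C W ->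
  let a X Y := root_form j X * theta j Y - root_form j Y * theta j X - curv_T2 j X Y in
  let b X Y :=
    signs S j * (- (root_form j X * eta j Y - root_form j Y * eta j X) + curv_T3 j X Y) in
  ext2 (dform (alpha S j)) Z W = 0 <->
  a Z.1 W.1 - a Z.2 W.2 = b Z.1 W.2 + b Z.2 W.1 /\
  b Z.1 W.1 - b Z.2 W.2 = - (a Z.1 W.2 + a Z.2 W.1).
Proof.
move=> aS [sZ1 sZ2] [sW1 sW2] a b; have [A0 _] := aS j.
have E X Y : su3 X -> su3 Y ->
    dform (alpha S j) X Y = - ((sizes S j)%:C * (a X Y +i* b X Y)).
  by move=> sX sY; rewrite /dform /alpha eta_lieb// theta_lieb.
rewrite -(ext2_complex_eq0 a b Z W A0).
suff -> : ext2 (dform (alpha S j)) Z W =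
  ext2 (fun X Y => - ((sizes S j)%:C * (a X Y +i* b X Y)) : R[i]^o) Z W by [].
by rewrite /ext2; congr (_ - _ + 'i *: (_ + _)); exact: E.
Qed.

(** When the signs agree, z_1 /\ z_2 or its conjugate is a nonzero (0,2)-part of
d alpha_0. *)
Lemma integrable_signs (R : realType) (S : ahs R) : is_ahs S -> integrable_ahs S ->
  ~ (forall j, signs S j = signs S 0).
Proof.
move=> aS iS eqS.
have [Z [TZ bZ tZ hZ]] := type01_root_vec 2 1 aS.
have [W [TW bW tW hW]] := type01_root_vec 1 'i aS.
have [_ HZ] := (type01P Z aS).1 TZ; have [_ HW] := (type01P W aS).1 TW.
have [+ _] := (ext2_dalpha_eq0 0 aS TZ.1 TW.1).1 (iS _ _ TZ TW 0).
rewrite /curv_T2 /curv_T3 /root_form !add0r.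
rewrite !(bZ _).1 !(bZ _).2 !(bW _).1 !(bW _).2.
rewrite !(HZ _).1 !(HZ _).2 !(HW _).1 !(HW _).2 !tZ !hZ !tW !hW.
rewrite !eqxx !eqI3 /= !eqS !(mul0r, mulr0, mulr1).
have [_ []] := aS 0 => ->; lra.
Qed.

Lemma signs_integrable (R : realType) (S : ahs R) : is_ahs S ->
  ~ (forall j, signs S j = signs S 0) -> integrable_ahs S.
Proof.
move=> aS neS Z W TZ TW j; apply/(ext2_dalpha_eq0 j aS TZ.1 TW.1).
have [_ HZ] := (type01P Z aS).1 TZ; have [_ HW] := (type01P W aS).1 TW.
have neS' : ~ (signs S (j + 1) = signs S j /\ signs S (j + 2) = signs S j).
  move=> [e1 e2]; apply: neS => k; transitivity (signs S j).
    by move: e1 e2; elim/ord3P: j {HZ HW}; elim/ord3P: k; rewrite ?add0r ?addI3 // => -> // ->.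
  by move: e1 e2; elim/ord3P: j {HZ HW}; rewrite ?add0r ?addI3 // => -> // ->.
rewrite /curv_T2 /curv_T3.
have [-> ->] := HZ (j + 1); have [-> ->] := HZ (j + 2); have [-> ->] := HZ j.
have [-> ->] := HW (j + 1); have [-> ->] := HW (j + 2); have [-> ->] := HW j.
have [[_ e1] [[_ e2] [_ e3]]] := (aS (j + 1), (aS (j + 2), aS j)).
move: neS'; gen_coords j Z.2; gen_coords j W.2.
move: (eta j Z.2) (theta j Z.2) (eta j W.2) (theta j W.2).
move: (root_form j Z.1) (root_form j Z.2) (root_form j W.1) (root_form j W.2).
case: e1 => ->; case: e2 => ->; case: e3 => -> *; try (exfalso; auto; fail); split; ring.
Qed.

(** * One-parameter subgroups of SU(3) along root vectors *)

(** The projector onto the coordinates j + 1 and j + 2; for |z| = 1 it is minus the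
square of [root_vec j z]. *)
Definition plane_proj (R : realType) (j : 'I_3) : 'M[R[i]]_3 :=
  delta_mx (j + 1) (j + 1) + delta_mx (j + 2) (j + 2).

(** The exponential of t times [root_vec j z] for |z| = 1, in closed form. *)
Definition exp_root (R : realType) (j : 'I_3) (z : R[i]) (t : R) : 'M[R[i]]_3 :=
  1%:M + (sin t)%:C *: root_vec j z + (cos t - 1)%:C *: plane_proj R j.

Lemma exp_root0 (R : realType) (j : 'I_3) (z : R[i]) : exp_root j z 0 = 1%:M.
Proof. by rewrite /exp_root sin0 cos0 subrr !scale0r !addr0. Qed.

Lemma cos2C (R : realType) (t : R) : (cos t)%:C ^+ 2 = 1 - (sin t)%:C ^+ 2 :> R[i].
Proof. by rewrite -!rmorphXn /= cos2sin2 rmorphB. Qed.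

Lemma exp_root_entries (R : realType) (j : 'I_3) (z : R[i]) (t : R) :
  (((exp_root j z t j j = 1) * (exp_root j z t j (j + 1) = 0)) *
   (exp_root j z t j (j + 2) = 0)) *
  ((((exp_root j z t (j + 1) j = 0) * (exp_root j z t (j + 1) (j + 1) = (cos t)%:C)) *
    (exp_root j z t (j + 1) (j + 2) = (sin t)%:C * z)) *
   (((exp_root j z t (j + 2) j = 0) *
     (exp_root j z t (j + 2) (j + 1) = - ((sin t)%:C * conjc z))) *
    (exp_root j z t (j + 2) (j + 2) = (cos t)%:C))).
Proof.
rewrite /exp_root /plane_proj rmorphB /=; have := root_vec_entries j z.
move: (root_vec j z) ((cos t)%:C) ((sin t)%:C) (conjc z) => V c s w E.
by rewrite !mxE !eqxx !eqI3c !E /=; do ![split]; ring.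
Qed.

Lemma exp_root_SU3 (R : realType) (j : 'I_3) (z : R[i]) (t : R) :
  z * conjc z = 1 -> SU3 (exp_root j z t).
Proof.
move=> zz; have := cos2C t; have := exp_root_entries j z t; rewrite /SU3 /=.
have cR (x : R) : Num.conj (x%:C) = x%:C by rewrite -[LHS]/(x -i* 0) oppr0.
have [cc ss] := (cR (cos t), cR (sin t)).
have [w wE] : exists w, w = conjc z by exists (conjc z).
have zw : Num.conj z = w by rewrite wE.
have wz : Num.conj w = z by rewrite wE; exact: conjcK.
rewrite -wE in zz *.
move: (exp_root j z t) ((cos t)%:C) ((sin t)%:C) cc ss => M c s cc ss E cs; split.
  apply/unitarymxP; apply: (@mx3cP _ j);
    split; rewrite (mulmx3c j) !mxE !E ?(rmorph0, rmorph1, rmorphN, rmorphM) /=;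
    rewrite ?cc ?ss ?zw ?wz ?eqxx ?eqI3c; rewrite /=; ring: cs zz.
rewrite (det3c j) !E; ring: cs zz.
Qed.

Lemma is_derive_trig (R : realType) (M0 M1 M2 : 'M[R[i]]_3) (t : R) :
  is_derive t 1
    (fun x => realmx (M0 + (sin x)%:C *: M1 + (cos x - 1)%:C *: M2))
    (realmx ((cos t)%:C *: M1 - (sin t)%:C *: M2)).
Proof.
apply: is_derive_realmx => i j; rewrite !mxE.
  under eq_fun do rewrite !mxE.
  case: (M0 i j) (M1 i j) (M2 i j) => a0 b0 [a1 b1] [a2 b2] /=.
  apply: is_derive_eq; rewrite /GRing.scale /=; ring.
under eq_fun do rewrite !mxE.
case: (M0 i j) (M1 i j) (M2 i j) => a0 b0 [a1 b1] [a2 b2] /=.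
apply: is_derive_eq; rewrite /GRing.scale /=; ring.
Qed.

Lemma root_vec_sq (R : realType) (j : 'I_3) (z : R[i]) : z * conjc z = 1 ->
  root_vec j z *m root_vec j z = - plane_proj R j /\
  plane_proj R j *m root_vec j z = root_vec j z.
Proof.
rewrite /root_vec /plane_proj; move: (conjc z) => w zw.
split; apply: (@mx3cP _ j); split; rewrite (mulmx3c j) !mxE !eqxx !eqI3c /=; ring: zw.
Qed.

Lemma is_derive_exp_root (R : realType) (j : 'I_3) (z : R[i]) (t : R) (A B : 'M[R[i]]_3) :
  z * conjc z = 1 ->
  is_derive t 1 (fun x => realmx (A *m exp_root j z x *m B))
    (realmx (A *m exp_root j z t *m root_vec j z *m B)).
Proof.
move=> zz; have [VV PV] := root_vec_sq j zz.
rewrite [X in is_derive _ _ X _](_ : _ = fun x => realmx (A *m B +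
    (sin x)%:C *: (A *m root_vec j z *m B) + (cos x - 1)%:C *: (A *m plane_proj R j *m B))).
  have -> : A *m exp_root j z t *m root_vec j z *m B =
      (cos t)%:C *: (A *m root_vec j z *m B) - (sin t)%:C *: (A *m plane_proj R j *m B).
    rewrite /exp_root; move: (root_vec j z) (plane_proj R j) VV PV => V P VV PV.
    rewrite -(mulmxA A) !mulmxDl -!scalemxAl VV PV mul1mx.
    rewrite !(mulmxDr, mulmxDl, mulmxN, mulNmx, scalerN) -!(scalemxAr, scalemxAl).
    move: (A *m V *m B) (A *m P *m B) => X Y.
    by apply/matrixP => i k; rewrite rmorphB !mxE /=; ring.
  exact: is_derive_trig.
apply/funext => x; rewrite /exp_root; congr realmx.
move: (root_vec j z) (plane_proj R j) {VV PV} => V P.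
by rewrite !(mulmxDr, mulmxDl) mulmx1 -!(scalemxAr, scalemxAl).
Qed.

(** * Irreducibility of the model connections *)

Lemma near_const (R : realType) (m n : nat) (F : R -> 'M[R]_(m, n)) (d : R) :
  (forall t : R, `|t| < d -> is_derive t 1 F 0) -> forall t : R, `|t| < d -> F t = F 0.
Proof.
move=> H t td; apply/matrixP => i j.
have dF (x : R) : `|x| < d -> is_derive x 1 (fun x => F x i j) 0.
  by move=> /H /is_derive_mxP /(_ i j); rewrite mxE.
have cF (x : R) : `|x| < d -> {for x, continuous (fun x => F x i j)}.
  by move=> /dF [+ _] => /derivable1_diffP /differentiable_continuous.
have [t0|t0] := leP 0 t.
  have [x||x _] := @MVT_segment R (fun x => F x i j) (fun=> 0) 0 t t0.
  - rewrite in_itv /= => /andP[x0 xt]; apply: dF.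
    by rewrite gtr0_norm// (lt_le_trans xt)// (le_trans (ler_norm t))// ltW.
  - apply: continuous_in_subspaceT => x; rewrite inE /= in_itv /= => /andP[x0 xt].
    by apply: cF; rewrite ger0_norm// (le_lt_trans xt)// (le_lt_trans (ler_norm t)).
  - by rewrite mul0r => /eqP; rewrite subr_eq0 => /eqP.
have [x||x _] := @MVT_segment R (fun x => F x i j) (fun=> 0) t 0 (ltW t0).
- rewrite in_itv /= => /andP[x0 xt]; apply: dF.
  by rewrite ltr0_norm// (le_lt_trans _ td)// ltr0_norm// lerN2 ltW.
- apply: continuous_in_subspaceT => x; rewrite inE /= in_itv /= => /andP[x0 xt].
  by apply: cF; rewrite ler0_norm// (le_lt_trans _ td)// ltr0_norm// lerN2.
- by rewrite mul0r => /eqP; rewrite subr_eq0 => /eqP.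
Qed.

Lemma is_derive_shift1 (R : realType) (V : normedModType R) (F : R -> V) (t0 : R) D :
  is_derive t0 1 F D <-> is_derive (0 : R) 1 (fun u : R => F (u + t0)) D.
Proof.
have E : (fun h : R => h^-1 *: (((fun u : R => F (u + t0)) \o shift 0)
    (h *: (1 : R)) - F (0 + t0))) =
    (fun h => h^-1 *: ((F \o shift t0) (h *: (1 : R)) - F t0)).
  by apply/funext => h /=; rewrite addr0 add0r.
have d1 : derivable (fun u : R => F (u + t0)) 0 1 = derivable F t0 1.
  by rewrite /derivable E.
have d2 : 'D_1 (fun u : R => F (u + t0)) (0 : R) = 'D_1 F t0.
  by rewrite /derive E.
by split=> -[d v]; split; rewrite ?d1 ?d2 // -?d1 -?d2.
Qed.

Lemma left_derive_curve (R : realType) (f : 'M[R[i]]_3 -> 'M[R]_3)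
    (c : R -> 'M[R[i]]_3) (t0 : R) X V :
  left_derive f (c t0) X V -> (forall t, SU3 (c t)) ->
  is_derive t0 1 (fun t => realmx (c t)) (realmx (c t0 *m X)) ->
  is_derive t0 1 (fun t => f (c t)) V.
Proof.
move=> Hf Hc Hd; apply/(is_derive_shift1 (fun t => f (c t))).
apply: (Hf (fun u => c (u + t0))) => [t||]; first exact: Hc.
  by rewrite add0r.
exact/(is_derive_shift1 (fun t => realmx (c t))).
Qed.

(** The hypothesis says that V = f s K - A s.  The terms in f cancel in the derivative
of s K s^T, as K commutes with itself, and the rest is the covariant constancy of
s K s^T. *)
Lemma left_derive_conj (R : realType) (s : 'M[R[i]]_3 -> 'M[R]_3) g X
    (V K A : 'M[R]_3) (f : R) :
  SO3 (s g) -> K^T = - K -> A^T = - A -> left_derive s g X V ->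
  invmx (s g) *m A *m s g + invmx (s g) *m V = f *: K ->
  left_derive (fun h => s h *m K *m (s h)^T) g X
    (lieb (s g *m K *m (s g)^T) A).
Proof.
move=> Ss KT AT Hs HV c Sc c0 dc; have D := Hs c Sc c0 dc.
have [ssT _ si] := SO3P Ss; rewrite si in HV.
have VE : V = f *: (s g *m K) - A *m s g.
  have := congr1 (mulmx (s g)) HV; rewrite mulmxDr !mulmxA ssT !mul1mx => E.
  by rewrite scalemxAr -E addrAC subrr add0r.
have := is_derive_mulmx (is_derive_mulmx D (is_derive_cstmx K 0)) (is_derive_trmx D).
rewrite c0 mulmx0 addr0 => E; apply: is_derive_eq E _.
have VT : V^T = (s g)^T *m A - f *: (K *m (s g)^T).
  rewrite VE linearB linearZ /= !trmx_mul KT AT mulNmx scalerN mulmxN opprK.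
  by rewrite addrC.
rewrite /lieb VT VE mulmxBl mulmxBr mulmxBl -!scalemxAl -!scalemxAr !mulmxA.
by rewrite addrC -addrA [X in _ + X]addrA addNr add0r.
Qed.

Lemma continuous_exp_root (R : realType) (j : 'I_3) (z : R[i]) a b :
  continuous (fun t : R => complex.Re (exp_root j z t a b)) /\
  continuous (fun t : R => complex.Im (exp_root j z t a b)).
Proof.
rewrite /exp_root; split => t.
  rewrite [X in continuous_at _ X](_ : _ = fun t : R =>
    complex.Re (1%:M a b : R[i]) + sin t * complex.Re (root_vec j z a b) +
    (cos t - 1) * complex.Re (plane_proj R j a b)).
    apply: cvgD; first apply: cvgD; first exact: cvg_cst.
      by apply: cvgM; [exact: continuous_sin|exact: cvg_cst].
    by apply: cvgM; [apply: cvgB; [exact: continuous_cos|exact: cvg_cst]|exact: cvg_cst].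
  apply/funext => x; rewrite [in LHS]mxE [X in X + _]mxE [X in _ + X + _]mxE [X in _ + X]mxE.
  by case: (1%:M a b) (root_vec j z a b) (plane_proj R j a b) => ? ? [? ?] [? ?] /=; ring.
rewrite [X in continuous_at _ X](_ : _ = fun t : R =>
    complex.Im (1%:M a b : R[i]) + sin t * complex.Im (root_vec j z a b) +
    (cos t - 1) * complex.Im (plane_proj R j a b)).
  apply: cvgD; first apply: cvgD; first exact: cvg_cst.
    by apply: cvgM; [exact: continuous_sin|exact: cvg_cst].
  by apply: cvgM; [apply: cvgB; [exact: continuous_cos|exact: cvg_cst]|exact: cvg_cst].
apply/funext => x; rewrite [in LHS]mxE [X in X + _]mxE [X in _ + X + _]mxE [X in _ + X]mxE.
by case: (1%:M a b) (root_vec j z a b) (plane_proj R j a b) => ? ? [? ?] [? ?] /=; ring.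
Qed.

Lemma Re_mulmx3 (R : realType) (A B : 'M[R[i]]_3) a b :
  let f m := complex.Re (A a m) * complex.Re (B m b) -
    complex.Im (A a m) * complex.Im (B m b) in
  complex.Re ((A *m B) a b) = f 0 + f 1 + f 2.
Proof.
rewrite mulmx3 /=; case: (A a 0) (A a 1) (A a 2) => ? ? [? ?] [? ?].
by case: (B 0 b) (B 1 b) (B 2 b) => ? ? [? ?] [].
Qed.

Lemma Im_mulmx3 (R : realType) (A B : 'M[R[i]]_3) a b :
  let f m := complex.Re (A a m) * complex.Im (B m b) +
    complex.Im (A a m) * complex.Re (B m b) in
  complex.Im ((A *m B) a b) = f 0 + f 1 + f 2.
Proof.
rewrite mulmx3 /=; case: (A a 0) (A a 1) (A a 2) => ? ? [? ?] [? ?].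
by case: (B 0 b) (B 1 b) (B 2 b) => ? ? [? ?] [].
Qed.

Lemma SU3_mul (R : realType) (g h : 'M[R[i]]_3) : SU3 g -> SU3 h -> SU3 (g *m h).
Proof.
move=> [ug dg] [uh dh]; split; first exact: mul_unitarymx.
by rewrite det_mulmx dg dh mulr1.
Qed.

Lemma SU3_1 (R : realType) : SU3 (1%:M : 'M[R[i]]_3).
Proof. by rewrite -(exp_root0 0 1); apply: exp_root_SU3; rewrite mul1r conjc1. Qed.

Lemma exp_root_nbhs (R : realType) (j k : 'I_3) (z w : R[i]) (U : set 'M[R[i]]_3) :
  z * conjc z = 1 -> w * conjc w = 1 -> nbhsSU3 1%:M U ->
  exists2 d : R, 0 < d & forall t s, `|t| < d -> `|s| < d ->
    U (exp_root j z t *m exp_root k w s).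
Proof.
move=> zz ww [V nV VU].
pose C (p : R * R) := exp_root j z p.1 *m exp_root k w p.2.
have C0 : C (0, 0) = 1%:M by rewrite /C !exp_root0 mulmx1.
have cC : {for (0, 0), continuous (fun p => realmx (C p))}.
  have c1 (f : R -> R) : continuous f -> {for ((0, 0) : R * R), continuous (fun p => f p.1)}.
    by move=> cf; apply: continuous_comp; [exact: cvg_fst|exact: cf].
  have c2 (f : R -> R) : continuous f -> {for ((0, 0) : R * R), continuous (fun p => f p.2)}.
    by move=> cf; apply: continuous_comp; [exact: cvg_snd|exact: cf].
  have zR a b := c1 _ (continuous_exp_root j z a b).1.
  have zI a b := c1 _ (continuous_exp_root j z a b).2.
  have wR a b := c2 _ (continuous_exp_root k w a b).1.
  have wI a b := c2 _ (continuous_exp_root k w a b).2.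
  apply: continuous_realmx => a b.
    pose fR m (p : R * R) :=
      complex.Re (exp_root j z p.1 a m) * complex.Re (exp_root k w p.2 m b) -
      complex.Im (exp_root j z p.1 a m) * complex.Im (exp_root k w p.2 m b).
    have cf m : {for (0, 0), continuous (fR m)}.
      by apply: cvgB; apply: cvgM; [exact: zR|exact: wR|exact: zI|exact: wI].
    rewrite [X in {for _, continuous X}](_ : _ = fun p => fR 0 p + fR 1 p + fR 2 p).
      by apply: cvgD; [apply: cvgD|]; exact: cf.
    by apply/funext => p; rewrite /C (Re_mulmx3 _ _ a b).
  pose fI m (p : R * R) :=
    complex.Re (exp_root j z p.1 a m) * complex.Im (exp_root k w p.2 m b) +
    complex.Im (exp_root j z p.1 a m) * complex.Re (exp_root k w p.2 m b).
  have cf m : {for (0, 0), continuous (fI m)}.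
    by apply: cvgD; apply: cvgM; [exact: zR|exact: wI|exact: zI|exact: wR].
  rewrite [X in {for _, continuous X}](_ : _ = fun p => fI 0 p + fI 1 p + fI 2 p).
    by apply: cvgD; [apply: cvgD|]; exact: cf.
  by apply/funext => p; rewrite /C (Im_mulmx3 _ _ a b).
have := cC V; rewrite /= C0 => /(_ nV) /nbhs_ballP[d /= d0 dV].
exists d => // t s td sd; apply: VU.
  by apply: SU3_mul; exact: exp_root_SU3.
apply: (dV (t, s)); split => /=; rewrite /ball /= sub0r normrN//.
Qed.

(** Ad (e^(-sY)) with Y in V_(j+2) rotates V_(j+1) towards
[V_(j+1), V_(j+2)] = V_j. *)
Lemma exp_root_conj (R : realType) (j : 'I_3) (z : R[i]) (s : R) : z * conjc z = 1 ->
  root_vec (j + 1) 1 *m exp_root (j + 2) z s =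
  exp_root (j + 2) z s *m ((cos s)%:C *: root_vec (j + 1) 1 +
                       (sin s)%:C *: root_vec j (- conjc z)).
Proof.
move=> zz; have cs := cos2C s; have := exp_root_entries (j + 2) z s.
have := root_vec_entries (j + 1) (1 : R[i]).
have := root_vec_entries j (- conjc z).
have -> : conjc (- conjc z) = - z.
  by rewrite rmorphN; congr (- _); exact: conjcK.
rewrite conjc1 !addI3c; move: zz.
move: (root_vec (j + 1) 1) (root_vec j (- conjc z)) => X W; move: (conjc z) => w.
move=> zw EW EX.
move: (exp_root (j + 2) z s) ((cos s)%:C) ((sin s)%:C) cs => M c r cs E.
by apply: (@mx3cP _ j); split; rewrite !(mulmx3c j) !mxE !E !EX !EW; ring: cs zw.
Qed.

Lemma commute_T2_T3 (R : realType) (Y : 'M[R]_3) : Y^T = - Y ->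
  lieb Y (soT2 R) = 0 -> lieb Y (soT3 R) = 0 -> Y = 0.
Proof.
move=> YT; rewrite (skew3 YT); move: (Y 1 0) (Y 0 2) (Y 2 1) => a b c {YT}.
move=> /matrixP E2 /matrixP E3.
have := E2 0 1; have := E2 1 2; have := E3 0 2; have := E3 1 2.
rewrite /lieb /soT2 /soT3 !(mulmx3, mxE) /= => e1 e2 e3 e4.
have [-> [-> ->]] : a = 0 /\ b = 0 /\ c = 0 by split; [|split]; lra.
by apply: mx3P; rewrite !mxE /= ?oppr0.
Qed.

(** Here s is a local gauge near the identity in which B takes its values in the
line of K; the section xi is then covariantly constant. *)
Section Irreducible.
Variables (R : realType) (B : conn R) (K : 'M[R]_3) (U : set 'M[R[i]]_3)
  (s : 'M[R[i]]_3 -> 'M[R]_3).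
Hypothesis KT : K^T = - K.
Hypothesis Bskew : forall X, su3 X -> (cform B X)^T = - cform B X.
Hypothesis nU : nbhsSU3 1%:M U.
Hypothesis sSO : forall g, U g -> SO3 (s g).
Hypothesis Hs : forall g X, U g -> su3 X -> exists2 V, left_derive s g X V &
  exists f, invmx (s g) *m cform B X *m s g + invmx (s g) *m V = f *: K.

Let xi g := s g *m K *m (s g)^T.

Lemma xi_derive g X : U g -> su3 X -> left_derive xi g X (lieb (xi g) (cform B X)).
Proof.
move=> Ug sX; have [V HV [f E]] := Hs Ug sX.
exact: left_derive_conj (sSO Ug) KT (Bskew sX) HV E.
Qed.

(** Since B vanishes on X in V_(j+1) and Y in V_(j+2), xi is constant on the surface
e^(tX) e^(rY); its derivative at t = 0 is taken in the direction Ad (e^(-rY)) X, on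
which B need not vanish. *)
Lemma xi_flat (j : 'I_3) (z : R[i]) : z * conjc z = 1 ->
  cform B (root_vec (j + 1) 1) = 0 -> cform B (root_vec (j + 2) z) = 0 ->
  exists2 r : R, 0 < sin r &
    lieb (xi 1%:M) (cform B ((cos r)%:C *: root_vec (j + 1) 1 +
                       (sin r)%:C *: root_vec j (- conjc z))) = 0.
Proof.
move=> zz BX BY.
have oo : (1 : R[i]) * conjc 1 = 1 by rewrite mul1r conjc1.
have [d d0 dU] := exp_root_nbhs (j + 1) (j + 2) oo zz nU.
pose P := exp_root (j + 1) (1 : R[i]); pose Q := exp_root (j + 2) z.
have SPQ t r : SU3 (P t *m Q r) by apply: SU3_mul; exact: exp_root_SU3.
have cQ t r : `|t| < d -> `|r| < d -> xi (P t *m Q r) = xi (P t).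
  move=> td rd; rewrite -[P t in RHS]mulmx1 -[1%:M in RHS](exp_root0 (j + 2) z) -/Q.
  apply: (near_const (F := fun r => xi (P t *m Q r)) (d := d)) => // x xd.
  apply: (left_derive_curve (c := fun r => P t *m Q r) (X := root_vec (j + 2) z)).
  - have := xi_derive (dU _ _ td xd) (root_vec_su3 (j + 2) z).
    by rewrite BY /lieb mulmx0 mul0mx subrr.
  - by move=> ?; exact: SPQ.
  - have E : (fun r => realmx (P t *m Q r)) =
        fun r => realmx (P t *m exp_root (j + 2) z r *m 1%:M).
      by apply/funext => u; rewrite mulmx1.
    rewrite E; apply: is_derive_eq (is_derive_exp_root (j + 2) x (P t) 1%:M zz) _.
    by rewrite mulmx1.
have cP t : `|t| < d -> xi (P t) = xi 1%:M.
  move=> td; rewrite -(exp_root0 (j + 1) 1) -/P.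
  have z0 : `|0 : R| < d by rewrite normr0.
  apply: (near_const (F := fun t => xi (P t)) (d := d)) => // x xd.
  apply: (left_derive_curve (c := P) (X := root_vec (j + 1) 1)).
  - have UP : U (P x) by have := dU _ _ xd z0; rewrite exp_root0 mulmx1.
    have := xi_derive UP (root_vec_su3 (j + 1) 1).
    by rewrite BX /lieb mulmx0 mul0mx subrr.
  - by move=> ?; exact: exp_root_SU3.
  - have E : (fun t => realmx (P t)) =
        fun t => realmx (1%:M *m exp_root (j + 1) 1 t *m 1%:M).
      by apply/funext => u; rewrite mul1mx mulmx1.
    rewrite E; apply: is_derive_eq (is_derive_exp_root (j + 1) x 1%:M 1%:M oo) _.
    by rewrite mul1mx mulmx1.
(* Small enough to stay in U, and less than pi so that sin r > 0. *)
pose r := Num.min (d / 2) 1.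
have r0 : 0 < r by rewrite lt_min divr_gt0//=.
have rd : `|r| < d.
  by rewrite gtr0_norm// gt_min; apply/orP; left; lra.
exists r.
  apply: sin_gt0_pi; rewrite r0 /=; apply: (@le_lt_trans _ _ 1).
    by rewrite ge_min lexx orbT.
  by apply: lt_le_trans (pi_ge2 R); lra.
have z0 : `|0 : R| < d by rewrite normr0.
have UQ : U (Q r) by have := dU _ _ z0 rd; rewrite exp_root0 mul1mx.
pose D := (cos r)%:C *: root_vec (j + 1) 1 + (sin r)%:C *: root_vec j (- conjc z).
have sD : su3 D.
  apply: su3_lin; first exact: root_vec_su3.
  rewrite -[X in su3 X]addr0; apply: su3_lin; first exact: root_vec_su3.
  exact: su3_0.
have : is_derive (0 : R) 1 (fun t => xi (P t *m Q r)) (lieb (xi (Q r)) (cform B D)).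
  apply: (left_derive_curve (c := fun t => P t *m Q r) (X := D)).
  - rewrite /P exp_root0 mul1mx; exact: xi_derive.
  - by move=> ?; exact: SPQ.
  - have E : (fun t => realmx (P t *m Q r)) =
        fun t => realmx (1%:M *m exp_root (j + 1) 1 t *m Q r).
      by apply/funext => u; rewrite mul1mx.
    rewrite E; apply: is_derive_eq (is_derive_exp_root (j + 1) 0 1%:M (Q r) oo) _.
    have swap (M V W Z : 'M[R[i]]_3) : M = 1%:M -> V *m W = W *m Z ->
        1%:M *m M *m V *m W = M *m W *m Z by move=> -> E'; rewrite !mul1mx.
    have D0 := swap _ _ _ _ (exp_root0 (j + 1) (1 : R[i])) (exp_root_conj j r zz).
    exact: (congr1 (@realmx R) D0).
have -> : xi (Q r) = xi 1%:M.
  by have := cQ 0 r z0 rd; rewrite /P exp_root0 mul1mx.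
move=> [_ <-].
have E : \forall t \near (0 : R), xi 1%:M = xi (P t *m Q r).
  apply/nbhs_ballP; exists d => //= t; rewrite /ball /= sub0r normrN => td.
  by rewrite cQ// cP.
by have [_] := near_eq_is_derive E (is_derive_cst (xi 1%:M) (0 : R) 1).
Qed.

End Irreducible.

Lemma root_conn_root_vec (R : realType) (j k : 'I_3) (c : R) (z : R[i]) :
  cform (root_conn j c) (root_vec k z) =
  (c * (j == k)%:R) *: (complex.Im z *: soT2 R - complex.Re z *: soT3 R).
Proof.
rewrite /= weight_root_form; last exact: root_vec_su3.
rewrite /root_form !beta_root_vec subrr scale0r add0r.
by rewrite eta_root_vec theta_root_vec -!scalerA -scalerBr scalerA.
Qed.

Lemma root_conn_skew (R : realType) (j : 'I_3) (c : R) (X : 'M[R[i]]_3) :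
  (cform (root_conn j c) X)^T = - cform (root_conn j c) X.
Proof. by apply: mx3P; rewrite !mxE /=; split; ring. Qed.

Lemma root_conn_lin (R : realType) (j : 'I_3) (c a : R) (X Y : 'M[R[i]]_3) :
  cform (root_conn j c) (a%:C *: X + Y) =
  a *: cform (root_conn j c) X + cform (root_conn j c) Y.
Proof.
rewrite /= /weight !beta_lin !eta_lin !theta_lin.
move: (_ *: soT1 R) (soT2 R) (soT3 R) => T1 T2 T3.
by apply/matrixP => p q; rewrite !mxE; ring.
Qed.

Lemma root_conn_scale (R : realType) (j : 'I_3) (c a : R) (X : 'M[R[i]]_3) :
  cform (root_conn j c) (a%:C *: X) = a *: cform (root_conn j c) X.
Proof.
have H0 : cform (root_conn j c) 0 = 0.
  have := root_conn_lin j c 1 0 0; rewrite scaler0 addr0 scale1r => /esym/eqP.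
  by rewrite -subr_eq0 addrK => /eqP.
by rewrite -[_ *: X]addr0 root_conn_lin H0 addr0.
Qed.

(** By [xi_flat], xi(1) commutes with the image of V_j, that is, with T_2 and T_3. *)
Lemma root_conn_irreducible (R : realType) (j : 'I_3) (c : R) :
  c != 0 -> ~ reducible (root_conn j c).
Proof.
move=> c0 [H [cH HSO [Q [Q1 Q2 Q3]]]].
have [K [K0 KT HK]] := lie_alg_line cH HSO.
have [U [s [[US nU] U1 _ Qs Hs]]] := Q3 _ (SU3_1 R).
have [HS _ _ _ _] := cH.
have sSO g : U g -> SO3 (s g).
  move=> Ug; have [a Sa QE] := Q1 _ (US _ Ug).
  by have := Qs _ Ug; rewrite QE => -[h /HS Sh <-]; exact: SO3_mul.
have Hs' g X : U g -> su3 X -> exists2 V, left_derive s g X V &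
    exists f, invmx (s g) *m cform (root_conn j c) X *m s g + invmx (s g) *m V = f *: K.
  by move=> Ug sX; have [V HV /HK] := Hs _ _ Ug sX; exists V.
pose xi := s 1%:M *m K *m (s 1%:M)^T.
have flat (z : R[i]) : z * conjc z = 1 ->
    lieb xi (complex.Im z *: soT2 R + complex.Re z *: soT3 R) = 0.
  move=> zz.
  have [||r r0] := xi_flat KT (fun X _ => root_conn_skew j c X) (nU _ U1) sSO Hs' zz (j := j).
  - by rewrite root_conn_root_vec eqI3c mulr0 scale0r.
  - by rewrite root_conn_root_vec eqI3c mulr0 scale0r.
  rewrite (_ : cform _ _ = (c * sin r) *: (complex.Im z *: soT2 R + complex.Re z *: soT3 R)).
    rewrite /lieb -scalemxAr -scalemxAl -scalerBr => /eqP.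
    by rewrite scaler_eq0 mulf_eq0 (negbTE c0) gt_eqF//= => /eqP.
  rewrite root_conn_lin root_conn_scale !root_conn_root_vec eqI3c eqxx mulr0.
  rewrite scale0r scaler0 add0r mulr1.
  have -> : complex.Im (- conjc z) = complex.Im z by case: (z) => ? ? /=; rewrite opprK.
  have -> : complex.Re (- conjc z) = - complex.Re z by case: (z).
  by rewrite scaleNr opprK scalerA mulrC.
have xiT : xi^T = - xi.
  by rewrite /xi !trmx_mul trmxK KT mulmxA mulmxN mulNmx.
have oo : (1 : R[i]) * conjc 1 = 1 by rewrite mul1r conjc1.
have ii : ('i : R[i]) * conjc 'i = 1 by simpc.
have := flat _ oo; have := flat _ ii; rewrite /= scale1r !scale0r addr0 add0r scale1r.
move=> f2 f3; have xi0 := commute_T2_T3 xiT f2 f3.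
have [_ sTs _] := SO3P (sSO _ U1).
move/eqP: K0; apply; transitivity ((s 1%:M)^T *m xi *m s 1%:M).
  by rewrite /xi !mulmxA sTs mul1mx -mulmxA sTs mulmx1.
by rewrite xi0 mulmx0 mul0mx.
Qed.

(** * Equivariance under the torus *)

Lemma conj_unit_inv (R : realType) (z : R[i]) : z * conjc z = 1 -> z^-1 = conjc z.
Proof.
move=> zz; have z0 : z != 0.
  by apply: contra_eq_neq zz => ->; rewrite mul0r eq_sym oner_neq0.
by rewrite -[LHS]mulr1 -zz mulKf.
Qed.

Lemma T2P (R : realType) (t : 'M[R[i]]_3) : T2 t ->
  [/\ forall i j, i != j -> t i j = 0, forall i, t i i * conjc (t i i) = 1,
      t 0 0 * t 1 1 * t 2 2 = 1 & invmx t = diag_mx (\row_i conjc (t i i))].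
Proof.
move=> [[/unitarymxP ut dt] /is_diag_mxP dg].
have D i j : i != j -> t i j = 0 by move=> ij; apply: dg; rewrite -val_eqE in ij.
have N i : t i i * conjc (t i i) = 1.
  have /matrixP/(_ i i) := ut; rewrite !mxE eqxx (bigD1 i)//= big1 ?addr0 ?mxE//.
  by move=> k ki; rewrite D ?mul0r// eq_sym.
split=> //.
  by move: dt; rewrite det3 (D 0 1)// (D 0 2)// (D 1 2)// (D 1 0)// => <-; ring.
have U : t *m diag_mx (\row_i conjc (t i i)) = 1%:M.
  apply/matrixP => i j; rewrite mul_mx_diag !mxE.
  by have [<-|ij] := eqVneq i j; [rewrite N|rewrite (D i j)// mul0r].
have [tU _] := mulmx1_unit U.
by rewrite -[RHS](mulKmx tU) U mulmx1.
Qed.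

Lemma T2_conj (R : realType) (t X : 'M[R[i]]_3) a b : T2 t ->
  (t *m X *m invmx t) a b = t a a * X a b * conjc (t b b).
Proof.
move=> /T2P[D _ _ ->]; rewrite mul_mx_diag !mxE (bigD1 a)//= big1 ?addr0// => k ka.
by rewrite (D a k) ?mul0r// eq_sym.
Qed.

Lemma lam_SO3 (R : realType) (k l : int) (t : 'M[R[i]]_3) :
  character k l t * conjc (character k l t) = 1 -> SO3 (lam k l t).
Proof.
rewrite /lam; case: (character k l t) => x y; simpc => /eqP.
rewrite eq_complex /= => /andP[/eqP xy _].
have yx : x ^+ 2 = 1 - y ^+ 2 by rewrite -xy; ring.
split; last by rewrite det3 !mx3E; ring: yx.
by apply: mx3P; rewrite !mulmx3 !mxE /=; split; ring: yx.
Qed.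

Lemma character_unit (R : realType) (k l : int) (t : 'M[R[i]]_3) : T2 t ->
  character k l t * conjc (character k l t) = 1.
Proof.
move=> /T2P[_ N _ _].
have Nz (z : R[i]) (m : int) : z * conjc z = 1 -> (z ^ m) * conjc (z ^ m) = 1.
  move=> zz; rewrite -[conjc (z ^ m)]/(Num.conj (z ^ m)) fmorphXz -expfzMl.
  transitivity ((1 : R[i]) ^ m); last exact: exp1rz.
  by congr (_ ^ m); exact: zz.
rewrite /character -[conjc _]/(Num.conj _) rmorphM mulrACA.
by rewrite [X in X * _ = _]Nz// [X in _ * X = _]Nz// mulr1.
Qed.

Lemma character_root (R : realType) (j : 'I_3) (t : 'M[R[i]]_3) : T2 t ->
  character (root_k j) (root_l j) t = t (j + 1) (j + 1) * conjc (t (j + 2) (j + 2)).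
Proof.
move=> /T2P[_ N d _].
have I i : (t i i)^-1 = conjc (t i i) by exact: conj_unit_inv.
have n0 i : t i i != 0.
  by apply: contra_eq_neq (N i) => ->; rewrite mul0r eq_sym oner_neq0.
have e2 : t 0 0 * t 1 1 = conjc (t 2 2).
  by rewrite -[LHS]mulr1 -(N 2) mulrA d mul1r.
have e0 : t 2 2 = conjc (t 0 0) * conjc (t 1 1).
  by have N0 := N 0; have N1 := N 1; rewrite -[RHS]mulr1 -d; ring: N0 N1.
rewrite /character; elim/ord3P: j; rewrite ?add0r ?addI3 /root_k /root_l /= -?I.
- by rewrite -I in e2; rewrite expr1z -[_ ^ 2]/(_ ^+ 2) expr2 mulrA e2 mulrC.
- rewrite -!I in e0; rewrite -[_ ^ (-2)]/((_ ^+ 2)^-1) -[_ ^ (-1)]/((_ ^+ 1)^-1).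
  by rewrite expr1 expr2 invfM e0 mulrAC.
- by rewrite expr1z.
Qed.

(** Ad (t) fixes the diagonal part and rotates V_j by the character of r_j. *)
Lemma T2_coords (R : realType) (t X : 'M[R[i]]_3) (j : 'I_3) : T2 t ->
  let z := character (root_k j) (root_l j) t in
  [/\ beta j (t *m X *m invmx t) = beta j X,
     theta j (t *m X *m invmx t) = complex.Re z * theta j X - complex.Im z * eta j X &
     eta j (t *m X *m invmx t) = complex.Re z * eta j X + complex.Im z * theta j X].
Proof.
move=> tT z; have [_ N _ _] := T2P tT.
rewrite /beta /theta /eta !T2_conj// mulrAC N mul1r /z character_root//.
rewrite -[t (j + 1) (j + 1) * _ * _]mulrAC.
move: (t _ _ * conjc _) (X (j + 1) (j + 2)) => [a b] [x y] /=.
by split=> //; ring.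
Qed.

Lemma su3_conj (R : realType) (t X : 'M[R[i]]_3) : T2 t -> su3 X ->
  su3 (t *m X *m invmx t).
Proof.
move=> [[/unitarymxP ut _] _] [sX1 sX2].
have -> : invmx t = t^t*%sesqui.
  have [tU _] := mulmx1_unit ut.
  by rewrite -[RHS](mulKmx tU) ut mulmx1.
split.
  by rewrite !trmx_mul !map_mxM /= sX1 trmxCK mulNmx mulmxN mulmxA.
by rewrite mxtrace_mulC mulmxA (mulmx1C ut) mul1mx.
Qed.

Lemma root_vec_conj (R : realType) (t : 'M[R[i]]_3) (j : 'I_3) (z : R[i]) : T2 t ->
  t *m root_vec j z *m invmx t = root_vec j (character (root_k j) (root_l j) t * z).
Proof.
move=> tT; have sz := root_vec_su3 j z.
apply: su3_ext => [||k]; [exact: su3_conj|exact: root_vec_su3|].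
have [b u h] := T2_coords (root_vec j z) k tT.
rewrite {}b {}u {}h !beta_root_vec !theta_root_vec !eta_root_vec.
have [->|_] := eqVneq k j; last by rewrite !mul0r !mulr0 subrr addr0; split.
by case: (character _ _ t) z {sz} => x y [a b] /=; split=> //; ring.
Qed.

Lemma root_conn_is_conn (R : realType) (j : 'I_3) (c : R) : is_conn (root_conn j c).
Proof.
split.
- by move=> a X Y _ _; exact: root_conn_lin.
- by move=> X _; exact: root_conn_skew.
- move=> X sX /is_diag_mxP dX.
  have D : X (j + 1) (j + 2) = 0 by apply: dX; elim/ord3P: j.
  rewrite /= /eta /theta D /= scale0r scale0r subrr scaler0 addr0.
  by rewrite scalerA.
move=> t X tT sX.
have L := lam_SO3 (character_unit (root_k j) (root_l j) tT).
have [_ _ ->] := SO3P L.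
have sX' := su3_conj tT sX.
rewrite !root_conn_so3//; have [_ -> ->] := T2_coords X j tT.
have -> : root_form j (t *m X *m invmx t) = root_form j X.
  by rewrite /root_form; have [-> _ _] := T2_coords X (j + 1) tT;
    have [-> _ _] := T2_coords X (j + 2) tT.
move: (SO3_row 1 L); rewrite /lam !mx3E => xy.
rewrite rotation_so3; last by rewrite -xy; ring.
by congr so3; ring.
Qed.

(** * Connections with values in the line of T_1 *)

(** The stabiliser of T_1, which contains the image of every [lam]. *)
Definition SO2 (R : realType) : set 'M[R]_3 := [set a | SO3 a /\ a 0 0 = 1].

Lemma closed_eq_fun (R : realType) (m n : nat) (f : 'M[R]_(m, n) -> R) (r : R) :
  continuous f -> closed [set a | f a = r].
Proof.
move=> cf; exact: (@closed_comp _ _ f [set r] (fun x _ => cf x) (@closed_eq R r)).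
Qed.

Lemma SO2_closed (R : realType) : closed_subgroup (@SO2 R).
Proof.
have ent i j : continuous (fun a : 'M[R]_3 => a i j) by exact: coord_continuous.
have M (f g : 'M[R]_3 -> R) : continuous f -> continuous g ->
  continuous (fun x => f x * g x) by move=> cf cg x; exact: (cvgM (cf x) (cg x)).
have B (f g : 'M[R]_3 -> R) : continuous f -> continuous g ->
  continuous (fun x => f x - g x) by move=> cf cg x; exact: (cvgB (cf x) (cg x)).
have D (f g : 'M[R]_3 -> R) : continuous f -> continuous g ->
  continuous (fun x => f x + g x) by move=> cf cg x; exact: (cvgD (cf x) (cg x)).
split.
- by move=> a [].
- by split; [exact: SO3_1|rewrite mxE].
- move=> a b [Sa a0] [Sb b0]; split; first exact: SO3_mul.
  have [t ->] := SO3_fix1 Sa a0; have [r ->] := SO3_fix1 Sb b0.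
  by rewrite mulmx3 !mx3E !mul0r !addr0 mulr1.
- move=> a [Sa a0]; have [_ _ ->] := SO3P Sa; split; first exact: SO3_tr.
  by rewrite mxE.
- have -> : @SO2 R = (\bigcap_i [set a : 'M[R]_3 |
        (fun a : 'M[R]_3 => (a *m a^T) i.1 i.2) a = (i.1 == i.2)%:R])
      `&` [set a | \det a = 1] `&` [set a | a 0 0 = 1].
    apply/seteqP; split=> [a [[aa da] a0]|a [[aa da] a0]].
      by split=> //; split=> // i _ /=; rewrite aa mxE.
    split=> //; split=> //; apply/matrixP => i j.
    by have := aa (i, j) I; rewrite /= => ->; rewrite mxE.
  apply: closedI; [apply: closedI|]; last exact: closed_eq_fun.
    apply: closed_bigI => -[i j] _; apply: closed_eq_fun => /=.
    rewrite [X in continuous X](_ : _ = fun a : 'M[R]_3 =>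
      a i 0 * a j 0 + a i 1 * a j 1 + a i 2 * a j 2).
      by apply: (D); [apply: (D)|]; apply: (M); exact: ent.
    by apply/funext => b; rewrite mulmx3 !mxE.
  apply: closed_eq_fun.
  rewrite [X in continuous X](_ : _ = fun A : 'M[R]_3 =>
    A 0 0 * (A 1 1 * A 2 2 - A 1 2 * A 2 1)
         - A 0 1 * (A 1 0 * A 2 2 - A 1 2 * A 2 0)
         + A 0 2 * (A 1 0 * A 2 1 - A 1 1 * A 2 0)).
    apply: (D); first apply: (B).
    - by apply: (M); [exact: ent|apply: (B); apply: (M); exact: ent].
    - by apply: (M); [exact: ent|apply: (B); apply: (M); exact: ent].
    - by apply: (M); [exact: ent|apply: (B); apply: (M); exact: ent].
  by apply/funext => b; exact: det3.
Qed.

Lemma SO2_proper (R : realType) : @SO2 R <> @SO3 R.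
Proof.
move=> E; have : SO2 (mx3 [:: [:: -1; 0; 0]; [:: 0; -1; 0]; [:: 0; 0; 1 : R]]).
  rewrite E; split; last by rewrite det3 !mx3E; ring.
  by apply: mx3P; rewrite !mulmx3 !mxE /=; split; ring.
by move=> [_]; rewrite mx3E; lra.
Qed.

Lemma SO2_lie (R : realType) (x : R) : lie_alg (@SO2 R) (x / 2 *: soT1 R).
Proof.
exists (fun t => rot1 (x * t)); split.
- by rewrite mulr0; apply: mx3P; rewrite !mxE /= ?cos0 ?sin0 ?oppr0.
- by move=> t; exact: is_derive_rot1.
- by move=> t; split; [exact: SO3_rot1|rewrite mx3E].
Qed.

Lemma left_derive_cst (R : realType) (a : 'M[R]_3) g X :
  left_derive (fun=> a) g X 0.
Proof. by move=> c _ _ _; exact: is_derive_cst. Qed.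

Lemma smooth_cst (R : realType) (U : set 'M[R[i]]_3) (a : 'M[R]_3) :
  smooth_on U (fun=> a).
Proof.
move=> n; elim: n a => [|n IH] a /=; split=> //.
- move=> g _ A nA; exists setT; first exact: filterT.
  by move=> h _ _; exact: nbhs_singleton nA.
- move=> g _ A nA; exists setT; first exact: filterT.
  by move=> h _ _; exact: nbhs_singleton nA.
- by move=> X _; exists (fun=> 0) => [g _|]; [exact: left_derive_cst|exact: IH].
Qed.

Lemma SU3_open (R : realType) : openSU3 (@SU3 R).
Proof.
by split=> // g _; exists setT => //; exact: filterT.
Qed.

Lemma lam_SO2 (R : realType) (k l : int) (t : 'M[R[i]]_3) : T2 t -> SO2 (lam k l t).
Proof.
by move=> tT; split; [exact: lam_SO3 (character_unit k l tT)|rewrite mx3E].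
Qed.

(** The subset SU(3) x SO(2) is invariant under T^2, and its constant section 1
already makes the connection so(2)-valued. *)
Lemma torus_conn_reducible (R : realType) (B : conn R) :
  (forall X, su3 X -> cform B X = (weight (wk B) (wl B) X / 2) *: soT1 R) ->
  reducible B.
Proof.
move=> HB; have C := SO2_closed R; have [_ H1 HM HV _] := C.
exists (@SO2 R); split=> //; first exact: SO2_proper.
exists (fun=> @SO2 R); split.
- move=> g _; exists 1%:M; first exact: SO3_1.
  apply/seteqP; split=> [a Ha|a [h Hh <-]]; last by rewrite mul1mx.
  by exists a => //; rewrite mul1mx.
- by move=> g t a _ tT Ha; apply: HM => //; apply: HV; exact: lam_SO2.
- move=> g0 Sg0; exists (@SU3 R), (fun=> 1%:M); split=> //.
  + exact: SU3_open.
  + exact: smooth_cst.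
  + move=> g X _ sX; exists 0; first exact: left_derive_cst.
    rewrite invmx1 mulmx0 addr0 mul1mx mulmx1 HB//; exact: SO2_lie.
Qed.

(** * Classification of the invariant connections *)

Definition cis (R : realType) (x : R) : R[i] := cos x +i* sin x.

Lemma cisD (R : realType) (x y : R) : cis (x + y) = cis x * cis y.
Proof. by rewrite /cis cosD sinD; simpc; congr (_ +i* _); ring. Qed.

Lemma cisN (R : realType) (x : R) : cis (- x) = conjc (cis x).
Proof. by rewrite /cis cosN sinN. Qed.

Lemma cis0 (R : realType) : cis (0 : R) = 1.
Proof. by rewrite /cis cos0 sin0. Qed.

Lemma cis_unit (R : realType) (x : R) : cis x * conjc (cis x) = 1.
Proof. by rewrite -cisN -cisD subrr cis0. Qed.

Lemma cisX (R : realType) (x : R) (m : int) : cis x ^ m = cis (m%:~R * x).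
Proof.
have H (n : nat) : cis x ^+ n = cis (n%:R * x).
  elim: n => [|n IH]; first by rewrite mul0r cis0 expr0.
  by rewrite exprS IH -cisD mulrSr mulrDl mul1r addrC.
case: m => n; first exact: H.
rewrite -[LHS]/((cis x ^+ n.+1)^-1) H conj_unit_inv ?cis_unit// -cisN.
by rewrite NegzE rmorphN mulNr.
Qed.

Definition torus_elt (R : realType) (x y : R) : 'M[R[i]]_3 :=
  mx3 [:: [:: cis x; 0; 0]; [:: 0; cis y; 0]; [:: 0; 0; cis (- (x + y))]].

Lemma torus_elt_T2 (R : realType) (x y : R) : T2 (torus_elt x y).
Proof.
split; last first.
  by apply/is_diag_mxP => i j; elim/ord3P: i; elim/ord3P: j => //= _; rewrite mx3E.
split; last first.
  by rewrite det3 !mx3E !(mul0r, mulr0, subr0, addr0) mulrA -!cisD subrr cis0.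
have conj0 : Num.conj (0 : R[i]) = 0 by exact: rmorph0.
by apply/unitarymxP; apply: mx3P; rewrite !(mulmx3, mxE) /= ?conj0;
  split; rewrite ?mul0r ?mulr0 ?addr0 ?add0r //; exact: cis_unit.
Qed.

Lemma character_torus_elt (R : realType) (k l : int) (x y : R) :
  character k l (torus_elt x y) = cis (k%:~R * x + l%:~R * y).
Proof. by rewrite /character !mx3E !cisX cisD. Qed.

Lemma lam_torus_elt (R : realType) (k l : int) (x y : R) :
  lam k l (torus_elt x y) = rot1 (k%:~R * x + l%:~R * y).
Proof. by rewrite /lam character_torus_elt. Qed.

(** At x = pi / (|a| + |c| + 1) both |a| x and |c| x lie in [0, pi], where the cosine
is injective. *)
Lemma cos_eq_norm (R : realType) (a c : R) :
  (forall x, cos (a * x) = cos (c * x)) -> `|a| = `|c|.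
Proof.
move=> H; pose x : R := pi / (`|a| + `|c| + 1).
have D0 : 0 < `|a| + `|c| + 1 by rewrite ltr_wpDl// addr_ge0.
have x0 : 0 < x by rewrite divr_gt0// pi_gt0.
have N (b : R) : cos (`|b| * x) = cos (b * x).
  by case: (ler0P b) => _ //; rewrite mulNr cosN.
have I (b : R) : `|b| <= `|a| + `|c| + 1 -> `|b| * x \in `[0, pi]%R.
  move=> bD; rewrite in_itv /= mulr_ge0//=; last exact: ltW.
  by rewrite /x mulrCA ler_piMr ?pi_ge0// ler_pdivrMr// mul1r.
have := H x; rewrite -(N a) -(N c) => /(congr1 (@acos R)).
rewrite !cosK; first by move/(mulIf (lt0r_neq0 x0)).
  by apply: I; move: (normr_ge0 a) (normr_ge0 c); lra.
by apply: I; move: (normr_ge0 a) (normr_ge0 c); lra.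
Qed.

(** The two coordinate axes give the equality of the coefficients up to signs, and
the diagonal x = y shows that the two signs are the same. *)
Lemma cos_weights (R : realType) (k l k' l' : int) :
  (forall x y : R, cos (k%:~R * x + l%:~R * y) = cos (k'%:~R * x + l'%:~R * y)) ->
  (k = k' /\ l = l') \/ (k = - k' /\ l = - l').
Proof.
move=> H.
have E (a b : int) : (forall x : R, cos (a%:~R * x) = cos (b%:~R * x)) ->
    a = b \/ a = - b.
  move=> /cos_eq_norm; rewrite -!intr_norm => /eqP; rewrite eqr_int => /eqP.
  by move=> /eqP; rewrite eqr_norm2 => /orP[] /eqP ->; auto.
have Ek : k = k' \/ k = - k' by apply: E => x; have := H x 0; rewrite !mulr0 !addr0.
have El : l = l' \/ l = - l' by apply: E => x; have := H 0 x; rewrite !mulr0 !add0r.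
have Es : k + l = k' + l' \/ k + l = - (k' + l').
  by apply: E => x; have := H x x; rewrite -!mulrDl -!intrD.
by move: Es; case: Ek => ->; case: El => -> [] Es; lia.
Qed.

Lemma skew_so3 (R : realType) (Y : 'M[R]_3) : Y^T = - Y ->
  exists x y z, Y = so3 x y z.
Proof.
move=> /skew3 ->; exists (Y 2 1 / 2), (Y 0 2 / 2), (Y 1 0 / 2).
by rewrite so3E; apply: mx3P; rewrite !mx3E; split; field.
Qed.

Lemma rot1_so3 (R : realType) (t x y z : R) :
  rot1 t *m so3 x y z *m invmx (rot1 t) =
  so3 x (cos t * y - sin t * z) (sin t * y + cos t * z).
Proof.
by have [_ _ ->] := SO3P (SO3_rot1 t); apply: rotation_so3; exact: cos2Dsin2.
Qed.

Lemma root_vec_lin (R : realType) (j : 'I_3) (a : R) (z w : R[i]) :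
  root_vec j (a%:C * z + w) = a%:C *: root_vec j z + root_vec j w.
Proof.
rewrite /root_vec; have -> : conjc (a%:C * z + w) = a%:C * conjc z + conjc w.
  by case: z w => ? ? [? ?]; simpc; congr (_ +i* _); ring.
by move: (conjc z) (conjc w) => z' w'; apply/matrixP => p q; rewrite !mxE; ring.
Qed.

(** Schur's lemma for maps from the root plane V_j to so(3).  An element of the torus
that acts by -1 on V_j forces the T_1-component to vanish.  Comparing (x, y) with
(-x, -y) separates even and odd functions of the angles, and the even part shows
that the weights have the same cosine unless f is zero.  A quarter turn of V_j
finally determines f(i) from f(1). *)
Lemma equivariant_plane (R : realType) (k l : int) (j : 'I_3) (f : R[i] -> 'M[R]_3) :
  (forall z, (f z)^T = - f z) ->
  (forall (a : R) z w, f (a%:C * z + w) = a *: f z + f w) ->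
  (forall z (x y : R), f (cis ((root_k j)%:~R * x + (root_l j)%:~R * y) * z) =
    rot1 (k%:~R * x + l%:~R * y) *m f z *m invmx (rot1 (k%:~R * x + l%:~R * y))) ->
  (forall z, f z = 0) \/
  exists s : bool, exists b d : R,
    [/\ (b != 0) || (d != 0), k = (-1) ^+ s * root_k j, l = (-1) ^+ s * root_l j &
     forall z, f z = so3 0 (complex.Re z * b - (-1) ^+ s * complex.Im z * d)
             (complex.Re z * d + (-1) ^+ s * complex.Im z * b)].
Proof.
move=> S L Eq.
pose be (x y : R) := k%:~R * x + l%:~R * y.
pose ro (x y : R) := (root_k j)%:~R * x + (root_l j)%:~R * y.
have f0 : f 0 = 0.
  have := L 1 0 0; rewrite mulr0 addr0 scale1r => /esym/eqP.
  by rewrite -subr_eq0 addrK => /eqP.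
have [a [b [d pE]]] := skew_so3 (S 1).
have [a' [b' [d' qE]]] := skew_so3 (S 'i).
have zE z : f z = so3 (complex.Re z * a + complex.Im z * a')
    (complex.Re z * b + complex.Im z * b') (complex.Re z * d + complex.Im z * d').
  have {1}-> : z = (complex.Re z)%:C * 1 + ((complex.Im z)%:C * 'i + 0).
    by case: z => x y; simpc.
  by rewrite !L f0 addr0 pE qE so3_lin.
have E1 x y : [/\ cos (ro x y) * a + sin (ro x y) * a' = a,
    cos (ro x y) * b + sin (ro x y) * b' = cos (be x y) * b - sin (be x y) * d &
    cos (ro x y) * d + sin (ro x y) * d' = sin (be x y) * b + cos (be x y) * d].
  have := Eq 1 x y; rewrite !zE rot1_so3 mulr1 /= !mul1r !mul0r !addr0.
  by move/so3_inj.
have E2 x y : - sin (ro x y) * a + cos (ro x y) * a' = a'.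
  have := Eq 'i x y; rewrite !zE rot1_so3 => /so3_inj[+ _ _].
  by rewrite /= !(mul0r, mulr0, mulr1, mul1r, add0r, sub0r, addr0, subr0).
(* The torus element (x0, y0) acts on V_j as -1. *)
have [x0 [y0 ro0]] : exists x0 y0, ro x0 y0 = pi.
  rewrite /ro; elim/ord3P: (j); rewrite /root_k /root_l /=.
  - by exists pi, 0; rewrite mulr0 addr0 mul1r.
  - by exists 0, (- pi); rewrite mulr0 add0r mulN1r opprK.
  - by exists pi, 0; rewrite mulr0 addr0 mul1r.
have roN x y : ro (- x) (- y) = - ro x y by rewrite /ro !mulrN opprD.
have beN x y : be (- x) (- y) = - be x y by rewrite /be !mulrN opprD.
have a0 : a = 0.
  by have [+ _ _] := E1 x0 y0; rewrite ro0 cospi sinpi; lra.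
have a'0 : a' = 0.
  by have := E2 x0 y0; rewrite ro0 cospi sinpi; lra.
have C x y : [/\ cos (ro x y) * b = cos (be x y) * b, cos (ro x y) * d = cos (be x y) * d,
    sin (ro x y) * b' = - sin (be x y) * d & sin (ro x y) * d' = sin (be x y) * b].
  have [_ e1 e2] := E1 x y; have [_ + +] := E1 (- x) (- y).
  by rewrite !roN !beN !cosN !sinN => e3 e4; split; lra.
have [bd|] := boolP ((b != 0) || (d != 0)); last first.
  rewrite negb_or !negbK => /andP[/eqP b0 /eqP d0]; left.
  have [_ _ e3 e4] := C (x0 / 2) (y0 / 2).
  have h : ro (x0 / 2) (y0 / 2) = pi / 2 by rewrite -ro0 /ro; field.
  move: e3 e4; rewrite h sin_pihalf b0 d0 !mul1r !mulr0 => b'0 d'0.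
  by move=> z; rewrite zE a0 a'0 b0 d0 b'0 d'0 !mulr0 !addr0 so3_0.
right.
have cc x y : cos (be x y) = cos (ro x y).
  by have [e1 e2 _ _] := C x y; case/orP: bd => [b0|d0];
    [apply: (mulIf b0)|apply: (mulIf d0)].
have [x1 [y1 ro1]] : exists x1 y1, ro x1 y1 = pi / 2.
  by exists (x0 / 2), (y0 / 2); rewrite -ro0 /ro; field.
have K (s : bool) : k = (-1) ^+ s * root_k j -> l = (-1) ^+ s * root_l j ->
    b' = - (-1) ^+ s * d /\ d' = (-1) ^+ s * b.
  move=> kE lE; have be1 : be x1 y1 = (-1) ^+ s * ro x1 y1.
    by rewrite /be /ro kE lE !rmorphM !rmorph_sign; ring.
  have [_ _ e3 e4] := C x1 y1; move: e3 e4; rewrite be1 ro1 sin_pihalf !mul1r => -> ->.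
  by case: s {kE lE be1}; rewrite ?expr1 ?expr0 ?mulN1r ?mul1r ?sinN sin_pihalf; split; ring.
have [[kE lE]|[kE lE]] := cos_weights cc.
  exists false, b, d; rewrite !expr0 !mul1r; split=> // z.
  have [b'E d'E] := K false (etrans kE (esym (mul1r _))) (etrans lE (esym (mul1r _))).
  by rewrite zE a0 a'0 b'E d'E expr0; congr so3; ring.
have kE' : k = (-1) ^+ true * root_k j by rewrite expr1 mulN1r.
have lE' : l = (-1) ^+ true * root_l j by rewrite expr1 mulN1r.
exists true, b, d; split=> // z.
have [b'E d'E] := K true kE' lE'.
by rewrite zE a0 a'0 b'E d'E expr1; congr so3; ring.
Qed.

Section Structure.
Variables (R : realType) (B : conn R).
Hypothesis cB : is_conn B.

Lemma conn_add X Y : su3 X -> su3 Y -> cform B (X + Y) = cform B X + cform B Y.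
Proof.
by case: cB => L _ _ _ sX sY; have := L 1 X Y sX sY; rewrite !scale1r.
Qed.

Lemma conn_root_plane (j : 'I_3) :
  (forall z, cform B (root_vec j z) = 0) \/
  exists s : bool, exists b d : R,
    [/\ (b != 0) || (d != 0), wk B = (-1) ^+ s * root_k j, wl B = (-1) ^+ s * root_l j &
     forall z, cform B (root_vec j z) =
       so3 0 (complex.Re z * b - (-1) ^+ s * complex.Im z * d)
             (complex.Re z * d + (-1) ^+ s * complex.Im z * b)].
Proof.
have [L S _ E] := cB; have rS := @root_vec_su3 R j.
apply: (equivariant_plane (f := fun z => cform B (root_vec j z))) => [z|c z w|z x y].
- exact: S.
- by rewrite root_vec_lin; exact: L.
- have := E _ _ (torus_elt_T2 x y) (rS z).
  by rewrite root_vec_conj ?character_torus_elt ?lam_torus_elt//; exact: torus_elt_T2.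
Qed.

Lemma conn_decomp X : su3 X -> cform B X =
  (weight (wk B) (wl B) X / 2) *: soT1 R +
  \sum_j cform B (root_vec j (theta j X +i* eta j X)).
Proof.
move=> sX; have [_ _ D _] := cB.
have [r [rE sr rb rt re]] : exists r : 'I_3 -> 'M[R[i]]_3,
    [/\ forall j, r j = root_vec j (theta j X +i* eta j X), forall j, su3 (r j),
      forall k j, beta k (r j) = 0,
      forall k j, theta k (r j) = (k == j)%:R * theta j X &
      forall k j, eta k (r j) = (k == j)%:R * eta j X].
  exists (fun j => root_vec j (theta j X +i* eta j X)).
  by split=> // *; rewrite ?beta_root_vec ?theta_root_vec ?eta_root_vec//; exact: root_vec_su3.
pose Y := (-1)%:C *: (r 0 + r 1 + r 2) + X.
have S1 (V W : 'M[R[i]]_3) : su3 V -> su3 W -> su3 (V + W).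
  by move=> sV sW; have := su3_lin 1 sV sW; rewrite scale1r.
have sr3 : su3 (r 0 + r 1 + r 2) := S1 _ _ (S1 _ _ (sr 0) (sr 1)) (sr 2).
have sY : su3 Y by exact: su3_lin.
have XE : X = r 0 + (r 1 + (r 2 + Y)).
  rewrite /Y -[(-1)%:C]/(-1 +i* 0).
  have -> : (-1 +i* 0 : R[i]) = -1 by rewrite -[RHS](rmorphN1 (real_complex R)).
  by rewrite scaleN1r !addrA subrr add0r.
have tD k V W : theta k (V + W) = theta k V + theta k W :> R.
  by rewrite /theta mxE raddfD.
have eD k V W : eta k (V + W) = eta k V + eta k W :> R.
  by rewrite /eta mxE raddfD.
have bD k V W : beta k (V + W) = beta k V + beta k W :> R.
  by rewrite /beta mxE raddfD.
have Y0 k : theta k Y = 0 /\ eta k Y = 0.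
  rewrite /Y theta_lin eta_lin !tD !eD !rt !re.
  by elim/ord3P: k; rewrite ?eqI3 ?eqxx /=; split; ring.
have Yd : is_diag_mx Y.
  apply/is_diag_mxP => a b ab.
  have Z m : Y (m + 1) (m + 2) = 0.
    have [] := Y0 m; rewrite /theta /eta; case: (Y (m + 1) (m + 2)) => ? ? /= -> ->.
    by [].
  have Z' m : Y (m + 2) (m + 1) = 0.
    by rewrite (su3_skew (m + 1) (m + 2) sY) Z conjc0 oppr0.
  have := Z 0; have := Z 1; have := Z 2; have := Z' 0; have := Z' 1; have := Z' 2.
  by rewrite ?add0r ?addI3; move: ab; elim/ord3P: a; elim/ord3P: b.
have WY : weight (wk B) (wl B) Y = weight (wk B) (wl B) X.
  by rewrite /weight /Y !beta_lin !bD !rb !addr0 !mulr0 !add0r.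
rewrite {1}XE conn_add//; last by apply: (S1) => //; exact: S1.
rewrite conn_add//; last exact: S1.
rewrite conn_add// (D Y)// WY sum3 -!rE.
by rewrite [RHS]addrC -!addrA.
Qed.
End Structure.

(** Only one root plane can contribute, because r_i is not r_j or -r_j for i <> j. *)
Lemma conn_structure (R : realType) (B : conn R) : is_conn B ->
  (forall X, su3 X -> cform B X = (weight (wk B) (wl B) X / 2) *: soT1 R) \/
  exists j : 'I_3, exists s : bool, exists b d : R,
    [/\ (b != 0) || (d != 0), wk B = (-1) ^+ s * root_k j, wl B = (-1) ^+ s * root_l j &
     forall X, su3 X -> cform B X = (weight (wk B) (wl B) X / 2) *: soT1 R +
       so3 0 (theta j X * b - (-1) ^+ s * eta j X * d)
             (theta j X * d + (-1) ^+ s * eta j X * b)].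
Proof.
move=> cB; have [Z|] := pselect (forall j z, cform B (root_vec j z) = 0).
  left=> X sX; rewrite (conn_decomp cB sX) big1 ?addr0// => j _; exact: Z.
move=> /existsNP[j nZ]; right; exists j.
have [//|[s [b [d [bd kE lE fE]]]]] := conn_root_plane cB j.
exists s, b, d; split=> // X sX; rewrite (conn_decomp cB sX).
rewrite (bigD1 j)//= big1 ?addr0 ?fE// => i ij.
have [->//|[s' [b' [d' [_ kE' lE' _]]]]] := conn_root_plane cB i.
exfalso; rewrite kE in kE'; rewrite lE in lE'.
move: ij kE' lE'; clear; case: s; case: s'; rewrite ?expr1 ?expr0 ?mulN1r ?mul1r.
all: by elim/ord3P: i; elim/ord3P: j.
Qed.

(** * Constant gauge transformations *)

(** Gauge transformations u that are constant on SU(3).  They suffice for the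
classification, and they compose and invert without any discussion of
smoothness. *)
Definition const_gauge (R : realType) (B B' : conn R) : Prop :=
  exists a : 'M[R]_3, [/\ SO3 a,
    forall t, T2 t -> lam (wk B) (wl B) t *m a = a *m lam (wk B') (wl B') t
    & forall X, su3 X -> cform B' X = a^T *m cform B X *m a].

Lemma const_gauge_equiv (R : realType) (B B' : conn R) :
  const_gauge B B' -> gauge_equiv B B'.
Proof.
move=> [a [Sa aL aA]]; exists (fun=> a); split=> //.
- exact: smooth_cst.
- move=> g t _ tT; have [_ LL ->] := SO3P (lam_SO3 (character_unit (wk B) (wl B) tT)).
  by rewrite -mulmxA -aL// mulmxA LL mul1mx.
- move=> g X _ sX; exists 0; first exact: left_derive_cst.
  by have [_ _ ->] := SO3P Sa; rewrite mulmx0 addr0; exact: aA.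
Qed.

Lemma const_gauge_sym (R : realType) (B B' : conn R) :
  const_gauge B B' -> const_gauge B' B.
Proof.
move=> [a [Sa aL aA]]; have [aaT aTa _] := SO3P Sa.
exists a^T; split; first exact: SO3_tr.
  move=> t tT; rewrite -[LHS]mul1mx -aTa -mulmxA [a *m _]mulmxA -aL//.
  by rewrite -(mulmxA _ a) aaT mulmx1.
move=> X sX; rewrite trmxK aA// !mulmxA aaT mul1mx.
by rewrite -mulmxA aaT mulmx1.
Qed.

Lemma const_gauge_trans (R : realType) (B1 B2 B3 : conn R) :
  const_gauge B1 B2 -> const_gauge B2 B3 -> const_gauge B1 B3.
Proof.
move=> [a [Sa aL aA]] [b [Sb bL bA]]; exists (a *m b); split.
- exact: SO3_mul.
- by move=> t tT; rewrite mulmxA aL// -mulmxA bL// mulmxA.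
- by move=> X sX; rewrite bA// aA// trmx_mul !mulmxA.
Qed.

Lemma const_gauge_HYM (R : realType) (S : ahs R) (B B' : conn R) :
  const_gauge B B' -> HYM S B -> HYM S B'.
Proof.
move=> [a [Sa _ aA]] [F02 Fw]; have [aaT aTa _] := SO3P Sa.
have cE X Y : su3 X -> su3 Y -> curv B' X Y = a^T *m curv B X Y *m a.
  move=> sX sY; rewrite /curv /dform !aA//; last exact: lieb_su3.
  move: (cform B (lieb X Y)) (cform B X) (cform B Y) => L A C.
  rewrite /lieb mulmxDr mulmxDl mulmxN mulNmx mulmxBr mulmxBl; congr (_ + (_ - _)).
    by rewrite !mulmxA -(mulmxA _ a) aaT mulmx1.
  by rewrite !mulmxA -(mulmxA _ a) aaT mulmx1.
split.
  move=> Z W TZ TW; apply/ext2_curvC_eq0.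
  have [[[sZ1 sZ2] _] [[sW1 sW2] _]] := (TZ, TW).
  have [E1 E2] := (ext2_curvC_eq0 _ _ _).1 (F02 _ _ TZ TW).
  by rewrite !cE// E1 E2 mulmxN mulNmx.
move=> X sX; have := Fw X sX; rewrite /curv_omega2.
set s := \sum_ _ _ => s0.
have {}s0 : s = 0.
  by move/eqP: s0; rewrite scaler_eq0 invr_eq0 pnatr_eq0 /= => /eqP.
apply/eqP; rewrite scaler_eq0; apply/orP; right; apply/eqP.
transitivity (map_mx (real_complex R) a^T *m s *m map_mx (real_complex R) a); last first.
  by rewrite s0 mulmx0 mul0mx.
rewrite /s mulmx_sumr mulmx_suml; apply: eq_bigr => p _.
by rewrite /curvC cE// !map_mxM /= -scalemxAr -scalemxAl.
Qed.

(** For e = 1 a rotation about T_1; for e = -1 it also reverses T_1, and thereby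
exchanges the bundles of beta and -beta. *)
Definition gauge_mx (R : realType) (e x y : R) : 'M[R]_3 :=
  mx3 [:: [:: e; 0; 0]; [:: 0; - (e * y); e * x]; [:: 0; - x; - y]].

Lemma gauge_mx_SO3 (R : realType) (e x y : R) :
  e ^+ 2 = 1 -> x ^+ 2 + y ^+ 2 = 1 -> SO3 (gauge_mx e x y).
Proof.
move=> ee xy; have yx : y ^+ 2 = 1 - x ^+ 2 by rewrite -xy; ring.
split; last by rewrite det3 !mx3E; ring: ee yx.
by apply: mx3P; rewrite !mulmx3 /gauge_mx ![_^T _ _]mxE !mx3E !mxE /=; split; ring: ee yx.
Qed.

Lemma gauge_mx_so3 (R : realType) (e x y p q r : R) :
  e ^+ 2 = 1 -> x ^+ 2 + y ^+ 2 = 1 ->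
  (gauge_mx e x y)^T *m so3 p q r *m gauge_mx e x y =
  so3 (e * p) (- (e * y * q) - x * r) (e * x * q - y * r).
Proof.
move=> ee xy; have yx : y ^+ 2 = 1 - x ^+ 2 by rewrite -xy; ring.
rewrite !so3E; apply: mx3P; rewrite !mulmx3 /gauge_mx ![_^T _ _]mxE !mx3E.
all: by split; ring: ee yx.
Qed.

(** The similarity from V_j to the plane of T_2 and T_3 given by [conn_structure] is c
times an isometry, and [gauge_mx] turns this isometry into the standard one. *)
Lemma conn_normalize (R : realType) (B : conn R) : is_conn B -> ~ reducible B ->
  exists j : 'I_3, exists2 c : R, 0 < c & const_gauge (root_conn j c) B.
Proof.
move=> cB nB; have [flat|] := conn_structure cB.
  by exfalso; exact: nB (torus_conn_reducible flat).
move=> [j [s [b [d [bd kE lE fE]]]]]; exists j.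
pose c := Num.sqrt (b ^+ 2 + d ^+ 2).
have bd0 : 0 < b ^+ 2 + d ^+ 2.
  rewrite lt_neqAle addr_ge0 ?sqr_ge0// andbT eq_sym.
  by apply: contraL bd => /eqP/sqr2_eq0[-> ->]; rewrite eqxx.
have c0 : 0 < c by rewrite sqrtr_gt0.
have cc : c ^+ 2 = b ^+ 2 + d ^+ 2 by rewrite sqr_sqrtr// ltW.
exists c => //.
have u0 : (b / c) ^+ 2 + (d / c) ^+ 2 = 1.
  by rewrite !expr_div_n -mulrDl -cc divff// expf_neq0// gt_eqF.
have [x [y [xy bE dE]]] : exists x y, [/\ x ^+ 2 + y ^+ 2 = 1, b = c * x & d = c * y].
  by exists (b / c), (d / c); split=> //; field; rewrite gt_eqF.
clear u0 cc bd0 bd; clearbody c; subst b d.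
have wE X : su3 X -> weight (wk B) (wl B) X = (-1) ^+ s * root_form j X.
  by move=> sX; rewrite -weight_root_form// /weight kE lE !rmorphM !rmorph_sign; ring.
pose e : R := (-1) ^+ s; have ee : e ^+ 2 = 1 by rewrite sqrr_sign.
have chE (t : 'M[R[i]]_3) : T2 t ->
    complex.Re (character (wk B) (wl B) t) =
      complex.Re (character (root_k j) (root_l j) t) /\
    complex.Im (character (wk B) (wl B) t) =
      e * complex.Im (character (root_k j) (root_l j) t).
  move=> tT; rewrite kE lE /e; case: (s); last by rewrite !expr0 !mul1r.
  have -> : character ((-1) ^+ true * root_k j) ((-1) ^+ true * root_l j) t =
      conjc (character (root_k j) (root_l j) t).
    rewrite -conj_unit_inv; last exact: character_unit.
    by rewrite !expr1 !mulN1r /character -!invr_expz invfM.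
  by case: (character _ _ t) => p q /=; rewrite mulN1r.
exists (gauge_mx e x y); split; first exact: gauge_mx_SO3.
- move=> t tT; rewrite /lam; have [-> ->] := chE t tT.
  move: (complex.Re _) (complex.Im _) => p q; rewrite /gauge_mx.
  by apply: mx3P; rewrite !mulmx3 !mx3E; split; ring: ee.
- move=> X sX; rewrite root_conn_so3// gauge_mx_so3// fE// wE// -/e.
  rewrite -[_ *: soT1 R]addr0 -[X in _ + X + _](scale0r (soT2 R)).
  rewrite -[_ + 0 *: _]addr0 -[X in _ + X + _](scale0r (soT3 R)) -/(so3 _ 0 0).
  rewrite -[so3 _ 0 0]scale1r -[X in _ + X]scale1r so3_lin.
  by congr so3; ring.
Qed.

(** * The Weyl group *)

(** The sign makes the determinant 1. *)
Definition weyl_mx (R : realType) (s : 'S_3) : 'M[R[i]]_3 := (-1) ^+ s *: perm_mx s^-1%g.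

Lemma weyl_mxV (R : realType) (s : 'S_3) :
  weyl_mx R s *m ((-1) ^+ s *: perm_mx s) = 1%:M.
Proof.
rewrite /weyl_mx -scalemxAl -scalemxAr scalerA -expr2 sqrr_sign scale1r.
by rewrite -perm_mxM mulVg perm_mx1.
Qed.

Lemma AdinvE (R : realType) (s : 'S_3) (X : 'M[R[i]]_3) i j :
  Adinv (weyl_mx R s) X i j = X (s i) (s j).
Proof.
have nV := weyl_mxV R s; have [nU _] := mulmx1_unit nV.
have -> : Adinv (weyl_mx R s) X = row_perm s (col_perm s X).
  rewrite /Adinv -[invmx _]mulmx1 -nV mulKmx// /weyl_mx -!scalemxAl -scalemxAr scalerA.
  by rewrite -expr2 sqrr_sign scale1r row_permE col_permE mulmxA.
by rewrite !mxE.
Qed.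

Lemma weyl_mx_SU3 (R : realType) (s : 'S_3) : SU3 (weyl_mx R s).
Proof.
split; last first.
  by rewrite detZ det_perm odd_permV; case: (odd_perm s); rewrite ?expr0 ?expr1; ring.
apply/unitarymxP; rewrite -(weyl_mxV R s); congr (_ *m _).
apply/matrixP => i j; rewrite !mxE rmorphM rmorph_sign; congr (_ * _).
by rewrite rmorph_nat; congr (_%:R); rewrite -(inj_eq (@perm_inj _ s)) permKV eq_sym.
Qed.

Lemma Adinv_su3 (R : realType) (s : 'S_3) (X : 'M[R[i]]_3) :
  su3 X <-> su3 (Adinv (weyl_mx R s) X).
Proof.
split=> sX; have [_ tX] := sX; apply: su3P.
- by move=> i j; rewrite !AdinvE; exact: su3_skew.
- rewrite -tX /mxtrace [RHS](reindex_inj (@perm_inj _ s)).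
  by apply: eq_bigr => i _; rewrite AdinvE.
- move=> i j; have := su3_skew (s^-1 i)%g (s^-1 j)%g sX.
  by rewrite !AdinvE !permKV.
- rewrite -tX /mxtrace [LHS](reindex_inj (@perm_inj _ s)).
  by apply: eq_bigr => i _; rewrite AdinvE.
Qed.

Lemma weyl_pullback_alpha (R : realType) (s : 'S_3) (S S' : ahs R) :
  (forall k X, su3 X -> alpha S k (Adinv (weyl_mx R s) X) = alpha S' (s k) X) ->
  weyl_pullback (weyl_mx R s) S S'.
Proof.
move=> H; split.
- exact: weyl_mx_SU3.
- move=> t [[ut dt] /is_diag_mxP td].
  have nS := weyl_mx_SU3 R s; have [nu dn] := nS.
  have iE : invmx (weyl_mx R s) = (weyl_mx R s)^t*%sesqui.
    have /unitarymxP nn := nu; have [nU _] := mulmx1_unit nn.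
    by rewrite -[RHS](mulKmx nU) nn mulmx1.
  split; [split|].
  + have ns : (weyl_mx R s)^t*%sesqui \is unitarymx by rewrite trmxC_unitary.
    by rewrite /Adinv iE; exact: mul_unitarymx (mul_unitarymx ns ut) nu.
  + have [nU _] := mulmx1_unit (weyl_mxV R s).
    by rewrite /Adinv !det_mulmx det_inv dn dt invr1 !mulr1.
  + apply/is_diag_mxP => i j ij; rewrite AdinvE; apply: td.
    by apply: contra_neq ij => /val_inj/perm_inj ->.
- move=> Z [s1 s2].
  have E k : ext1 (alpha S k) (Adinv (weyl_mx R s) Z.1, Adinv (weyl_mx R s) Z.2) =
      ext1 (alpha S' (s k)) Z.
    by rewrite /ext1; congr (_ + _ *: _); exact: H.
  split=> -[_ HZ]; split=> [|k]; first by split.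
  + by have := HZ (s^-1 k)%g; rewrite E permKV.
  + by split; apply: (Adinv_su3 _ _).1.
  + by rewrite E.
- move=> X Y sX sY; rewrite /omega; congr (_ * _).
  rewrite [RHS](reindex_inj (@perm_inj _ s)); apply: eq_bigr => k _.
  by rewrite (H k X sX) (H k Y sY).
Qed.

(** Exactly one index carries the odd sign.  A translation of the indices moves it to
the last place.  If the two other signs are -1, a reflection k |-> c - k is used
instead: it maps theta_k + i eta_k to the negative of a conjugate, which reverses
all signs. *)
Lemma weyl_to_Ji (R : realType) (S : ahs R) : is_ahs S ->
  ~ (forall j, signs S j = signs S 0) ->
  exists n A1 A2 A3,
    [/\ 0 < A1, 0 < A2, 0 < A3 & weyl_pullback n S (Ji A1 A2 A3)].
Proof.
move=> aS ne.
have [c [tw|tw]] : exists c : 'I_3,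
    (forall k, signs S k = tri 1 1 (-1) (c + k)) \/
    (forall k, signs S k = - tri 1 1 (-1) (c - k)).
  have [[_ e0] [[_ e1] [_ e2]]] := (aS 0, (aS 1, aS 2)).
  case: e0 => E0; case: e1 => E1; case: e2 => E2.
  all: try by exfalso; apply: ne; apply: ord3P; rewrite ?E0 ?E1 ?E2.
  - by exists 0; left; apply: ord3P; rewrite ?E0 ?E1 ?E2.
  - by exists 1; left; apply: ord3P; rewrite ?E0 ?E1 ?E2.
  - by exists 2; right; apply: ord3P; rewrite ?E0 ?E1 ?E2 /tri /= ?opprK.
  - by exists 2; left; apply: ord3P; rewrite ?E0 ?E1 ?E2.
  - by exists 0; right; apply: ord3P; rewrite ?E0 ?E1 ?E2 /tri /= ?opprK.
  - by exists 1; right; apply: ord3P; rewrite ?E0 ?E1 ?E2 /tri /= ?opprK.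
- pose s : 'S_3 := perm (@addrI _ c).
  have sE k : s k = c + k by rewrite permE.
  exists (weyl_mx R s), (sizes S (0 - c)), (sizes S (1 - c)), (sizes S (2 - c)).
  split; try by have [] := aS (0 - c); have [] := aS (1 - c); have [] := aS (2 - c).
  apply: weyl_pullback_alpha => k X sX.
  have zE : sizes (Ji (sizes S (0 - c)) (sizes S (1 - c)) (sizes S (2 - c))) (s k) = sizes S k.
    have kE : k = s k - c by rewrite sE addrAC subrr add0r.
    by rewrite [in RHS]kE; elim/ord3P: (s k).
  rewrite /alpha zE /= /eta /theta !AdinvE !sE tw !addrA.
  by [].
- pose s : 'S_3 := perm (can_inj (subKr c)).
  have sE k : s k = c - k by rewrite permE.
  exists (weyl_mx R s), (sizes S (c - 0)), (sizes S (c - 1)), (sizes S (c - 2)).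
  split; try by have [] := aS (c - 0); have [] := aS (c - 1); have [] := aS (c - 2).
  apply: weyl_pullback_alpha => k X sX.
  have zE : sizes (Ji (sizes S (c - 0)) (sizes S (c - 1)) (sizes S (c - 2))) (s k) = sizes S k.
    have kE : k = c - s k by rewrite sE subKr.
    by rewrite [in RHS]kE; elim/ord3P: (s k).
  have e1 : s (k + 1) = s k + 2.
    by rewrite !sE opprD addrA; congr (_ + _); exact: val_inj.
  have e2 : s (k + 2) = s k + 1.
    by rewrite !sE opprD addrA; congr (_ + _); exact: val_inj.
  rewrite /alpha zE /= {1}/eta {1}/theta !AdinvE e1 e2 !(su3E (s k) sX) /= tw -sE.
  by rewrite mulNr mulrN opprK.
Qed.

Lemma Ji_ahs (R : realType) (A1 A2 A3 : R) :
  0 < A1 -> 0 < A2 -> 0 < A3 -> is_ahs (Ji A1 A2 A3).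
Proof. by move=> ? ? ?; apply: ord3P => /=; split=> //; rewrite /tri /=; auto. Qed.

(** * Irreducible Hermitian Yang-Mills connections *)

(** The half-turn about T_1 reverses T_2 and T_3. *)
Lemma root_conn_opp (R : realType) (j : 'I_3) (c : R) :
  const_gauge (root_conn j (- c)) (root_conn j c).
Proof.
have e1 : (1 : R) ^+ 2 = 1 by rewrite expr1n.
have xy : (0 : R) ^+ 2 + 1 ^+ 2 = 1 by rewrite expr0n expr1n add0r.
exists (gauge_mx 1 0 1); split; first exact: gauge_mx_SO3.
- move=> t _; rewrite /lam /= /gauge_mx; move: (complex.Re _) (complex.Im _) => p q.
  by apply: mx3P; rewrite !mulmx3 !mx3E; split; ring.
- by move=> X sX; rewrite !root_conn_so3// gauge_mx_so3//; congr so3; ring.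
Qed.

Lemma irreducible_HYM_root_conn (R : realType) (S : ahs R) (B : conn R) :
  is_ahs S -> irreducible_HYM S B ->
  exists j : 'I_3, exists c : R,
    [/\ 0 < c, const_gauge (root_conn j c) B, signs S (j + 1) * signs S (j + 2) = -1 &
     2 * (1 - c ^+ 2) * (omega_coef S (j + 1) * omega_coef S (j + 2)) =
       omega_coef S j * (omega_coef S (j + 1) + omega_coef S (j + 2))].
Proof.
move=> aS [cB hB nB]; have [j [c c0 gB]] := conn_normalize cB nB.
exists j, c; have /(HYM_root_conn _ _ aS)[[ce|e] E] :=
  const_gauge_HYM (const_gauge_sym gB) hB; last by split.
by rewrite ce ltxx in c0.
Qed.

Lemma omega_coef_neq0 (R : realType) (S : ahs R) (j : 'I_3) :
  is_ahs S -> omega_coef S j != 0.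
Proof.
move=> aS; have [A0 e] := aS j; rewrite /omega_coef mulf_neq0//.
  by case: e => ->; rewrite ?oppr_eq0 oner_neq0.
by rewrite expf_neq0// gt_eqF.
Qed.

(** Two of the three signs agree, so an index z is excluded, and two of any three
connections belong to the same index; the amplitude is a function of the index. *)
Lemma irreducible_HYM_at_most_two (R : realType) (S : ahs R) (B : 'I_3 -> conn R) :
  is_ahs S -> (forall i, irreducible_HYM S (B i)) ->
  exists i j : 'I_3, i != j /\ gauge_equiv (B i) (B j).
Proof.
move=> aS hB.
have same i i' j c c' : i != i' -> 0 < c -> 0 < c' ->
    const_gauge (root_conn j c) (B i) -> const_gauge (root_conn j c') (B i') ->
    2 * (1 - c ^+ 2) * (omega_coef S (j + 1) * omega_coef S (j + 2)) =
       omega_coef S j * (omega_coef S (j + 1) + omega_coef S (j + 2)) ->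
    2 * (1 - c' ^+ 2) * (omega_coef S (j + 1) * omega_coef S (j + 2)) =
       omega_coef S j * (omega_coef S (j + 1) + omega_coef S (j + 2)) ->
    exists i j : 'I_3, i != j /\ gauge_equiv (B i) (B j).
  move=> ii c0 c'0 g g' E E'; exists i, i'; split=> //; apply: const_gauge_equiv.
  have W0 : omega_coef S (j + 1) * omega_coef S (j + 2) != 0
    by rewrite mulf_neq0 ?omega_coef_neq0.
  have : c ^+ 2 = c' ^+ 2.
    by have := mulIf W0 (etrans E (esym E')); lra.
  move/eqP; rewrite eqrXn2 ?ltW// => /eqP cc; rewrite cc in g.
  exact: const_gauge_trans (const_gauge_sym g) g'.
have [j0 [c0 [p0 g0 s0 E0]]] := irreducible_HYM_root_conn aS (hB 0).
have [j1 [c1 [p1 g1 s1 E1]]] := irreducible_HYM_root_conn aS (hB 1).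
have [j2 [c2 [p2 g2 s2 E2]]] := irreducible_HYM_root_conn aS (hB 2).
have [z zE] : exists z : 'I_3, signs S (z + 1) * signs S (z + 2) = 1.
  have [[_ e0] [[_ e1] [_ e2]]] := (aS 0, (aS 1, aS 2)).
  case: e0 => e0; case: e1 => e1; case: e2 => e2;
  by [exists 0; rewrite ?add0r ?addI3 ?e0 ?e1 ?e2; ring|
      exists 1; rewrite ?add0r ?addI3 ?e0 ?e1 ?e2; ring|
      exists 2; rewrite ?add0r ?addI3 ?e0 ?e1 ?e2; ring].
have nz k : signs S (k + 1) * signs S (k + 2) = -1 -> k != z.
  by move=> E; apply/eqP => kz; move: zE; rewrite -kz E; lra.
have : [|| j0 == j1, j0 == j2 | j1 == j2].
  move: (nz _ s0) (nz _ s1) (nz _ s2); clear.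
  by elim/ord3P: j0; elim/ord3P: j1; elim/ord3P: j2; elim/ord3P: z.
case/or3P => /eqP e.
- by rewrite e in g0 E0; exact: (same 0 1 j1 c0 c1).
- by rewrite e in g0 E0; exact: (same 0 2 j2 c0 c2).
- by rewrite e in g1 E1; exact: (same 1 2 j2 c1 c2).
Qed.

(** The value of c^2 that F /\ omega^2 = 0 prescribes. *)
Definition amplitude2 (R : realType) (S : ahs R) (j : 'I_3) : R :=
  1 - omega_coef S j * (1 / (2 * omega_coef S (j + 1)) + 1 / (2 * omega_coef S (j + 2))).

Lemma amplitude2P (R : realType) (S : ahs R) (j : 'I_3) (c : R) : is_ahs S ->
  2 * (1 - c ^+ 2) * (omega_coef S (j + 1) * omega_coef S (j + 2)) =
    omega_coef S j * (omega_coef S (j + 1) + omega_coef S (j + 2)) <->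
  c ^+ 2 = amplitude2 S j.
Proof.
move=> aS; rewrite /amplitude2.
have := omega_coef_neq0 (j + 1) aS; have := omega_coef_neq0 (j + 2) aS.
move: (omega_coef S j) (omega_coef S (j + 1)) (omega_coef S (j + 2)) => u v w w0 v0.
split=> [E|->].
  have {}E : 1 - c ^+ 2 = u * (v + w) / (2 * (v * w)).
    by rewrite -E; field; rewrite v0 w0.
  have -> : c ^+ 2 = 1 - (1 - c ^+ 2) by ring.
  by rewrite E; field; rewrite v0 w0.
by field; rewrite v0 w0.
Qed.

Lemma signed_sqrt_sq (R : realType) (b : bool) (x : R) : 0 <= x ->
  ((-1) ^+ b * Num.sqrt x) ^+ 2 = x.
Proof. by move=> x0; rewrite exprMn sqrr_sign mul1r sqr_sqrtr. Qed.

Lemma root_conn_irreducible_HYM (R : realType) (S : ahs R) (j : 'I_3) (b : bool) :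
  is_ahs S -> signs S (j + 1) * signs S (j + 2) = -1 -> 0 < amplitude2 S j ->
  irreducible_HYM S (root_conn j ((-1) ^+ b * Num.sqrt (amplitude2 S j))).
Proof.
move=> aS e a0; split; first exact: root_conn_is_conn.
  apply/(HYM_root_conn _ _ aS); split; first by right.
  by apply/(amplitude2P _ _ aS); rewrite signed_sqrt_sq// ltW.
by apply: root_conn_irreducible; rewrite mulf_neq0 ?signr_eq0// gt_eqF// sqrtr_gt0.
Qed.

Lemma irreducible_HYM_classified (R : realType) (S : ahs R) (B : conn R) :
  is_ahs S -> irreducible_HYM S B ->
  exists j : 'I_3, [/\ signs S (j + 1) * signs S (j + 2) = -1, 0 < amplitude2 S j &
    forall b : bool, gauge_equiv (root_conn j ((-1) ^+ b * Num.sqrt (amplitude2 S j))) B].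
Proof.
move=> aS hB.
have [j [c [c0 g e /(amplitude2P _ _ aS) E]]] := irreducible_HYM_root_conn aS hB.
exists j; rewrite -E; split=> //; first by rewrite exprn_gt0.
move=> b; apply: const_gauge_equiv; rewrite sqrtr_sqr gtr0_norm//.
case: b; last by rewrite mul1r.
by rewrite mulN1r; exact: const_gauge_trans (root_conn_opp j c) g.
Qed.

Lemma root_conn0_reducible (R : realType) (j : 'I_3) : reducible (@root_conn R j 0).
Proof.
apply: torus_conn_reducible => X sX.
by rewrite /= scale0r addr0 scalerA.
Qed.

(** * The structure J^i *)

Lemma amplitude2_Ji (R : realType) (A1 A2 A3 : R) : 0 < A1 -> 0 < A2 -> 0 < A3 ->
  amplitude2 (Ji A1 A2 A3) 0 = 1 - A1 ^+ 2 * (1 / (2 * A2 ^+ 2) - 1 / (2 * A3 ^+ 2)) /\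
  amplitude2 (Ji A1 A2 A3) 1 = 1 + A2 ^+ 2 * (1 / (2 * A3 ^+ 2) - 1 / (2 * A1 ^+ 2)).
Proof.
move=> p1 p2 p3; rewrite /amplitude2 /omega_coef ?add0r ?addI3 /= /tri /= ?mul1r ?mulN1r.
by split; field; rewrite !gt_eqF.
Qed.

Lemma slope_Ji (R : realType) (A1 A2 A3 : R) : 0 < A1 -> 0 < A2 -> 0 < A3 ->
  slope (Ji A1 A2 A3) 1 2 = - (4 / 3 * A1 ^- 2 * amplitude2 (Ji A1 A2 A3) 0) /\
  slope (Ji A1 A2 A3) (-2) (-1) = - (4 / 3 * A2 ^- 2 * amplitude2 (Ji A1 A2 A3) 1).
Proof.
move=> p1 p2 p3; have [-> ->] := amplitude2_Ji p1 p2 p3.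
rewrite /slope /= /tri /= rmorphB /= !rmorphN /=.
by split; field; rewrite !gt_eqF.
Qed.

Lemma amplitude2_Ji_cleared (R : realType) (A1 A2 A3 : R) : 0 < A1 -> 0 < A2 -> 0 < A3 ->
  2 * A2 ^+ 2 * A3 ^+ 2 - A1 ^+ 2 * (A3 ^+ 2 - A2 ^+ 2) =
    2 * A2 ^+ 2 * A3 ^+ 2 * amplitude2 (Ji A1 A2 A3) 0 /\
  2 * A3 ^+ 2 * A1 ^+ 2 - A2 ^+ 2 * (A3 ^+ 2 - A1 ^+ 2) =
    2 * A3 ^+ 2 * A1 ^+ 2 * amplitude2 (Ji A1 A2 A3) 1.
Proof.
move=> p1 p2 p3; have [-> ->] := amplitude2_Ji p1 p2 p3.
by split; field; rewrite !gt_eqF.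
Qed.

Lemma slope_Ji_lt0 (R : realType) (A1 A2 A3 : R) : 0 < A1 -> 0 < A2 -> 0 < A3 ->
  (slope (Ji A1 A2 A3) 1 2 < 0) = (0 < amplitude2 (Ji A1 A2 A3) 0) /\
  (slope (Ji A1 A2 A3) (-2) (-1) < 0) = (0 < amplitude2 (Ji A1 A2 A3) 1).
Proof.
move=> p1 p2 p3; have [-> ->] := slope_Ji p1 p2 p3.
have f (x : R) : 0 < x -> 0 < 4 / 3 * x ^- 2.
  by move=> x0; rewrite mulr_gt0 ?divr_gt0// invr_gt0 exprn_gt0.
by rewrite !oppr_lt0 (pmulr_rgt0 _ (f _ p1)) (pmulr_rgt0 _ (f _ p2)).
Qed.

Local Close Scope complex_scope.
Local Close Scope classical_set_scope.
Unset Implicit Arguments.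

Theorem theorem2 (R : realType) :
  (forall S : ahs R, is_ahs S -> integrable_ahs S ->
     (exists n A1 A2 A3,
        [/\ 0 < A1, 0 < A2, 0 < A3 & weyl_pullback n S (Ji A1 A2 A3)]) /\
     (forall B : 'I_3 -> conn R, (forall i, irreducible_HYM S (B i)) ->
        exists i j : 'I_3, i != j /\ gauge_equiv (B i) (B j))) /\
  (forall A1 A2 A3 : R, 0 < A1 -> 0 < A2 -> 0 < A3 ->
     let S := Ji A1 A2 A3 in
     [/\ integrable_ahs S,
         (slope S 1 2 < 0 <->
            A1 ^+ 2 * (A3 ^+ 2 - A2 ^+ 2) < 2 * A2 ^+ 2 * A3 ^+ 2) /\
         (slope S (-2) (-1) < 0 <->
            A2 ^+ 2 * (A3 ^+ 2 - A1 ^+ 2) < 2 * A3 ^+ 2 * A1 ^+ 2),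
         (slope S 1 2 < 0 ->
            forall b, irreducible_HYM S (conn_r1 A1 A2 A3 b)) /\
         (slope S (-2) (-1) < 0 ->
            forall b, irreducible_HYM S (conn_r2 A1 A2 A3 b)),
         forall B : conn R, irreducible_HYM S B ->
           (slope S 1 2 < 0 /\ forall b, gauge_equiv (conn_r1 A1 A2 A3 b) B) \/
           (slope S (-2) (-1) < 0 /\
              forall b, gauge_equiv (conn_r2 A1 A2 A3 b) B)
       & (A1 ^+ 2 * (A3 ^+ 2 - A2 ^+ 2) = 2 * A2 ^+ 2 * A3 ^+ 2 ->
            forall b, is_conn (conn_r1 A1 A2 A3 b) /\
                      reducible (conn_r1 A1 A2 A3 b)) /\
         (A2 ^+ 2 * (A3 ^+ 2 - A1 ^+ 2) = 2 * A3 ^+ 2 * A1 ^+ 2 ->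
            forall b, is_conn (conn_r2 A1 A2 A3 b) /\
                      reducible (conn_r2 A1 A2 A3 b))]).
Proof.
split=> [S aS iS|A1 A2 A3 p1 p2 p3 S].
  split; first exact: weyl_to_Ji aS (integrable_signs aS iS).
  by move=> B; exact: irreducible_HYM_at_most_two.
have aS : is_ahs S := Ji_ahs p1 p2 p3.
have [a1E a2E] := amplitude2_Ji p1 p2 p3.
have [sl1 sl2] := slope_Ji_lt0 p1 p2 p3.
have [cl1 cl2] := amplitude2_Ji_cleared p1 p2 p3.
have c1E b : conn_r1 A1 A2 A3 b = root_conn 0 ((-1) ^+ b * Num.sqrt (amplitude2 S 0)).
  by rewrite a1E.
have c2E b : conn_r2 A1 A2 A3 b = root_conn 1 ((-1) ^+ b * Num.sqrt (amplitude2 S 1)).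
  by rewrite a2E.
have g0 (x y : R) : 0 < x -> 0 < y -> 0 < 2 * x ^+ 2 * y ^+ 2.
  by move=> x0 y0; rewrite !mulr_gt0 ?exprn_gt0.
rewrite sl1 sl2; split.
- apply: signs_integrable => // /(_ 2) /=; rewrite /tri /=; lra.
- by split; rewrite -[X in _ <-> is_true X]subr_gt0 ?cl1 ?cl2 pmulr_rgt0//; exact: g0.
- split=> a b; [rewrite c1E|rewrite c2E];
    apply: root_conn_irreducible_HYM => //; by rewrite /= ?mul1r ?mulr1.
- move=> B /(irreducible_HYM_classified aS)[j [e a g]].
  move: e a g; elim/ord3P: j => e a g.
  + by left; split=> // b; rewrite c1E.
  + by right; split=> // b; rewrite c2E.
  + by move: e; rewrite /= ?addI3 /tri /=; lra.
- split=> E b.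
    have a0 : amplitude2 S 0 = 0.
      apply/eqP; move/eqP: cl1; rewrite E subrr eq_sym mulf_eq0.
      by rewrite (gt_eqF (g0 _ _ p2 p3)).
    rewrite c1E a0 sqrtr0 mulr0; split; first exact: root_conn_is_conn.
    exact: root_conn0_reducible.
  have a0 : amplitude2 S 1 = 0.
    apply/eqP; move/eqP: cl2; rewrite E subrr eq_sym mulf_eq0.
    by rewrite (gt_eqF (g0 _ _ p3 p1)).
  rewrite c2E a0 sqrtr0 mulr0; split; first exact: root_conn_is_conn.
  exact: root_conn0_reducible.
Qed.
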